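(* Let $\Omega\subset\mathbb{R}^n$ be open and bounded, let $p\in[1,\infty)$, $k\in\{0,\dots,n\}$, and let $\omega\in L^p(\wedge^kT^*\Omega)$, where $\omega$ is extended to an element of $L^p(\wedge^kT^*\mathbb{R}^n)$ by setting $\omega=0$ outside $\Omega$. Then $$\|I_\omega\|_{L^pM^k(\Omega)}=\lim_{\theta\to1^-}\left(\int_{\Omega^{k+1}}\frac{(1-\theta)^k|I_\omega(x_0,\dots,x_k)|^p}{\left(|x_1-x_0|\,|x_2-x_0|\cdots|x_k-x_0|\right)^{n+\theta p}}\,dx_0\cdots dx_k\right)^{1/p}$$ (in particular the limit exists). Moreover, there exists a constant $K$ depending only on $n$, $p$ and $k$ such that $\|I_\omega\|_{L^pM^k(\Omega)}=K\,\bigl\||\omega|_{\mathbb{S},p}\bigr\|_{L^p(\Omega)}$. In particular, $\|I_\omega\|_{L^pM^k(\Omega)}$ is uniformly comparable with $\|\omega\|_{L^p(\Omega)}$, with comparison constants depending only on $n$, $p$ and $k$.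
   Context: Differential forms. For $U\subset\mathbb{R}^n$ open, a measurable $k$-form is $\omega=\sum_I \omega_I\,dx_{I_1}\wedge\dots\wedge dx_{I_k}$ with $I=(I_1<\dots<I_k)$ and measurable coefficients; its pointwise norm is $|\omega_x|=(\sum_I|\omega_I(x)|^2)^{1/2}$. $L^p(\wedge^kT^*U)$ is the space of (a.e.-equivalence classes of) measurable $k$-forms with $\|\omega\|_{L^p(U)}:=\||\omega|\|_{L^p(U)}<\infty$. Forms are regarded as alternating multilinear maps, with $(dx_{1}\wedge\dots\wedge dx_{k})(e_1,\dots,e_k)=1$. Integration function. Let $\Delta_k=\{s\in\mathbb{R}^k: s_i\ge0,\ s_1+\dots+s_k\le1\}$ and $\phi_{x_0,\dots,x_k}(s)=x_0+\sum_{i=1}^k s_i(x_i-x_0)$; $\Delta(x_0,\dots,x_k)$ is the oriented simplex $\phi_{x_0,\dots,x_k}(\Delta_k)$. Choosing a Borel representative of the zero-extended form $\omega$, the integration function is $$I_\omega(x_0,\dots,x_k)=\int_{\Delta(x_0,\dots,x_k)}\omega=\int_{\Delta_k}\phi_{x_0,\dots,x_k}^*\omega=\int_{\Delta_k}\omega_{\phi_{x_0,\dots,x_k}(s)}(x_1-x_0,\dots,x_k-x_0)\,ds .$$ It is defined and finite for a.e. $(x_0,\dots,x_k)\in\Omega^{k+1}$, and is independent of the representative up to null-sets. For $k=0$, $I_\omega(x_0)=\omega(x_0)$. Seminorm. For measurable $F:\Omega^{k+1}\to\mathbb{R}$, $$\|F\|_{L^pM^k(\Omega)}^p=\limsup_{\theta\to1^-}\int_{\Omega^{k+1}}\frac{(1-\theta)^k|F(x_0,\dots,x_k)|^p}{(|x_1-x_0|\cdots|x_k-x_0|)^{n+\theta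 p}}\,dx_0\cdots dx_k\in[0,\infty],$$ with empty products equal to $1$. Norm $|\cdot|_{\mathbb{S},p}$. For an alternating $k$-linear form $\alpha$ on $\mathbb{R}^n$, $$|\alpha|_{\mathbb{S},p}^p=\int_{\{|v_1|=\dots=|v_k|=1\}}|\alpha(v_1,\dots,v_k)|^p\,d\mathcal{H}^{n-1}(v_1)\cdots d\mathcal{H}^{n-1}(v_k)$$ (and $|\alpha|_{\mathbb{S},p}=|\alpha|$ if $k=0$), with $\mathcal{H}^{n-1}$ the $(n-1)$-dimensional Hausdorff measure on the unit sphere; $|\omega|_{\mathbb{S},p}$ is the function $x\mapsto|\omega_x|_{\mathbb{S},p}$. *)

(* Defs.v *)
From HB Require Import structures.
From mathcomp Require Import all_boot all_order all_algebra.
From mathcomp Require Import all_classical all_reals all_analysis.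
From mathcomp Require Import measurable_realfun lra.
Set Implicit Arguments.
Unset Strict Implicit.
Unset Printing Implicit Defensive.
Import Order.TTheory GRing.Theory Num.Def Num.Theory.
Import numFieldNormedType.Exports.
Local Open Scope classical_set_scope.
Local Open Scope ring_scope.

Definition rV_borel_display : measure_display.
Proof. by constructor. Qed.

Section rV_borel.
Context {R : realType} {n : nat}.

(* The topology of 'rV[R]_n is that of the sup norm: its open sets are the
   Euclidean ones. *)
Definition rV_borel : set (set 'rV[R]_n) := <<s open >>.

Let borel0 : rV_borel set0. Proof. exact: sigma_algebra0. Qed.

Let borelC A : rV_borel A -> rV_borel (~` A).
Proof. exact: sigma_algebraC. Qed.

Let borel_bigcup (F : (set 'rV[R]_n)^nat) :
  (forall i, rV_borel (F i)) -> rV_borel (\bigcup_i F i).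
Proof. exact: sigma_algebra_bigcup. Qed.

HB.instance Definition _ := @isMeasurable.Build rV_borel_display 'rV[R]_n
  rV_borel borel0 borelC borel_bigcup.

Lemma open_rV_measurable (A : set 'rV[R]_n) : open A -> measurable A.
Proof. by move=> oA; apply: sub_sigma_algebra. Qed.

Lemma sigma_algebra_open_rV (S : set (set 'rV[R]_n)) :
  sigma_algebra setT S ->
  (forall i a, S [set v : 'rV[R]_n | v ord0 i < a]) ->
  (forall i a, S [set v : 'rV[R]_n | a < v ord0 i]) ->
  (@open 'rV[R]_n) `<=` S.
Proof.
move=> sS Slt Sgt A oA.
pose U := g_sigma_algebraType S.
have SE : (measurable : set (set U)) = S by exact: sigma_algebra_id.
rewrite -SE.
pose box (qm : 'rV[rat]_n * nat) : set U :=
  [set v : 'rV[R]_n | forall i, ratr (qm.1 ord0 i) - qm.2.+1%:R^-1 < v ord0 i /\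
     v ord0 i < ratr (qm.1 ord0 i) + qm.2.+1%:R^-1].
have mbox qm : measurable (box qm).
  have -> : box qm = \bigcap_(i in [set: 'I_n])
      ([set v : 'rV[R]_n | ratr (qm.1 ord0 i) - qm.2.+1%:R^-1 < v ord0 i] `&`
       [set v | v ord0 i < ratr (qm.1 ord0 i) + qm.2.+1%:R^-1] : set U).
    by apply/seteqP; split=> [v bv i _ /=|v bv i]; [exact: bv|exact: bv].
  apply: fin_bigcap_measurable => [|i _]; first exact: finite_finset.
  by apply: (@measurableI _ U); rewrite SE; [exact: Sgt|exact: Slt].
pose F qm := if `[< box qm `<=` A >] then box qm else set0.
have -> : A = \bigcup_qm F qm.
  apply/seteqP; split=> [x Ax|x [qm _]]; last first.
    by rewrite /F; case: ifPn => // /asboolP qmA; exact: qmA.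
  have := open_nbhs_nbhs (conj oA Ax).
  move=> /nbhs_ballP[e /= e0 xeA].
  have [m mP] : exists m : nat, m.+1%:R^-1 < e / 2.
    have e20 : 0 < e / 2 by rewrite divr_gt0.
    have := @near_infty_natSinv_lt R (PosNum e20).
    by case=> m _ /(_ m (leqnn _)) /= h; exists m.
  have qP i : exists q : rat, x ord0 i - m.+1%:R^-1 < ratr q < x ord0 i + m.+1%:R^-1.
    have /rat_in_itvoo[q] : x ord0 i - m.+1%:R^-1 < x ord0 i + m.+1%:R^-1.
      by rewrite ltrD2l gtrN// invr_gt0.
    by rewrite in_itv/= => qx; exists q.
  have [q xq] := choice qP.
  have xbox : box (\row_i q i, m) x.
    by move=> i; rewrite /= mxE; have /andP[] := xq i;
      rewrite !ltrBlDr; split => //; rewrite ltrBlDr.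
  exists (\row_i q i, m) => //; rewrite /F ifT//.
  apply/asboolP => y by_; apply: xeA; split => // a i.
  rewrite ord1 -ball_normE /ball_/=.
  have /= [] := by_ i; have /= [] := xbox i; rewrite !mxE.
  move: mP; set t := m.+1%:R^-1 => mP h1 h2 h3 h4.
  by rewrite ltr_norml; apply/andP; split; lra.
apply: countable_bigcupT_measurable => // qm.
by rewrite /F; case: ifPn => // _; exact: measurable0.
Qed.

End rV_borel.

Section sigma_finite_lemmas.
Local Open Scope ereal_scope.
Context d1 d2 (T1 : measurableType d1) (T2 : measurableType d2) (R : realType).

Lemma pushforward_sigma_finite (m : {measure set T1 -> \bar R})
    (f : T1 -> T2) (g : T2 -> T1) :
  sigma_finite setT m -> measurable_fun setT g -> cancel f g ->
  sigma_finite setT (pushforward m f).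
Proof.
move=> [F TF Foo] mg fK; exists (fun i => g @^-1` F i).
  by rewrite -preimage_bigcup -TF preimage_setT.
move=> i; have [mFi Fioo] := Foo i; split.
  by rewrite -[X in measurable X]setTI; exact: mg.
rewrite /pushforward -comp_preimage (_ : g \o f = id)//.
by apply/funext => x /=; rewrite fK.
Qed.

(* The library registers sigma-finiteness of a product measure only for
   (sub)probabilities. *)
Lemma product_measure1_sigma_finite
    (m1 : {sigma_finite_measure set T1 -> \bar R})
    (m2 : {sigma_finite_measure set T2 -> \bar R}) :
  sigma_finite setT (m1 \x m2).
Proof.
have /sigma_finiteP[F [TF ndF Foo]] := sigma_finiteT m1.
have /sigma_finiteP[G [TG ndG Goo]] := sigma_finiteT m2.
exists (fun n => F n `*` G n).
  rewrite -setXTT TF TG predeqE => -[x y]; split.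
    move=> [/= [n _ Fnx] [k _ Gky]]; exists (maxn n k) => //; split.
    - by move: x Fnx; exact/subsetPset/ndF/leq_maxl.
    - by move: y Gky; exact/subsetPset/ndG/leq_maxr.
  by move=> [n _ []/= ? ?]; split; exists n.
move=> k; have [? ?] := Foo k; have [? ?] := Goo k.
split; first exact: measurableX.
by rewrite product_measure1E// lte_mul_pinfty// ge0_fin_numE.
Qed.

End sigma_finite_lemmas.

Definition tuple_cons T n (x : T * n.-tuple T) : n.+1.-tuple T :=
  [tuple of x.1 :: x.2].

Lemma measurable_tuple_cons d (T : measurableType d) n :
  measurable_fun setT (@tuple_cons T n).
Proof. exact: measurable_cons. Qed.

Section cons_measure.
Local Open Scope ereal_scope.
Context d (T : measurableType d) (R : realType) (n : nat).
Variable mu : {sigma_finite_measure set T -> \bar R}.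
Variable nu : {sigma_finite_measure set (n.-tuple T) -> \bar R}.

Definition cons_measure : set (n.+1.-tuple T) -> \bar R :=
  pushforward (mu \x nu) (@tuple_cons T n).

Let cons_measure0 : cons_measure set0 = 0.
Proof. by rewrite /cons_measure /pushforward preimage_set0 measure0. Qed.

Let cons_measure_ge0 A : 0 <= cons_measure A.
Proof. by rewrite /cons_measure /pushforward; exact: measure_ge0. Qed.

Let cons_measure_sigma_additive : semi_sigma_additive cons_measure.
Proof.
have mf := @measurable_tuple_cons d T n.
exact: (@measure_semi_sigma_additive _ _ _ (pushforward (mu \x nu) _)).
Qed.

HB.instance Definition _ := isMeasure.Build _ _ _ cons_measure
  cons_measure0 cons_measure_ge0 cons_measure_sigma_additive.

Let cons_measure_sigma_finite : sigma_finite setT cons_measure.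
Proof.
pose g (t : n.+1.-tuple T) : T * n.-tuple T := (thead t, [tuple of behead t]).
apply: (@pushforward_sigma_finite _ _ _ _ _ (mu \x nu) _ g).
- exact: product_measure1_sigma_finite.
- apply/measurable_fun_pairP; split; first exact: measurable_tnth.
  exact: measurable_behead.
- by move=> [x t]; rewrite /g theadE; congr pair; exact: val_inj.
Qed.

HB.instance Definition _ := Measure_isSigmaFinite.Build _ _ _ cons_measure
  cons_measure_sigma_finite.

End cons_measure.

(* The n-fold product measure. *)
Fixpoint tuple_measure d (T : measurableType d) (R : realType)
    (mu : {sigma_finite_measure set T -> \bar R}) (n : nat) :
    {sigma_finite_measure set (n.-tuple T) -> \bar R} :=
  match n with
  | 0 => (\d_[tuple of [::]] : {sigma_finite_measure set _ -> \bar R})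
  | n'.+1 => (cons_measure mu (tuple_measure mu n') : {sigma_finite_measure set _ -> \bar R})
  end.

Section lebesgue_rV.
Local Open Scope ereal_scope.
Context {R : realType} {n : nat}.

Definition row_of_tuple (t : n.-tuple (measurableTypeR R)) : 'rV[R]_n :=
  \row_i tnth t i.

Lemma measurable_row_of_tuple : measurable_fun setT row_of_tuple.
Proof.
pose S := image_set_system setT row_of_tuple measurable.
have sS : sigma_algebra setT S.
  exact/sigma_algebra_image/sigma_algebra_measurable.
have mi (i : 'I_n) := @measurable_tnth _ (measurableTypeR R) n i.
have SB (i : 'I_n) (B : set (measurableTypeR R)) : measurable B ->
    S [set v : 'rV[R]_n | B (v ord0 i)].
  move=> mB; rewrite /S /image_set_system /=.
  rewrite (_ : _ @^-1` _ = (fun t => tnth t i) @^-1` B); first exact: mi.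
  by apply/seteqP; split=> t; rewrite /= mxE.
have openS : @open 'rV[R]_n `<=` S.
  apply: sigma_algebra_open_rV => // i a.
    apply: (SB i [set` `]-oo, a[]); exact: measurable_itv.
  by apply: (SB i [set x | (a < x)%R]); rewrite -set_itvoy; exact: measurable_itv.
by move=> _ A mA; exact: (smallest_sub sS openS mA).
Qed.

Definition lebesgue_rV : set 'rV[R]_n -> \bar R :=
  pushforward (tuple_measure lebesgue_measure n) row_of_tuple.

Let lebesgue_rV0 : lebesgue_rV set0 = 0.
Proof. by rewrite /lebesgue_rV /pushforward preimage_set0 measure0. Qed.

Let lebesgue_rV_ge0 A : 0 <= lebesgue_rV A.
Proof. by rewrite /lebesgue_rV /pushforward; exact: measure_ge0. Qed.

Let lebesgue_rV_sigma_additive : semi_sigma_additive lebesgue_rV.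
Proof.
have mf := measurable_row_of_tuple.
exact: (@measure_semi_sigma_additive _ _ _
  (pushforward (tuple_measure lebesgue_measure n) _)).
Qed.

HB.instance Definition _ := isMeasure.Build _ _ _ lebesgue_rV
  lebesgue_rV0 lebesgue_rV_ge0 lebesgue_rV_sigma_additive.

Lemma measurable_rV_coord (i : 'I_n) :
  measurable_fun setT (fun v : 'rV[R]_n => v ord0 i : measurableTypeR R).
Proof.
apply: (measurability _ (RGenOInfty.measurableE R)) => // _ [_ [x ->] <-].
rewrite setTI; apply: open_rV_measurable; apply: open_comp.
  by move=> v _; exact: coord_continuous.
exact: interval_open.
Qed.

Let lebesgue_rV_sigma_finite : sigma_finite setT lebesgue_rV.
Proof.
pose g (v : 'rV[R]_n) : n.-tuple (measurableTypeR R) := [tuple v ord0 i | i < n].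
apply: (@pushforward_sigma_finite _ _ _ _ _
  (tuple_measure lebesgue_measure n) _ g).
- exact: sigma_finiteT.
- apply/measurable_fun_tnthP => i.
  rewrite (_ : _ \o _ = (fun v : 'rV[R]_n => v ord0 i)).
    exact: measurable_rV_coord.
  by apply/funext => v /=; rewrite tnth_mktuple.
- by move=> t; apply: eq_from_tnth => i; rewrite tnth_mktuple mxE.
Qed.

HB.instance Definition _ := Measure_isSigmaFinite.Build _ _ _ lebesgue_rV
  lebesgue_rV_sigma_finite.

End lebesgue_rV.

Section covering_outer.
Local Open Scope ereal_scope.
Context {R : realType} {T : Type}.
Variables (g : set T -> \bar R) (C : set (set T)).

Definition covering_outer (A : set T) : \bar R :=
  ereal_inf [set \sum_(i <oo) g (U i) |
    U in [set U : (set T)^nat | (forall i, C (U i)) /\ A `<=` \bigcup_i U i]].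

Hypothesis g0 : g set0 = 0.
Hypothesis g_ge0 : forall A, 0 <= g A.
Hypothesis C0 : C set0.

Lemma covering_outer_ge0 A : 0 <= covering_outer A.
Proof. by apply: le_ereal_inf_tmp => _ [U _ <-]; exact: nneseries_ge0. Qed.

Lemma covering_outer_set0 : covering_outer set0 = 0.
Proof.
apply/eqP; rewrite eq_le covering_outer_ge0 andbT.
apply: ereal_inf_lbound; exists (fun=> set0); first by split.
by rewrite eseries0.
Qed.

Lemma le_covering_outer : {homo covering_outer : A B / A `<=` B >-> A <= B}.
Proof.
move=> A B AB; apply: ereal_inf_le_tmp => _ [U [CU BU] <-].
by exists U => //; split => //; exact: subset_trans BU.
Qed.

Lemma covering_outer_sigma_subadditive : sigma_subadditive covering_outer.
Proof.
move=> A; have [[i ioo]|] := pselect (exists i, covering_outer (A i) = +oo).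
  rewrite (eseries_pinfty _ _ ioo) ?leey// => n _.
  by rewrite -ltNye (lt_le_trans _ (covering_outer_ge0 _)).
rewrite -forallNE => Aoo.
suff add2e (e : {posnum R}) : covering_outer (\bigcup_n A n) <=
    \sum_(i <oo) covering_outer (A i) + e%:num%:E.
  by apply/lee_addgt0Pr => _/posnumP[].
rewrite (le_trans _ (epsilon_trick _ _ _))//; last first.
  by move=> n; exact: covering_outer_ge0.
pose P n (B : (set T)^nat) := ((forall i, C (B i)) /\ A n `<=` \bigcup_i B i) /\
  \sum_(k <oo) g (B k) <= covering_outer (A n) + (e%:num / (2 ^ n.+1)%:R)%:E.
have [G PG] : {G : ((set T)^nat)^nat & forall n, P n (G n)}.
  apply: (@choice _ _ P) => n.
  have en1 : (0 < e%:num / (2 ^ n.+1)%:R)%R by [].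
  have fA : covering_outer (A n) \is a fin_num.
    by rewrite ge0_fin_numE ?covering_outer_ge0// ltey; apply/eqP/Aoo.
  have [_ [B CB <-] Blt] := lb_ereal_inf_adherent en1 fA.
  by exists B; split => //; exact: ltW.
have gG_ge0 x : 0 <= (g \o uncurry G) x by exact: g_ge0.
apply: (@le_trans _ _ (\esum_(i in setT) (g \o uncurry G) i)).
  apply: ereal_inf_lbound => /=.
  have /card_esym/ppcard_eqP[f] := card_nat2.
  exists (uncurry G \o f).
    split => [i|]; first by rewrite /= /uncurry; case: (f i) => a b; exact: (PG a).1.1.
    move=> t [i _ Ait]; have [j _ Gijt] := (PG i).1.2 _ Ait.
    by exists (f^-1%FUN (i, j)) => //=; rewrite invK ?inE.
  rewrite -(esum_pred_image (g \o uncurry G) _ xpredT) ?[fun=> _]set_true//.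
  by rewrite image_eq.
rewrite (_ : esum _ _ = \sum_(i <oo) \sum_(j <oo ) g (G i j)); last first.
  pose J : nat -> set (nat * nat) := fun i => [set (i, j) | j in setT].
  rewrite (_ : setT = \bigcup_k J k); last first.
    by rewrite predeqE => -[a b]; split => // _; exists a => //; exists b.
  rewrite esum_bigcupT /=; last 2 first.
    - apply/trivIsetP => i j _ _ ij.
      rewrite predeqE => -[n m] /=; split => //= -[] [_] _ [<-{n} _].
      by move=> [m' _] [] /esym/eqP; rewrite (negbTE ij).
    - by move=> /= [n m].
  rewrite -(image_id [set: nat]) -fun_true esum_pred_image//; last first.
    by move=> n _; exact: esum_ge0.
  apply: eq_eseriesr => /= j _.
  rewrite -(esum_pred_image (g \o uncurry G) (pair j) predT)//=; last first.
    by move=> ? ? _ _; exact: (@can_inj _ _ _ snd).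
  by congr esum; rewrite predeqE => -[a b]; split; move=> [i _ <-]; exists i.
apply: lee_lim.
- by apply: is_cvg_nneseries => n *; exact: nneseries_ge0.
- apply: is_cvg_nneseries => n *; apply: adde_ge0 => //.
  exact: covering_outer_ge0.
- by near=> n; apply: lee_sum => i _; exact: (PG i).2.
Unshelve. all: by end_near. Qed.

Lemma covering_outerD (A B : set T) :
  (forall U, C U -> U `&` A !=set0 -> U `&` B !=set0 -> False) ->
  covering_outer A + covering_outer B <= covering_outer (A `|` B).
Proof.
move=> CAB; apply: le_ereal_inf_tmp => _ [U [CU ABU] <-].
pose V (D : set T) i := if `[< U i `&` D !=set0 >] then U i else set0.
have CV D i : C (V D i) by rewrite /V; case: ifPn.
have DV D : D `<=` \bigcup_i U i -> D `<=` \bigcup_i V D i.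
  move=> DU x Dx; have [i _ Uix] := DU x Dx; exists i => //.
  by rewrite /V ifT//; apply/asboolP; exists x.
apply: (@le_trans _ _ (\sum_(i <oo) g (V A i) + \sum_(i <oo) g (V B i))).
  apply: leeD; apply: ereal_inf_lbound.
    exists (V A) => //; split => //; apply: DV.
    by apply: subset_trans ABU => x; left.
  exists (V B) => //; split => //; apply: DV.
  by apply: subset_trans ABU => x; right.
rewrite -nneseriesD//; apply: lee_nneseries => [i _|i _].
  by move=> _; exact: adde_ge0.
rewrite /V; case: ifPn => [/asboolP UA|_]; case: ifPn => [/asboolP UB|_].
- by have := CAB _ (CU i) UA UB.
- by rewrite g0 adde0.
- by rewrite g0 add0e.
- by rewrite g0 adde0.
Qed.

End covering_outer.

Section euclidean.
Context {R : realType} {n : nat}.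
Implicit Types x y : 'rV[R]_n.

Definition enorm x : R := Num.sqrt (\sum_i x ord0 i ^+ 2).

Lemma coord_le_enorm x i : `|x ord0 i| <= enorm x.
Proof.
rewrite -sqrtr_sqr ler_wsqrtr// (bigD1 i)//= lerDl.
by apply: sumr_ge0 => j _; exact: sqr_ge0.
Qed.

Definition ediam (A : set 'rV[R]_n) : \bar R :=
  ereal_sup [set (enorm (xy.1 - xy.2))%:E | xy in A `*` A].

End euclidean.

Section hausdorff.
Local Open Scope ereal_scope.
Context {R : realType} {n : nat} (m : nat).
Implicit Types A B U : set 'rV[R]_n.

(* Normalized by the volume of the unit ball of R^m, so that H^n is Lebesgue
   measure on R^n. The empty set needs a case of its own: its ediam is -oo, and
   x ^+ 0 = 1. *)
Definition hausdorff_gauge U : \bar R :=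
  if U == set0 then 0
  else lebesgue_rV [set x : 'rV[R]_m | (enorm x <= 1)%R] *
       (ediam U * 2^-1%:E) ^+ m.

Definition hausdorff_content (d : R) : set 'rV[R]_n -> \bar R :=
  covering_outer hausdorff_gauge [set U | ediam U <= d%:E].

Definition hausdorff A : \bar R :=
  ereal_sup [set hausdorff_content d A | d in [set d : R | (0 < d)%R]].

Let gauge0 : hausdorff_gauge set0 = 0.
Proof. by rewrite /hausdorff_gauge eqxx. Qed.

Lemma hausdorff_gauge_ge0 U : 0 <= hausdorff_gauge U.
Proof.
rewrite /hausdorff_gauge; case: ifPn => // /set0P[x Ux].
rewrite mule_ge0// expe_ge0// mule_ge0//.
apply: (@le_trans _ _ (enorm (x - x))%:E); first by rewrite lee_fin sqrtr_ge0.
by apply: ereal_sup_ubound; exists (x, x).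
Qed.

Let gauge_ge0 := hausdorff_gauge_ge0.

Let diam0 (d : R) : ediam (@set0 'rV[R]_n) <= d%:E.
Proof. by rewrite /ediam set0X image_set0 ereal_sup0 leNye. Qed.

Let hausdorff0 : hausdorff set0 = 0.
Proof.
apply/eqP; rewrite eq_le; apply/andP; split.
  apply: ge_ereal_sup => _ [d _ <-].
  by rewrite /hausdorff_content covering_outer_set0//; exact: diam0.
apply: ereal_sup_ubound; exists 1%R => //=.
by rewrite /hausdorff_content covering_outer_set0//; exact: diam0.
Qed.

Let hausdorff_ge0 A : 0 <= hausdorff A.
Proof.
apply: (@le_trans _ _ (hausdorff_content 1 A)); first exact: covering_outer_ge0.
by apply: ereal_sup_ubound; exists 1%R => //=.
Qed.

Let le_hausdorff : {homo hausdorff : A B / A `<=` B >-> A <= B}.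
Proof.
move=> A B AB; apply: ge_ereal_sup => _ [d d0 <-].
apply: (@le_trans _ _ (hausdorff_content d B)).
  exact: le_covering_outer.
by apply: ereal_sup_ubound; exists d.
Qed.

Let hausdorff_sigma_subadditive : sigma_subadditive hausdorff.
Proof.
move=> F; apply: ge_ereal_sup => _ [d d0 <-].
apply: (le_trans (@covering_outer_sigma_subadditive _ _ hausdorff_gauge
  [set U | ediam U <= d%:E] hausdorff_gauge_ge0 F)).
apply: lee_nneseries => [i _|i _]; first by move=> _; exact: covering_outer_ge0.
by apply: ereal_sup_ubound; exists d.
Qed.

HB.instance Definition _ := isOuterMeasure.Build R 'rV[R]_n hausdorff
  hausdorff0 hausdorff_ge0 le_hausdorff hausdorff_sigma_subadditive.

End hausdorff.

Section hausdorff_borel.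
Local Open Scope ereal_scope.
Context {R : realType} {n : nat} (m : nat).
Implicit Types A B U X : set 'rV[R]_n.

Local Notation H := (@hausdorff R n m).

Lemma hausdorffD_far A B (e : R) : (0 < e)%R ->
  (forall x y, A x -> B y -> e <= enorm (x - y))%R ->
  H A + H B <= H (A `|` B).
Proof.
move=> e0 ABe; set X := A `|` B.
have [->|Xoo] := eqVneq (H X) +oo; first by rewrite leey.
have fX : H X \is a fin_num.
  by rewrite ge0_fin_numE ?outer_measure_ge0// ltey.
have fA : H A \is a fin_num.
  rewrite ge0_fin_numE ?outer_measure_ge0//.
  apply: (@le_lt_trans _ _ (H X)); last by rewrite ltey.
  by apply: le_outer_measure; exact: subsetUl.
have fB : H B \is a fin_num.
  rewrite ge0_fin_numE ?outer_measure_ge0//.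
  apply: (@le_lt_trans _ _ (H X)); last by rewrite ltey.
  by apply: le_outer_measure; exact: subsetUr.
have le_content (d1 d2 : R) D : (d1 <= d2)%R ->
    hausdorff_content m d2 D <= hausdorff_content m d1 D.
  move=> d12; apply: ereal_inf_le_tmp => _ [U [CU DU] <-].
  exists U => //; split => // i.
  by apply: (le_trans (CU i)); rewrite lee_fin.
have key (d1 d2 : R) : (0 < d1)%R -> (0 < d2)%R ->
    hausdorff_content m d1 A + hausdorff_content m d2 B <= H X.
  move=> d10 d20; pose d := (Num.min (Num.min d1 d2) (e / 2))%R.
  have d0 : (0 < d)%R by rewrite !lt_min d10 d20 divr_gt0.
  apply: (@le_trans _ _ (hausdorff_content m d A + hausdorff_content m d B)).
    by apply: leeD; apply: le_content; rewrite /d !ge_min lexx ?orbT.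
  apply: (@le_trans _ _ (hausdorff_content m d X)); last first.
    by apply: ereal_sup_ubound; exists d.
  apply: covering_outerD.
  - by rewrite /hausdorff_gauge eqxx.
  - exact: hausdorff_gauge_ge0.
  - by rewrite /= /ediam set0X image_set0 ereal_sup0 leNye.
  move=> U Ud [x [Ux Ax]] [y [Uy By]].
  have : (enorm (x - y))%:E <= d%:E.
    by apply: le_trans Ud; apply: ereal_sup_ubound; exists (x, y).
  rewrite lee_fin; apply/negP; rewrite -ltNge.
  apply: lt_le_trans (ABe _ _ Ax By).
  by rewrite /d gt_min; apply/orP; right; rewrite ltr_pdivrMr// ltr_pMr// ltr1n.
rewrite -leeBrDr//; apply: ge_ereal_sup => _ [d1 d10 <-].
rewrite leeBrDr// addeC.
have fA1 : hausdorff_content m d1 A \is a fin_num.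
  rewrite ge0_fin_numE; last first.
    by apply: covering_outer_ge0; exact: hausdorff_gauge_ge0.
  apply: (@le_lt_trans _ _ (H A)); last by rewrite ltey_eq fA.
  by apply: ereal_sup_ubound; exists d1.
rewrite -leeBrDr//; apply: ge_ereal_sup => _ [d2 d20 <-].
by rewrite leeBrDr// addeC; exact: key.
Qed.

Lemma caratheodory_gt0 (f : 'rV[R]_n -> R) :
  (forall x y, `|f x - f y| <= enorm (x - y))%R ->
  H.-caratheodory [set x | (0 < f x)%R].
Proof.
move=> fL; apply: le_caratheodory_measurable => X /=.
have [->|Xoo] := eqVneq (H X) +oo; first by rewrite leey.
have fX : H X \is a fin_num.
  by rewrite ge0_fin_numE ?outer_measure_ge0// ltey.
pose a k : R := (k.+1%:R^-1)%R.
have aS j k : (j < k)%N -> (a k < a j)%R.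
  by move=> jk; rewrite /a ltf_pV2 ?posrE// ltr_nat ltnS.
have far A B (s t : R) : (t < s)%R -> (forall x, A x -> (s < f x)%R) ->
    (forall x, B x -> (f x <= t)%R) -> H A + H B <= H (A `|` B).
  move=> ts As Bt; apply: (@hausdorffD_far _ _ (s - t)).
    by rewrite subr_gt0.
  move=> x y /As fx /Bt fy; apply: le_trans (fL x y).
  by apply: le_trans (ler_norm _); rewrite lerB// ltW.
pose G t := X `&` [set x | (t < f x)%R].
pose Z := X `&` ~` [set x | (0 < f x)%R].
pose Q j := X `&` [set x | (a j.+1 < f x <= a j)%R].
have GZ k : H (G (a k)) + H Z <= H X.
  apply: (@le_trans _ _ (H (G (a k) `|` Z))).
    apply: (far _ _ (a k) 0%R); rewrite ?invr_gt0//; first by move=> x [].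
    by move=> x [_ /negP]; rewrite -leNgt.
  by apply: le_outer_measure => x [[]|[]].
have rings c N : \sum_(j < N) H (Q (j.*2 + c)%N.+1) <= H (G (a (N.*2 + c)%N)).
  elim: N => [|N IH]; first by rewrite big_ord0 outer_measure_ge0.
  rewrite big_ord_recr/=; apply: (le_trans (leeD2r _ IH)).
  apply: (@le_trans _ _ (H (G (a (N.*2 + c)%N) `|` Q (N.*2 + c)%N.+1))).
    apply: (far _ _ (a (N.*2 + c)%N) (a (N.*2 + c)%N.+1)); first exact: aS.
      by move=> x [].
    by move=> x [_ /= /andP[]].
  apply: le_outer_measure => x [[Xx fx]|[Xx /andP[fx _]]]; split => //=.
  by apply: le_lt_trans fx; rewrite ltW// aS// doubleS !addSn ltnS leqnSn.
pose u j := H (Q j.+1).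
have u0 j : 0 <= u j by exact: outer_measure_ge0.
have GX t : H (G t) <= H X by apply: le_outer_measure => x [].
have uN N : \sum_(0 <= j < N) u j <= H X + H X.
  apply: (@le_trans _ _ (\sum_(0 <= j < N.*2) u j)).
    by apply: lee_sum_nneg_natr => //; rewrite -addnn leq_addr.
  have -> : \sum_(0 <= j < N.*2) u j =
      \sum_(j < N) H (Q (j.*2 + 0)%N.+1) + \sum_(j < N) H (Q (j.*2 + 1)%N.+1).
    elim: N => [|N IH]; first by rewrite !big_ord0 big_nil adde0.
    rewrite doubleS !big_nat_recr//= IH !big_ord_recr/= /u addn0 addn1.
    by rewrite -!addeA; congr (_ + _); rewrite addeCA.
  apply: leeD; apply: le_trans (GX _); exact: rings.
have uoo : \sum_(j <oo) u j < +oo.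
  apply: (@le_lt_trans _ _ (H X + H X)); last first.
    by rewrite ltey_eq fin_numD fX.
  apply: lime_le; first by apply: is_cvg_nneseries.
  by apply: nearW => N; exact: uN.
have tail N : H (X `&` [set x | (0 < f x)%R]) <=
    H (G (a N.+1)) + \sum_(N <= j <oo) u j.
  rewrite -nneseries_addn//.
  apply: (@le_trans _ _ (H (G (a N.+1) `|` \bigcup_j Q (j + N)%N.+1))).
    apply: le_outer_measure => x [Xx /= fx0].
    have [fN|fN] := ltP (a N.+1) (f x); first by left.
    right.
    have ex : exists j, (a j < f x)%R.
      have := @near_infty_natSinv_lt R (PosNum fx0).
      by case=> j _ /(_ j (leqnn _)) /= h; exists j.
    have [[|[|j]] aj minj] := ex_minnP ex.
    - have := lt_le_trans aj fN; rewrite ltNge => /negP[].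
      by rewrite ltW// aS.
    - have := lt_le_trans aj fN; rewrite ltNge => /negP[].
      case: N {fN} => // N; by rewrite ltW// aS.
    - have Nj : (N <= j)%N.
        rewrite leqNgt; apply/negP => jN.
        have := lt_le_trans aj fN; rewrite ltNge => /negP[].
        have [->//|jN'] := eqVneq j.+1 N.
        by rewrite ltW// aS// !ltnS ltn_neqAle jN' jN.
      exists (j - N)%N => //; rewrite subnK//; split => //=.
      rewrite aj/= leNgt; apply/negP => /minj.
      by rewrite ltnn.
  apply: (le_trans (outer_measureU2 _ _ _)); apply: leeD2l.
  exact: outer_measure_sigma_subadditive.
apply/lee_addgt0Pr => e e0.
have := nneseries_tail_cvg uoo (fun k _ => u0 k).
move=> /fine_cvgP[finu /cvgrPdist_lt /(_ e e0)] [N0 _ hN0].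
case: finu => N1 _ hN1.
pose N := maxn N0 N1.
have tailN : \sum_(N <= j <oo) u j <= e%:E.
  have /= := hN0 N (leq_maxl _ _); have /= fN := hN1 N (leq_maxr _ _).
  rewrite sub0r normrN => h.
  rewrite -(fineK fN) lee_fin; apply: le_trans (ltW h).
  exact: ler_norm.
apply: (@le_trans _ _ (H (G (a N.+1)) + \sum_(N <= j <oo) u j + H Z)).
  exact: leeD2r.
by rewrite addeAC; apply: leeD => //; exact: GZ.
Qed.

Let lip_coord (i : 'I_n) (x y : 'rV[R]_n) :
  (`|x ord0 i - y ord0 i| <= enorm (x - y))%R.
Proof.
by apply: le_trans (coord_le_enorm _ i); rewrite !mxE.
Qed.

Lemma borel_caratheodory A : measurable A -> H.-caratheodory A.
Proof.
pose S : set (set 'rV[R]_n) := H.-caratheodory.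
have sS : sigma_algebra setT S.
  split.
  - exact: caratheodory_measurable_set0.
  - by move=> B SB; rewrite setTD; exact: caratheodory_measurable_setC.
  - by move=> F SF; exact: caratheodory_measurable_bigcup.
apply: (smallest_sub sS); apply: sigma_algebra_open_rV => // i b.
- rewrite (_ : [set _ | _] = [set v : 'rV[R]_n | (0 < b - v ord0 i)%R]); last first.
    by apply/seteqP; split=> v /=; rewrite subr_gt0.
  apply: caratheodory_gt0 => x y.
  rewrite opprB addrC addrA subrK distrC; exact: lip_coord.
- rewrite (_ : [set _ | _] = [set v : 'rV[R]_n | (0 < v ord0 i - b)%R]); last first.
    by apply/seteqP; split=> v /=; rewrite subr_gt0.
  apply: caratheodory_gt0 => x y.
  rewrite opprB addrA subrK; exact: lip_coord.
Qed.

Let hausdorff_sigma_additive : semi_sigma_additive (hausdorff m : set 'rV[R]_n -> _).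
Proof.
move=> F mF tF mUF.
by apply: caratheodory_measure_sigma_additive => // *; exact: borel_caratheodory.
Qed.

HB.instance Definition _ := isMeasure.Build rV_borel_display 'rV[R]_n R
  (hausdorff m) (outer_measure0 _) (outer_measure_ge0 _) hausdorff_sigma_additive.

End hausdorff_borel.

Section forms.
Context {R : realType} {n k : nat}.

Definition multi_index := {I : k.-tuple 'I_n | sorted ltn [seq val i | i <- I]}.

(* An alternating k-linear form on R^n, by its coefficients in the basis
   dx_(I_1) /\ .. /\ dx_(I_k), I_1 < .. < I_k. *)
Definition kcovector := {ffun multi_index -> R}.

Definition kcov_eval (a : kcovector) (v : k.-tuple 'rV[R]_n) : R :=
  \sum_(I : multi_index) a I *
    \det (\matrix_(i < k, j < k) tnth v j ord0 (tnth (val I) i)).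

Definition kcov_norm (a : kcovector) : R := Num.sqrt (\sum_I a I ^+ 2).

Definition measurable_form (D : set 'rV[R]_n) (w : 'rV[R]_n -> kcovector) :=
  forall I : multi_index, measurable_fun D (fun x => w x I : measurableTypeR R).

Definition zero_ext (Omega : set 'rV[R]_n) (w : 'rV[R]_n -> kcovector) x :
  kcovector := if `[< Omega x >] then w x else 0.

(* w' is a Borel representative of the class of w up to null sets. *)
Definition borel_representative (w w' : 'rV[R]_n -> kcovector) :=
  measurable_form setT w' /\ {ae lebesgue_rV, forall x, w' x = w x}.

Definition edges (X : k.+1.-tuple 'rV[R]_n) : k.-tuple 'rV[R]_n :=
  [tuple tnth X (lift ord0 i) - tnth X ord0 | i < k].

Definition std_simplex : set 'rV[R]_k :=
  [set s | (forall i, 0 <= s ord0 i) /\ \sum_i s ord0 i <= 1].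

Definition simplex_map (X : k.+1.-tuple 'rV[R]_n) (s : 'rV[R]_k) : 'rV[R]_n :=
  tnth X ord0 + \sum_i s ord0 i *: tnth (edges X) i.

(* Rintegral has the value 0 at the simplices, which form a null set, on which
   the integrand is not integrable. *)
Definition integration_fun (w : 'rV[R]_n -> kcovector)
    (X : k.+1.-tuple 'rV[R]_n) : R :=
  \int[lebesgue_rV]_(s in std_simplex)
    kcov_eval (w (simplex_map X s)) (edges X).

End forms.
Arguments multi_index : clear implicits.
Arguments kcovector : clear implicits.

Section norms.
Local Open Scope ereal_scope.
Context {R : realType} {n : nat}.

Definition Lp_norm (p : R) (Omega : set 'rV[R]_n) (f : 'rV[R]_n -> \bar R) :
  \bar R := 'N[lebesgue_rV]_p%:E[f \_ Omega].

(* The quotient is 0 on the null set where some x_i = x_0. *)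
Definition LpM_integral (k : nat) (p : R) (Omega : set 'rV[R]_n)
    (F : k.+1.-tuple 'rV[R]_n -> R) (theta : R) : \bar R :=
  \int[tuple_measure lebesgue_rV k.+1]_(X in
      [set X : k.+1.-tuple 'rV[R]_n | forall i, Omega (tnth X i)])
    (((1 - theta) ^+ k * `|F X| `^ p /
      (\prod_(i < k) enorm (tnth (edges X) i)) `^ (n%:R + theta * p))%R)%:E.

Definition LpM_norm (k : nat) (p : R) (Omega : set 'rV[R]_n)
    (F : k.+1.-tuple 'rV[R]_n -> R) : \bar R :=
  limf_esup (LpM_integral p Omega F) (1%R^'-) `^ p^-1.

Definition unit_sphere : set 'rV[R]_n := [set v | enorm v = 1%R].

(* \int_D .. \int_D f(v_1, .., v_k) dmu(v_1) .. dmu(v_k) *)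
Fixpoint iterated_integral d (T : measurableType d)
    (mu : {measure set T -> \bar R}) (D : set T) (k : nat) :
    (k.-tuple T -> \bar R) -> \bar R :=
  match k with
  | 0 => fun f => f [tuple]
  | k'.+1 => fun f => \int[mu]_(x in D)
      iterated_integral mu D (fun v : k'.-tuple T => f [tuple of x :: v])
  end.

(* For k = 0 the iterated integral is `|a|^p, so that the norm is `|a|. *)
Definition kcov_sphere_norm (k : nat) (p : R) (a : kcovector R n k) : \bar R :=
  iterated_integral (hausdorff n.-1) unit_sphere
    (fun v : k.-tuple 'rV[R]_n => (`|kcov_eval a v| `^ p)%:E) `^ p^-1.

End norms.

(* Main.v *)
From HB Require Import structures.
Require Import Defs.
From mathcomp Require Import all_boot all_order all_algebra.
From mathcomp Require Import all_classical all_reals all_analysis.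
From mathcomp Require Import measurable_realfun lra ring perm.

(** In the coordinates x = x_0, h_i = x_i - x_0 the functional integrates
|I(x, h)|^p against the product over i of the kernels
(1 - theta) |h_i|^-(n + theta p), where I(x, h) is the integral over s in the
standard simplex Delta of w_(x + sum_i s_i h_i)(h_1, .., h_k)
([LpM_integralE]). As theta tends to 1 each kernel gives up its mass outside any
neighbourhood of 0, so that only short edges matter. There I(x, h) is close to
|Delta| w_x(h), and t |-> |w_x(t)|^p is positively homogeneous of degree p in
every slot. For such a function a kernel cut off at radius r is integrated
exactly in polar coordinates ([integral_slot]): the radial part is
(1 - theta) times the integral of rho ^ (p (1 - theta) - 1) over 0 < rho < r,
that is r ^ (p (1 - theta)) / p, and what remains is the integral over the unit
sphere. Applied slot after slot this turns the integral of |w_x(h)|^p into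
kappa(theta, r)^k |w_x|^p, with the norm of the statement defined by integration
over spheres, and kappa(theta, r) tends to a positive limit kappa that does not
depend on r ([integral_slots], [slot_factor_cvg]). Hence the functional should
tend to |Delta|^p kappa^k times the integral of |w_x|^p in this norm, and K is
the p-th root of the constant.

The upper bound for the functional is already the right one. By Jensen's
inequality |I(x, h)|^p is at most |Delta|^(p - 1) times the integral over s of
|w_(x + sum_i s_i h_i)(h)|^p, the translation disappears when x is integrated
first, and the bounded set admits only edges shorter than some rho; this gives
|Delta|^p kappa(theta, rho)^k times the integral ([LpM_integral_le]). For the
lower bound the functional is restricted to the points x at distance at least r
from the complement, for which all edges shorter than r are allowed, and
|Delta| w_x(h) is compared with I(x, h) by means of
(u + v)^p <= lam u^p + C v^p, with lam as close to 1 as desired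
([powR_perturb]). The error is again estimated by Jensen's inequality, in terms
of the L^p distance of w to its translates by vectors shorter than r, which is
small because translations are continuous in L^p ([chord_integral_oscillation],
[family_shift]). Letting theta tend to 1, then r to 0, then lam to 1 closes the
gap ([LpM_integral_cvg]).

Polar coordinates for the Hausdorff measure come from a uniqueness theorem. On
the sphere, two finite Borel measures that are invariant under reflections are
proportional ([sphere_measure_unique]), since the balls of a given radius have
equal measures. The Hausdorff measure of dimension n - 1 is invariant, as
reflections are isometries, and it is finite and positive on the sphere
([hausdorff_sphere_lty], [hausdorff_sphere_gt0]); the image of a radial measure
under h |-> h / |h| is invariant because reflections preserve Lebesgue measure.
So this image is a multiple of the Hausdorff measure, the total mass being a
geometric series over dyadic annuli ([integral_polar], [integral_radial]). The
constant kappa is thereby known only through the mass of one annulus and the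
area of the sphere, which suffices.

Continuity of translations in L^p is reduced to sets. The Borel sets A for which
the measure of the symmetric difference of A and A + y tends to 0 with y, within
any cube, form a sigma-algebra containing the coordinate half-spaces
([local_shift_borel]); simple functions, integrable functions and p-th powers
follow.

The comparison with the Euclidean norm of forms holds pointwise: both norms are
homogeneous functions of a covector, and the sphere norm controls every
coefficient because the p-th moment of a linear form on the sphere is at least a
constant times the p-th power of its value at any unit vector
([sphere_power_le], [sphere_power_ge]). *)
Set Implicit Arguments.
Unset Strict Implicit.
Unset Printing Implicit Defensive.
Import Order.TTheory GRing.Theory Num.Def Num.Theory.
Import numFieldNormedType.Exports.
Local Open Scope classical_set_scope.
Local Open Scope ring_scope.

(** * Measurability and Tonelli on tuples *)

Section rV_measurability.
Context {R : realType}.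

Lemma measurable_fun_rV d (T : measurableType d) n (f : T -> 'rV[R]_n) :
  (forall i, measurable_fun setT (fun x => f x ord0 i)) ->
  measurable_fun setT f.
Proof.
move=> mf.
pose S := image_set_system setT f measurable.
have sS : sigma_algebra setT S.
  exact/sigma_algebra_image/sigma_algebra_measurable.
have SB (i : 'I_n) (B : set (measurableTypeR R)) : measurable B ->
    S [set v : 'rV[R]_n | B (v ord0 i)].
  by move=> mB; exact: mf.
have openS : @open 'rV[R]_n `<=` S.
  apply: sigma_algebra_open_rV => // i a.
    apply: (SB i [set` `]-oo, a[]); exact: measurable_itv.
  by apply: (SB i [set x | (a < x)%R]); rewrite -set_itvoy; exact: measurable_itv.
by move=> _ A mA; exact: (smallest_sub sS openS mA).
Qed.

Lemma measurable_coord d (T : measurableType d) n (f : T -> 'rV[R]_n) i :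
  measurable_fun setT f -> measurable_fun setT (fun x => f x ord0 i).
Proof. by move=> mf; exact: (measurableT_comp (measurable_rV_coord i) mf). Qed.

Lemma measurable_addrV d (T : measurableType d) n (f g : T -> 'rV[R]_n) :
  measurable_fun setT f -> measurable_fun setT g ->
  measurable_fun setT (fun x => f x + g x).
Proof.
move=> mf mg; apply: measurable_fun_rV => i.
rewrite (_ : (fun _ => _) = (fun x => f x ord0 i + g x ord0 i)); last first.
  by apply/funext => x; rewrite mxE.
by apply: measurable_funD; exact: measurable_coord.
Qed.

Lemma measurable_scalerV d (T : measurableType d) n (a : T -> R) (f : T -> 'rV[R]_n) :
  measurable_fun setT a -> measurable_fun setT f ->
  measurable_fun setT (fun x => a x *: f x).
Proof.
move=> ma mf; apply: measurable_fun_rV => i.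
rewrite (_ : (fun _ => _) = (fun x => a x * f x ord0 i)); last first.
  by apply/funext => x; rewrite mxE.
by apply: measurable_funM => //; exact: measurable_coord.
Qed.

Lemma measurable_sumrV d (T : measurableType d) n k (f : 'I_k -> T -> 'rV[R]_n) :
  (forall i, measurable_fun setT (f i)) ->
  measurable_fun setT (fun x => \sum_(i < k) f i x).
Proof.
move=> mf; apply: measurable_fun_rV => j.
rewrite (_ : (fun _ => _) = (fun x => \sum_(i < k) f i x ord0 j)); last first.
  by apply/funext => x; rewrite summxE.
by apply: measurable_sum => i; exact: measurable_coord.
Qed.

Lemma measurable_oppr n : measurable_fun setT (fun x : 'rV[R]_n => - x).
Proof.
apply: measurable_fun_rV => i.
rewrite (_ : (fun _ => _) = (fun x : 'rV[R]_n => - x ord0 i)); last first.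
  by apply/funext => x; rewrite mxE.
by apply: measurableT_comp => //; exact: measurable_coord.
Qed.

Lemma measurable_sqrt : measurable_fun setT (Num.sqrt : R -> R).
Proof. by apply: continuous_measurable_fun; exact: sqrt_continuous. Qed.

Lemma measurable_enorm n : measurable_fun setT (@enorm R n).
Proof.
apply: (measurableT_comp measurable_sqrt).
by apply: measurable_sum => i; apply: measurable_funX; exact: measurable_rV_coord.
Qed.

End rV_measurability.

Lemma integral_image_measure d1 d2 (T1 : measurableType d1)
    (T2 : measurableType d2) (R : realType)
    (m1 : {measure set T1 -> \bar R}) (m2 : {measure set T2 -> \bar R})
    (h : T1 -> T2) (g : T2 -> \bar R) :
  measurable_fun setT h ->
  (forall A, measurable A -> m2 A = m1 (h @^-1` A)) ->
  measurable_fun setT g -> (forall x, 0 <= g x)%E ->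
  (\int[m2]_x g x = \int[m1]_x g (h x))%E.
Proof.
move=> mh m12 mg g0.
have := ge0_integral_pushforward mh m1 measurableT mg (fun x _ => g0 x).
rewrite preimage_setT => <-.
by apply: eq_measure_integral => A mA _; exact: m12.
Qed.

Section tuple_tonelli.
Local Open Scope ereal_scope.
Context d (T : measurableType d) (R : realType).
Variable mu : {sigma_finite_measure set T -> \bar R}.

Lemma measurable_consP n : measurable_fun setT
  (fun z : T * n.-tuple T => [tuple of z.1 :: z.2]).
Proof. exact: measurable_tuple_cons. Qed.

Lemma measurable_cons1 n (x : T) :
  measurable_fun setT (fun t : n.-tuple T => [tuple of x :: t]).
Proof. exact: measurable_cons. Qed.

Lemma measurable_cons2 n (t : n.-tuple T) :
  measurable_fun setT (fun x : T => [tuple of x :: t]).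
Proof. exact: measurable_cons. Qed.

Lemma integral_tuple0 (f : 0.-tuple T -> \bar R) :
  \int[tuple_measure mu 0]_t f t = f [tuple].
Proof.
rewrite integral_dirac//; first by rewrite diracE in_setT mul1e.
move=> _ A mA; rewrite setTI.
have [f0|f0] := pselect (A (f [tuple])).
  rewrite (_ : _ @^-1` _ = setT)//; apply/seteqP; split => // t _ /=.
  by rewrite tuple0.
rewrite (_ : _ @^-1` _ = set0)//; apply/seteqP; split => // t /=.
by rewrite tuple0.
Qed.

Section cons.
Variables (n : nat) (f : n.+1.-tuple T -> \bar R).
Hypotheses (mf : measurable_fun setT f) (f0 : forall t, 0 <= f t).

Lemma integral_tuple_pair : \int[tuple_measure mu n.+1]_X f X =
  \int[mu \x tuple_measure mu n]_z f [tuple of z.1 :: z.2].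
Proof.
exact: integral_image_measure (@measurable_consP n) _ mf f0.
Qed.

Lemma integral_tuple_cons : \int[tuple_measure mu n.+1]_X f X =
  \int[mu]_x \int[tuple_measure mu n]_t f [tuple of x :: t].
Proof.
rewrite integral_tuple_pair fubini_tonelli1//.
exact: measurableT_comp mf (@measurable_consP n).
Qed.

Lemma measurable_integral_cons : measurable_fun setT
  (fun x => \int[tuple_measure mu n]_t f [tuple of x :: t]).
Proof.
pose g (z : T * n.-tuple T) := f [tuple of z.1 :: z.2].
have mg : measurable_fun setT g by exact: measurableT_comp mf (@measurable_consP n).
exact: (measurable_fun_fubini_tonelli_F (m2 := tuple_measure mu n) g mg (fun z => f0 _)).
Qed.

End cons.

Lemma measurable_tuple_box n (A : 'I_n -> set T) : (forall i, measurable (A i)) ->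
  measurable [set t : n.-tuple T | forall i, A i (tnth t i)].
Proof.
move=> mA; rewrite (_ : [set _ | _] = \bigcap_(i in [set: 'I_n])
    ((fun t : n.-tuple T => tnth t i) @^-1` A i)); last first.
  by apply/seteqP; split => t /= At i; [move=> _; exact: At|exact: At].
apply: fin_bigcap_measurable => [|i _]; first exact: finite_finset.
by rewrite -[X in measurable X]setTI; exact: measurable_tnth.
Qed.

Lemma tuple_measure_box n (A : 'I_n -> set T) : (forall i, measurable (A i)) ->
  tuple_measure mu n [set t | forall i, A i (tnth t i)] = \prod_(i < n) mu (A i).
Proof.
elim: n A => [|n IH] A mA.
  by rewrite big_ord0 /= diracE mem_set// => -[].
rewrite big_ord_recl -(IH (fun i => A (lift ord0 i)))//.
rewrite -product_measure1E//; last exact: (measurable_tuple_box (fun i => mA (lift ord0 i))).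
rewrite /= /cons_measure /pushforward; congr (_ _).
apply/seteqP; split => -[x t] /=.
  move=> h; split; first by have := h ord0; rewrite tnth0.
  by move=> i; have := h (lift ord0 i); rewrite tnthS.
move=> [hx ht] i; case: (unliftP ord0 i) => [j ->|->]; first by rewrite tnthS.
by rewrite tnth0.
Qed.

Definition measure_preserving (mu : set T -> \bar R) (f : T -> T) :=
  measurable_fun setT f /\ forall A, measurable A -> mu (f @^-1` A) = mu A.

End tuple_tonelli.

Lemma integral_preserving d (T : measurableType d) (R : realType)
    (m : {measure set T -> \bar R}) (h : T -> T) (g : T -> \bar R) :
  measure_preserving m h -> measurable_fun setT g -> (forall x, 0 <= g x)%E ->
  (\int[m]_x g (h x) = \int[m]_x g x)%E.
Proof.
move=> [mh hm] mg g0; apply/esym.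
by apply: (integral_image_measure mh _ mg g0) => A /hm.
Qed.

Section tuple_preserving.
Local Open Scope ereal_scope.
Context d (T : measurableType d) (R : realType).
Variable mu : {sigma_finite_measure set T -> \bar R}.

Definition tuple_map n (h : 'I_n -> T -> T) (t : n.-tuple T) : n.-tuple T :=
  [tuple h i (tnth t i) | i < n].

Lemma tuple_map_cons n (h : 'I_n.+1 -> T -> T) x (t : n.-tuple T) :
  tuple_map h [tuple of x :: t] =
  [tuple of h ord0 x :: tuple_map (fun i => h (lift ord0 i)) t].
Proof.
apply: eq_from_tnth => i; rewrite tnth_mktuple.
case: (unliftP ord0 i) => [j ->|->]; last by rewrite !tnth0.
by rewrite !tnthS tnth_mktuple.
Qed.

Lemma measurable_tuple_map n (h : 'I_n -> T -> T) :
  (forall i, measurable_fun setT (h i)) -> measurable_fun setT (tuple_map h).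
Proof.
move=> mh; apply/measurable_fun_tnthP => i.
rewrite (_ : _ \o _ = (fun t => h i (tnth t i))); last first.
  by apply/funext => t /=; rewrite tnth_mktuple.
exact: measurableT_comp (mh i) (measurable_tnth i).
Qed.

Lemma integral_tuple_map n (h : 'I_n -> T -> T) (g : n.-tuple T -> \bar R) :
  (forall i, measure_preserving mu (h i)) -> measurable_fun setT g ->
  (forall t, 0 <= g t) ->
  \int[tuple_measure mu n]_t g (tuple_map h t) = \int[tuple_measure mu n]_t g t.
Proof.
elim: n h g => [|n IH] h g hP mg g0.
  by rewrite !integral_tuple0; congr (g _); apply: eq_from_tnth => -[].
rewrite integral_tuple_cons//; last first.
  by apply: measurableT_comp mg _; apply: measurable_tuple_map => i; exact: (hP i).1.
rewrite [RHS]integral_tuple_cons//.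
rewrite -(@integral_preserving _ _ _ mu (h ord0)
  (fun x => \int[tuple_measure mu n]_t g [tuple of x :: t]))//; first last.
- by move=> x; exact: integral_ge0.
- exact: measurable_integral_cons.
apply: eq_integral => x _.
rewrite -(IH (fun i => h (lift ord0 i)) (fun t => g [tuple of h ord0 x :: t])); first last.
- by move=> t.
- exact: measurableT_comp mg (@measurable_cons1 _ T n (h ord0 x)).
- by move=> i; exact: hP.
by apply: eq_integral => t _; rewrite tuple_map_cons.
Qed.

(** By Tonelli one factor is transformed at a time ([integral_tuple_map]); sets are
handled through the integrals of their indicators. *)
Lemma tuple_measure_preserving n (h : 'I_n -> T -> T) :
  (forall i, measure_preserving mu (h i)) ->
  measure_preserving (tuple_measure mu n) (tuple_map h).
Proof.
move=> hP.
have mh : measurable_fun setT (tuple_map h).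
  by apply: measurable_tuple_map => i; exact: (hP i).1.
split => // A mA.
have mA' : measurable (tuple_map h @^-1` A) by rewrite -[X in measurable X]setTI; exact: mh.
have := @integral_tuple_map n h (fun t => (\1_A t)%:E) hP.
have E (B : set (n.-tuple T)) : measurable B ->
    tuple_measure mu n B = \int[tuple_measure mu n]_t (\1_B t)%:E.
  by move=> mB; rewrite integral_indic ?setIT.
rewrite -(E A mA) => <-//; first exact: E.
by apply/measurable_EFinP; exact: measurable_indic.
Qed.

End tuple_preserving.

(** * Lebesgue measure on row vectors *)

Section lebesgue_rV_theory.
Local Open Scope ereal_scope.
Context {R : realType}.

(** Lebesgue measure on the line is determined by its values on intervals. *)
Lemma lebesgue_measure_translation (a : R) :
  measure_preserving (@lebesgue_measure R) (fun x : measurableTypeR R => (x + a)%R).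
Proof.
have mf : measurable_fun setT (fun x : measurableTypeR R => (x + a)%R).
  by apply: measurable_funD.
split => // A mA; pose h (x : measurableTypeR R) : measurableTypeR R := (x + a)%R.
have mh : measurable_fun setT h by [].
rewrite -[LHS]/(pushforward (@lebesgue_measure R) h A).
apply/esym; apply: (@lebesgue_measure_unique R (pushforward (@lebesgue_measure R) h)) => //.
move=> _ [[c e] _ <-].
rewrite -[RHS]/(lebesgue_measure (h @^-1` `]c, e])).
rewrite (_ : _ @^-1` _ = `](c - a)%R, (e - a)%R]%classic); last first.
  by apply/seteqP; split => x /=; rewrite !in_itv/= ltrBlDr lerBrDr.
by rewrite !lebesgue_measure_itv/= !lte_fin ltrD2r -!EFinB opprB addrA subrK.
Qed.

Lemma lebesgue_rV_translation n (a : 'rV[R]_n) :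
  measure_preserving lebesgue_rV (fun x => x + a)%R.
Proof.
have mf : measurable_fun setT (fun x : 'rV[R]_n => x + a)%R.
  by apply: measurable_addrV => //; exact: measurable_id.
split => // A mA.
pose h (i : 'I_n) := fun x : measurableTypeR R => (x + a ord0 i)%R.
have [_] := @tuple_measure_preserving _ _ _ lebesgue_measure n h
  (fun i => lebesgue_measure_translation (a ord0 i)).
rewrite /lebesgue_rV /pushforward => /(_ (row_of_tuple @^-1` A)) <-.
  congr (_ _); apply/seteqP.
  have E t : (row_of_tuple (tuple_map h t) = row_of_tuple t + a)%R.
    by apply/rowP => i; rewrite !mxE tnth_mktuple.
  by split => t /=; rewrite E.
by rewrite -[X in measurable X]setTI; exact: measurable_row_of_tuple.
Qed.

Lemma measurable_rV_box n (A : 'I_n -> set (measurableTypeR R)) :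
  (forall i, measurable (A i)) ->
  measurable [set x : 'rV[R]_n | forall i, A i (x ord0 i)].
Proof.
move=> mA; rewrite (_ : [set _ | _] = \bigcap_(i in [set: 'I_n])
    ((fun x : 'rV[R]_n => x ord0 i) @^-1` A i)); last first.
  by apply/seteqP; split => x /= Ax i; [move=> _; exact: Ax|exact: Ax].
apply: fin_bigcap_measurable => [|i _]; first exact: finite_finset.
by rewrite -[X in measurable X]setTI; exact: measurable_rV_coord.
Qed.

Lemma lebesgue_rV_box n (A : 'I_n -> set (measurableTypeR R)) :
  (forall i, measurable (A i)) ->
  lebesgue_rV [set x : 'rV[R]_n | forall i, A i (x ord0 i)] =
  \prod_(i < n) lebesgue_measure (A i).
Proof.
move=> mA; rewrite -tuple_measure_box// /lebesgue_rV /pushforward.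
congr (_ _); apply/seteqP; split => t /= h i; have := h i; by rewrite mxE.
Qed.

End lebesgue_rV_theory.
(** * Euclidean geometry and Lebesgue measure *)

Section euclidean.
Context {R : realType} {n : nat}.
Implicit Types x y z u : 'rV[R]_n.

Definition dot x y : R := \sum_i x ord0 i * y ord0 i.

Lemma dotC x y : dot x y = dot y x.
Proof. by apply: eq_bigr => i _; rewrite mulrC. Qed.

Lemma dotDl x y z : dot (x + y) z = dot x z + dot y z.
Proof. by rewrite -big_split; apply: eq_bigr => i _; rewrite mxE mulrDl. Qed.

Lemma dotZl a x z : dot (a *: x) z = a * dot x z.
Proof. by rewrite mulr_sumr; apply: eq_bigr => i _; rewrite mxE mulrA. Qed.

Lemma dotDr x y z : dot z (x + y) = dot z x + dot z y.
Proof. by rewrite dotC dotDl !(dotC z). Qed.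

Lemma dotZr a x z : dot z (a *: x) = a * dot z x.
Proof. by rewrite dotC dotZl (dotC z). Qed.

Lemma dotNl x z : dot (- x) z = - dot x z.
Proof. by rewrite -scaleN1r dotZl mulN1r. Qed.

Lemma dotNr x z : dot z (- x) = - dot z x.
Proof. by rewrite -scaleN1r dotZr mulN1r. Qed.

Lemma dot_ge0 x : 0 <= dot x x.
Proof. by apply: sumr_ge0 => i _; rewrite -expr2 sqr_ge0. Qed.

Lemma dot_eq0 x : (dot x x == 0) = (x == 0).
Proof.
apply/eqP/eqP => [x0|->]; last by rewrite /dot big1// => i _; rewrite mxE mul0r.
apply/rowP => i; rewrite mxE; apply/eqP; rewrite -sqrf_eq0.
have := @psumr_eq0P _ _ predT (fun i => x ord0 i * x ord0 i) _ x0.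
by rewrite expr2 => ->// j _; rewrite -expr2 sqr_ge0.
Qed.

Lemma enormE x : enorm x = Num.sqrt (dot x x).
Proof. by congr Num.sqrt; apply: eq_bigr => i _; rewrite expr2. Qed.

Lemma enorm_ge0 x : 0 <= enorm x.
Proof. exact: sqrtr_ge0. Qed.

Lemma sqr_enorm x : enorm x ^+ 2 = dot x x.
Proof. by rewrite enormE sqr_sqrtr// dot_ge0. Qed.

Lemma enorm_eq0 x : (enorm x == 0) = (x == 0).
Proof. by rewrite -sqrf_eq0 sqr_enorm dot_eq0. Qed.

Lemma enorm0 : enorm (0 : 'rV[R]_n) = 0.
Proof. by apply/eqP; rewrite enorm_eq0. Qed.

Lemma enorm_gt0 x : (0 < enorm x) = (x != 0).
Proof. by rewrite lt0r enorm_ge0 andbT enorm_eq0. Qed.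

Lemma enormZ a x : enorm (a *: x) = `|a| * enorm x.
Proof.
by rewrite !enormE dotZl dotZr mulrA -expr2 sqrtrM ?sqr_ge0// sqrtr_sqr.
Qed.

Lemma enormN x : enorm (- x) = enorm x.
Proof. by rewrite -scaleN1r enormZ normrN1 mul1r. Qed.

Lemma enormB x y : enorm (x - y) = enorm (y - x).
Proof. by rewrite -enormN opprB. Qed.

Lemma dot_le_enorm x y : dot x y <= enorm x * enorm y.
Proof.
have [->|x0] := eqVneq x 0.
  by rewrite enorm0 mul0r /dot big1// => i _; rewrite mxE mul0r.
have xx0 : 0 < dot x x by rewrite lt0r dot_ge0 dot_eq0 x0.
apply: le_trans (ler_norm _) _.
rewrite -(ler_pXn2r (n := 2))// ?nnegrE ?mulr_ge0 ?enorm_ge0//.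
rewrite exprMn !sqr_enorm real_normK ?num_real// mulrC -ler_pdivrMr//.
have := dot_ge0 ((dot x y / dot x x) *: x - y).
rewrite dotDl !dotDr !dotNl !dotNr !dotZl !dotZr (dotC y x) opprK divfK ?gt_eqF//.
by rewrite mulrAC -expr2; lra.
Qed.

Lemma ler_enormD x y : enorm (x + y) <= enorm x + enorm y.
Proof.
rewrite -(ler_pXn2r (n := 2))// ?nnegrE ?addr_ge0 ?enorm_ge0//.
rewrite sqrrD !sqr_enorm dotDl !dotDr (dotC y x).
have := dot_le_enorm x y; set e := enorm x * enorm y; rewrite mulr2n; lra.
Qed.

Lemma enorm_sum k (f : 'I_k -> 'rV[R]_n) :
  enorm (\sum_i f i) <= \sum_i enorm (f i).
Proof.
elim/big_ind2 : _ => [|a b c e ab ce|//]; first by rewrite enorm0.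
by apply: le_trans (ler_enormD _ _) _; exact: lerD.
Qed.

Lemma enorm_le_sum x : enorm x <= \sum_i `|x ord0 i|.
Proof.
rewrite [leLHS](_ : _ = enorm (\sum_i x ord0 i *: delta_mx ord0 i)).
  apply: le_trans (enorm_sum _) _; apply: ler_sum => i _.
  rewrite enormZ ler_piMr// enormE /dot (bigD1 i)//= big1 ?mxE ?eqxx ?mul1r.
    by rewrite addr0 sqrtr1.
  by move=> j ji; rewrite !mxE (negbTE ji) andbF mul0r.
by congr enorm; exact: row_sum_delta.
Qed.

Lemma continuous_enorm : continuous (@enorm R n).
Proof.
have cs : continuous (fun x : 'rV[R]_n => \sum_i x ord0 i ^+ 2).
  apply: continuous_big => [|i _ x]; first exact: add_continuous.
  apply: (@continuous_comp _ _ _ (fun x : 'rV[R]_n => x ord0 i) (fun y : R => y ^+ 2)).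
    exact: coord_continuous.
  exact: exprn_continuous.
move=> x; apply: (@continuous_comp _ _ _ (fun x => \sum_i x ord0 i ^+ 2) Num.sqrt).
  exact: cs.
exact: sqrt_continuous.
Qed.

Definition eball x (r : R) : set 'rV[R]_n := [set y | enorm (x - y) < r].

Lemma open_eball x r : open (eball x r).
Proof.
have -> : eball x r = (fun y => enorm (x - y)) @^-1` [set z | z < r] by [].
apply: open_comp; last exact: open_lt.
move=> y _; apply: (@continuous_comp _ _ _ (fun y => x - y) (@enorm R n)).
  by apply: continuousB; [exact: cst_continuous|exact: cvg_id].
exact: continuous_enorm.
Qed.

Lemma measurable_eball x r : measurable (eball x r).
Proof. by apply: open_rV_measurable; exact: open_eball. Qed.

Lemma open_eballP (U : set 'rV[R]_n) x : open U -> U x ->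
  exists2 r, 0 < r & eball x r `<=` U.
Proof.
move=> oU Ux; have := open_nbhs_nbhs (conj oU Ux).
move=> /nbhs_ballP[e /= e0 xeU]; exists e => // y xy; apply: xeU.
split => // a i; rewrite ord1 -ball_normE /ball_/=.
by apply: le_lt_trans xy; apply: le_trans (coord_le_enorm _ i); rewrite !mxE.
Qed.

(** The orthogonal reflection in the hyperplane normal to u; division by zero
makes it the identity for u = 0. *)
Definition refl u x := x - (2 * dot x u / dot u u) *: u.

Lemma refl0 x : refl 0 x = x.
Proof. by rewrite /refl scaler0 subr0. Qed.

Lemma reflD u x y : refl u (x + y) = refl u x + refl u y.
Proof. by rewrite /refl dotDl mulrDr mulrDl scalerDl opprD addrACA. Qed.

Lemma reflZ u a x : refl u (a *: x) = a *: refl u x.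
Proof. by rewrite /refl dotZl scalerBr scalerA; do 3 congr (_ _); rewrite !mulrA (mulrC a). Qed.

Lemma reflB u x y : refl u (x - y) = refl u x - refl u y.
Proof. by rewrite -scaleN1r reflD reflZ scaleN1r. Qed.

Lemma reflK u : involutive (refl u).
Proof.
move=> x; have [->|u0] := eqVneq u 0; first by rewrite !refl0.
have uu0 : dot u u != 0 by rewrite dot_eq0.
rewrite {1}/refl {2}/refl dotDl dotNl dotZl divfK// /refl.
by rewrite (_ : dot x u - 2 * dot x u = - dot x u) 1?mulrN ?mulNr ?scaleNr ?opprK ?subrK//; ring.
Qed.

Lemma dot_refl u x y : dot (refl u x) (refl u y) = dot x y.
Proof.
have [->|u0] := eqVneq u 0; first by rewrite !refl0.
have uu0 : dot u u != 0 by rewrite dot_eq0.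
rewrite /refl dotDl !dotDr !dotNl !dotNr !dotZl !dotZr (dotC u y).
by field.
Qed.

Lemma enorm_refl u x : enorm (refl u x) = enorm x.
Proof. by rewrite !enormE dot_refl. Qed.

(** Reflections act transitively on spheres; this replaces the rotation group. *)
Lemma refl_swap x y : enorm x = enorm y -> refl (x - y) x = y.
Proof.
move=> xy; have [/eqP|u0] := eqVneq (x - y) 0.
  by rewrite subr_eq0 => /eqP ->; rewrite subrr refl0.
have uu0 : dot (x - y) (x - y) != 0 by rewrite dot_eq0.
rewrite /refl (_ : 2 * _ = dot (x - y) (x - y)); first by rewrite divff// scale1r opprB addrC subrK.
rewrite !dotDl !dotDr !dotNl !dotNr (dotC y x) -!sqr_enorm xy; ring.
Qed.

Lemma measurable_refl u : measurable_fun setT (refl u).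
Proof.
apply: measurable_addrV; first exact: measurable_id.
apply: measurableT_comp (@measurable_oppr R n) _.
apply: measurable_scalerV; last exact: measurable_cst.
apply: measurable_funM => //; apply: measurable_funM => //.
by apply: measurable_sum => i; apply: measurable_funM => //; exact: measurable_rV_coord.
Qed.

End euclidean.

Lemma mule_pI (R : realType) (c x y : \bar R) :
  c \is a fin_num -> (0 < c)%E -> (c * x = c * y)%E -> x = y.
Proof.
move=> cf c0 /eqP cxy; apply/eqP; move: cxy.
by rewrite !eq_le !(lee_pmul2l cf c0).
Qed.

Section as_sigma_finite.
Context d (T : measurableType d) (R : realType) (m : {measure set T -> \bar R}).
Hypothesis sf : sigma_finite setT m.

(** Packages a measure with a proof of sigma-finiteness, for measures that acquire
the property only under a hypothesis. *)
Definition as_sigma_finite of sigma_finite setT m : set T -> \bar R := m.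

HB.instance Definition _ := isMeasure.Build _ _ _ (as_sigma_finite sf)
  (measure0 m) (measure_ge0 m) (@measure_semi_sigma_additive _ _ _ m).

HB.instance Definition _ :=
  Measure_isSigmaFinite.Build _ _ _ (as_sigma_finite sf) sf.

End as_sigma_finite.

Section translation_invariant.
Local Open Scope ereal_scope.
Context {R : realType} {n : nat}.
Local Notation L := (@lebesgue_rV R n).

Lemma integral_indic1 d (T : measurableType d) (m : {measure set T -> \bar R}) (A : set T) :
  measurable A -> \int[m]_x (\1_A x)%:E = m A.
Proof. by move=> mA; rewrite integral_indic ?setIT. Qed.

(** Two translation-invariant measures are proportional: both sides compute
the double integral of 1_A(x) 1_B(y - x), the right one after the substitution
of x + y for x. *)
Lemma translation_invariant_eq (m : {sigma_finite_measure set 'rV[R]_n -> \bar R})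
    (A B : set 'rV[R]_n) :
  (forall a, measure_preserving m (fun x => x + a)%R) ->
  measurable A -> measurable B ->
  m A * L B = m (-%R @^-1` B) * L A.
Proof.
move=> mP mA mB.
have mNB : measurable (-%R @^-1` B : set 'rV[R]_n).
  by rewrite -[X in measurable X]setTI; exact: measurable_oppr.
have mI (C : set 'rV[R]_n) : measurable C ->
    measurable_fun setT (fun x => (\1_C x : R)%:E).
  by move=> mC; apply/measurable_EFinP; exact: measurable_indic.
pose g1 (z : 'rV[R]_n * 'rV[R]_n) := (\1_A z.1 : R)%:E * (\1_B (z.2 - z.1)%R : R)%:E.
have mg1 : measurable_fun setT g1.
  apply: emeasurable_funM; first exact: measurableT_comp (mI _ mA) _.
  apply: measurableT_comp (mI _ mB) _; apply: measurable_addrV => //.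
  exact: measurableT_comp (@measurable_oppr R n) _.
have g10 z : 0 <= g1 z by rewrite mule_ge0.
pose g2 (z : 'rV[R]_n * 'rV[R]_n) := (\1_A (z.1 + z.2)%R : R)%:E * (\1_(-%R @^-1` B) z.1 : R)%:E.
have mg2 : measurable_fun setT g2.
  apply: emeasurable_funM; last exact: measurableT_comp (mI _ mNB) _.
  by apply: measurableT_comp (mI _ mA) _; exact: measurable_addrV.
have g20 z : 0 <= g2 z by rewrite mule_ge0.
transitivity (\int[m]_x \int[L]_y g1 (x, y)).
  rewrite -(integral_indic1 m mA) -ge0_integralZr//; last exact: mI.
  apply: eq_integral => x _; rewrite /g1/= ge0_integralZl//; last first.
    by apply: measurableT_comp (mI _ mB) _; exact: measurable_addrV.
  congr (_ * _); rewrite -(integral_indic1 L mB).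
  by rewrite (integral_preserving (lebesgue_rV_translation (- x)%R) (mI _ mB)).
rewrite fubini_tonelli//.
transitivity (\int[L]_y \int[m]_x g2 (x, y)).
  apply: eq_integral => y _.
  rewrite -(integral_preserving (mP y) (g := fun x => g1 (x, y)))//; last first.
    exact: measurableT_comp mg1 (measurable_pair2 _).
  by apply: eq_integral => x _; rewrite /g1 /g2/= opprD addrCA subrr addr0.
rewrite -fubini_tonelli//.
rewrite -(integral_indic1 m mNB) -ge0_integralZr//; last exact: mI.
apply: eq_integral => x _; rewrite /g2/= ge0_integralZr//; last first.
  by apply: measurableT_comp (mI _ mA) _; exact: measurable_addrV.
rewrite muleC; congr (_ * _); rewrite -(integral_indic1 L mA).
rewrite -(integral_preserving (lebesgue_rV_translation x) (mI _ mA))//.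
by apply: eq_integral => y _; rewrite addrC.
Qed.

(** The image of Lebesgue measure under an additive bijection is again invariant
under translations; the factor, an absolute determinant, is read off on any
convenient set B. *)
Lemma lebesgue_rV_linear (M M' : 'rV[R]_n -> 'rV[R]_n) (A B : set 'rV[R]_n) :
  measurable_fun setT M -> measurable_fun setT M' -> cancel M M' -> cancel M' M ->
  {morph M : x y / (x + y)%R} -> measurable A -> measurable B ->
  L (M @^-1` A) * L B = L (M @^-1` (-%R @^-1` B)) * L A.
Proof.
move=> mM mM' MK MK' MD mA mB.
have sf := pushforward_sigma_finite (sigma_finiteT L) mM' MK.
pose m1 : {measure set 'rV[R]_n -> \bar R} :=
  measure_function_pushforward__canonical__measure_function_Measure L mM.
have sf1 : sigma_finite setT m1 by exact: sf.
have := @translation_invariant_eq (as_sigma_finite sf1) A B; apply => // a.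
split.
  by apply: measurable_addrV => //; exact: measurable_id.
move=> C mC; rewrite -[LHS]/(L (M @^-1` _)) -[RHS]/(L (M @^-1` _)).
rewrite -[RHS](lebesgue_rV_translation (M' a)).2; last first.
  by rewrite -[X in measurable X]setTI; exact: (mM measurableT).
by congr (L _); apply/seteqP; split => x /=; rewrite MD MK'.
Qed.

End translation_invariant.

Section scaling.
Local Open Scope ereal_scope.
Context {R : realType} {n : nat}.
Local Notation L := (@lebesgue_rV R n).

Definition cube (r : R) : set 'rV[R]_n := [set x | forall i, (`|x ord0 i| < r)%R].

Let cubeE r : cube r =
  [set x : 'rV[R]_n | forall i, (`](- r)%R, r[%classic : set R) (x ord0 i)].
Proof. by apply/seteqP; split => x /= h i; have := h i; rewrite in_itv/= ltr_norml. Qed.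

Lemma measurable_cube r : measurable (cube r).
Proof. by rewrite cubeE; apply: (@measurable_rV_box R n (fun=> `](- r)%R, r[%classic)). Qed.

Lemma lebesgue_cube r : (0 <= r)%R -> L (cube r) = ((2 * r) ^+ n)%:E.
Proof.
move=> r0; rewrite cubeE (@lebesgue_rV_box R n (fun=> `](- r)%R, r[%classic))//.
rewrite (eq_bigr (fun=> (2 * r)%:E)); last first.
  move=> i _; rewrite lebesgue_measure_itv/=.
  have [->|rn0] := eqVneq r 0%R; first by rewrite oppr0 lte_fin ltxx mulr0.
  by rewrite lte_fin gtrN ?lt0r ?rn0// -EFinB opprK mulr2n mulrDl mul1r.
by rewrite prodEFin prodr_const card_ord.
Qed.

Lemma lebesgue_scale (r : R) (A : set 'rV[R]_n) : (0 < r)%R -> measurable A ->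
  L ( *:%R r @^-1` A) = (r ^- n)%:E * L A.
Proof.
move=> r0 mA.
have ms (c : R) : measurable_fun setT ( *:%R c : 'rV[R]_n -> 'rV[R]_n).
  by apply: measurable_scalerV => //; exact: measurable_id.
have := @lebesgue_rV_linear R n ( *:%R r) ( *:%R r^-1) A (cube 1) (ms _) (ms _)
  (scalerK (lt0r_neq0 r0)) (scalerKV (lt0r_neq0 r0)) (scalerDr r) mA (measurable_cube 1).
rewrite (_ : *:%R r @^-1` (-%R @^-1` _) = cube r^-1); last first.
  apply/seteqP; split => x /= h i; have := h i;
    by rewrite !mxE normrN normrM gtr0_norm// mulrC -ltr_pdivlMr// div1r.
rewrite !lebesgue_cube ?invr_ge0 ?(ltW r0)// mulr1 exprMn EFinM -muleA muleC.
move=> /(congr1 (fun x => (2 ^- n)%:E * x)).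
rewrite !muleA -!EFinM mulVf ?expf_neq0// !mul1e => ->.
by rewrite mul1r exprVn.
Qed.

Lemma lebesgue_eball_lty r : L (eball 0 r) < +oo.
Proof.
apply: (@le_lt_trans _ _ (L (cube `|r|))); last by rewrite lebesgue_cube// ltry.
apply: le_measure; rewrite ?inE; [exact: measurable_eball|exact: measurable_cube|].
move=> x; rewrite /eball/= sub0r enormN => xr i.
by apply: le_lt_trans (coord_le_enorm _ _) _; apply: lt_le_trans (ler_norm r).
Qed.

Lemma lebesgue_eball_gt0 r : (0 < r)%R -> 0 < L (eball 0 r).
Proof.
move=> r0; apply: (@lt_le_trans _ _ (L (cube (r / n.+1%:R)))).
  by rewrite lebesgue_cube ?lte_fin ?exprn_gt0// ?mulr_gt0 ?divr_gt0// divr_ge0// ltW.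
apply: le_measure; rewrite ?inE; [exact: measurable_cube|exact: measurable_eball|].
move=> x xr; rewrite /eball/= sub0r enormN.
apply: le_lt_trans (enorm_le_sum _) _.
apply: (@le_lt_trans _ _ (\sum_(i < n) r / n.+1%:R)%R).
  by apply: ler_sum => i _; exact: ltW.
have -> : (\sum_(i < n) r / n.+1%:R = r * n%:R / n.+1%:R :> R)%R.
  by rewrite sumr_const card_ord -[LHS]mulr_natr mulrAC.
by rewrite ltr_pdivrMr// ltr_pM2l// ltr_nat.
Qed.

Lemma eball_scale (r s : R) : (0 < r)%R ->
  *:%R r @^-1` (eball 0 s) = (eball 0 (s / r) : set 'rV[R]_n).
Proof.
move=> r0; apply/seteqP; split => x; rewrite /eball/= !sub0r !enormN enormZ gtr0_norm//.
  by rewrite ltr_pdivlMr// mulrC.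
by rewrite ltr_pdivlMr// mulrC.
Qed.

Lemma lebesgue_eball r : (0 <= r)%R -> (0 < n)%N ->
  L (eball 0 r) = (r ^+ n)%:E * L (eball 0 1).
Proof.
rewrite le_eqVlt => /predU1P[<- n0|r0 _].
  rewrite expr0n gtn_eqF// mul0e (_ : eball 0 0 = set0) ?measure0//.
  by rewrite -subset0 => x; rewrite /eball/= ltNge enorm_ge0.
have := @lebesgue_scale r^-1 (eball 0 1); rewrite invr_gt0 => /(_ r0 (measurable_eball _ _)).
by rewrite eball_scale ?invr_gt0// div1r invrK -exprVn invrK.
Qed.

(** Reflections preserve Lebesgue measure, since they preserve the unit ball. *)
Lemma lebesgue_refl (u : 'rV[R]_n) : measure_preserving L (refl u).
Proof.
split; first exact: measurable_refl.
move=> A mA.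
have := @lebesgue_rV_linear R n (refl u) (refl u) A (eball 0 1) (measurable_refl u)
  (measurable_refl u) (reflK u) (reflK u) (reflD u) mA (measurable_eball _ _).
rewrite (_ : _ @^-1` (-%R @^-1` _) = eball 0 1); last first.
  by apply/seteqP; split => x; rewrite /eball/= !sub0r ?opprK ?enormN enorm_refl.
rewrite muleC; apply: mule_pI; last exact: lebesgue_eball_gt0.
by rewrite ge0_fin_numE ?lebesgue_eball_lty// measure_ge0.
Qed.

End scaling.
(** * Reflection-invariant measures on the sphere *)

Section sphere_uniqueness.
Local Open Scope ereal_scope.
Context {R : realType} {n : nat}.
Local Notation S := (@unit_sphere R n).
Local Notation L := (@lebesgue_rV R n).

Lemma measurable_sphere : measurable S.
Proof.
rewrite (_ : S = @enorm R n @^-1` [set 1%R]); last by [].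
by rewrite -[X in measurable X]setTI; exact: measurable_enorm.
Qed.

Definition refl_invariant (m : set 'rV[R]_n -> \bar R) :=
  forall u A, measurable A -> m (refl u @^-1` A) = m A.

Lemma measurable_dist_lt r :
  measurable [set z : 'rV[R]_n * 'rV[R]_n | (enorm (z.1 - z.2) < r)%R].
Proof.
have mf : measurable_fun setT (fun z : 'rV[R]_n * 'rV[R]_n => enorm (z.1 - z.2)).
  apply: measurableT_comp (@measurable_enorm R n) _.
  apply: measurable_addrV => //.
  exact: measurableT_comp (@measurable_oppr R n) _.
rewrite (_ : [set _ | _] = (fun z : 'rV[R]_n * 'rV[R]_n => enorm (z.1 - z.2)) @^-1` `]-oo, r[).
  by rewrite -[X in measurable X]setTI; exact: mf.
by apply/seteqP; split => z /=; rewrite in_itv.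
Qed.

Lemma eball_sphere_eq (m : {measure set 'rV[R]_n -> \bar R}) x y r :
  refl_invariant m -> S x -> S y ->
  m (S `&` eball x r) = m (S `&` eball y r).
Proof.
move=> mP Sx Sy; rewrite -(mP (y - x)%R); last first.
  by apply: measurableI; [exact: measurable_sphere|exact: measurable_eball].
congr (m _).
have xy : refl (y - x) x = y.
  rewrite -{2}(@refl_swap R n y x) ?reflK//.
  by move: Sx Sy; rewrite /unit_sphere/= => -> ->.
have E z : enorm (x - refl (y - x) z) = enorm (y - z).
  by rewrite -{1}(reflK (y - x) x) xy -reflB enorm_refl.
by apply/seteqP; split => z; rewrite /eball/= /unit_sphere/= enorm_refl E.
Qed.

Section ratio.
Variables m1 m2 : {sigma_finite_measure set 'rV[R]_n -> \bar R}.
Hypotheses (P1 : refl_invariant m1) (P2 : refl_invariant m2).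
Variables (x0 : 'rV[R]_n) (Sx0 : S x0).

(** Both sides are compared with the measure of the pairs of points at distance
less than r, the first in V and the second in U: the sections of this set are
balls, whose measures do not depend on their centre. *)
Lemma sphere_ball_ratio (U V : set 'rV[R]_n) r :
  measurable U -> measurable V -> (forall x, V x -> eball x r `<=` U) ->
  m2 (S `&` eball x0 r) * m1 (S `&` V) <= m1 (S `&` eball x0 r) * m2 (S `&` U).
Proof.
move=> mU mV VU.
pose W : set ('rV[R]_n * 'rV[R]_n) := ((S `&` V) `*` (S `&` U)) `&` [set z | (enorm (z.1 - z.2) < r)%R].
have mS := measurable_sphere.
have mW : measurable W.
  by apply: measurableI (measurable_dist_lt r); apply: measurableX; exact: measurableI.
have mf : measurable_fun setT (fun z => (\1_W z : R)%:E).
  by apply/measurable_EFinP; exact: measurable_indic.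
have f0 z : 0 <= (\1_W z : R)%:E by [].
have mx x : measurable (xsection W x) by exact: measurable_xsection.
have my y : measurable (ysection W y) by exact: measurable_ysection.
have := fubini_tonelli (m1 := m1) (m2 := m2) _ mf f0.
have -> : \int[m1]_x \int[m2]_y (\1_W (x, y) : R)%:E =
    m2 (S `&` eball x0 r) * m1 (S `&` V).
  rewrite -(integral_indic1 m1 (measurableI _ _ mS mV)) -ge0_integralZl//; last first.
    by apply/measurable_EFinP; apply: measurable_indic; exact: measurableI.
  apply: eq_integral => x _.
  rewrite (_ : \int[m2]_y _ = m2 (xsection W x)); last first.
    rewrite -(integral_indic1 m2 (mx x)); apply: eq_integral => y _.
    by rewrite !indicE mem_xsection.
  have [xSV|xSV] := boolP (x \in S `&` V); last first.
    rewrite indicE (negbTE xSV) mulr0n mule0 (_ : xsection W x = set0) ?measure0// -subset0 => y.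
    by rewrite /xsection/= inE => -[[/= SVx _] _]; move: xSV; rewrite notin_setE.
  rewrite indicE xSV mulr1n mule1; move: xSV; rewrite inE => -[Sx Vx]; rewrite (eball_sphere_eq r P2 Sx0 Sx).
  congr (m2 _); apply/seteqP; split => y; rewrite /xsection/= inE.
    by move=> [[_ [Sy _]] xy].
  by move=> [Sy xy]; split => //; split => //; split => //; exact: VU xy.
move=> ->.
rewrite -(integral_indic1 m2 (measurableI _ _ mS mU)) -ge0_integralZl//; last first.
  by apply/measurable_EFinP; apply: measurable_indic; exact: measurableI.
apply: ge0_le_integral => //.
- by move=> y _; exact: integral_ge0.
- exact: (measurable_fun_fubini_tonelli_G (m1 := m1) _ mf f0).
- apply: measurable_funeM.
  by apply/measurable_EFinP; apply: measurable_indic; exact: measurableI.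
move=> y _.
rewrite (_ : \int[m1]_x _ = m1 (ysection W y)); last first.
  rewrite -(integral_indic1 m1 (my y)); apply: eq_integral => x _.
  by rewrite !indicE mem_ysection.
have [ySU|ySU] := boolP (y \in S `&` U); last first.
  rewrite indicE (negbTE ySU) mulr0n mule0 (_ : ysection W y = set0) ?measure0// -subset0 => x.
  by rewrite /ysection/= inE => -[[_ /= SUy] _]; move: ySU; rewrite notin_setE.
rewrite indicE ySU mulr1n mule1; move: ySU; rewrite inE => -[Sy Uy]; rewrite (eball_sphere_eq r P1 Sx0 Sy).
apply: le_measure; rewrite ?inE//.
  by apply: measurableI => //; exact: measurable_eball.
move=> x; rewrite /ysection/= inE => -[[[Sx _] _] xy]; split => //.
by rewrite /eball/= enormB.
Qed.

End ratio.

(** Averaging the measures of small balls against Lebesgue measure shows that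
they cannot all vanish. *)
Lemma sphere_ball_gt0 (m2 : {sigma_finite_measure set 'rV[R]_n -> \bar R})
    (x0 : 'rV[R]_n) r : refl_invariant m2 -> S x0 ->
  (0 < r)%R -> 0 < m2 S -> 0 < m2 (S `&` eball x0 r).
Proof.
move=> P2 Sx0 r0 S0; rewrite lt_neqAle measure_ge0 andbT eq_sym; apply/eqP => q0.
have mS := measurable_sphere.
have r20 : (0 < r / 2)%R by rewrite divr_gt0.
pose W : set ('rV[R]_n * 'rV[R]_n) := ((setT : set 'rV[R]_n) `*` S) `&` [set z | (enorm (z.1 - z.2) < r / 2)%R].
have mW : measurable W.
  by apply: measurableI; [exact: measurableX|exact: measurable_dist_lt].
have mf : measurable_fun setT (fun z => (\1_W z : R)%:E).
  by apply/measurable_EFinP; exact: measurable_indic.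
have f0 z : 0 <= (\1_W z : R)%:E by [].
have mx x : measurable (xsection W x) by exact: measurable_xsection.
have my y : measurable (ysection W y) by exact: measurable_ysection.
have := fubini_tonelli (m1 := L) (m2 := m2) _ mf f0.
rewrite (_ : \int[L]_x _ = 0); last first.
  apply: integral0_eq => c _.
  rewrite (_ : \int[m2]_y _ = m2 (xsection W c)); last first.
    rewrite -(integral_indic1 m2 (mx c)); apply: eq_integral => y _.
    by rewrite !indicE mem_xsection.
  have [[y [Sy cy]]|noy] := pselect (exists y, S y /\ (enorm (c - y) < r / 2)%R); last first.
    rewrite (_ : xsection W c = set0) ?measure0// -subset0 => y.
    by rewrite /xsection/= inE => -[[_ /= Sy] cy]; apply: noy; exists y.
  apply/eqP; rewrite eq_le measure_ge0 andbT -q0 (eball_sphere_eq r P2 Sx0 Sy).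
  apply: le_measure; rewrite ?inE//.
    by apply: measurableI => //; exact: measurable_eball.
  move=> z; rewrite /xsection/= inE => -[[_ /= Sz] cz]; split => //.
  rewrite /eball/=; rewrite (_ : y - z = (y - c) + (c - z))%R; last by rewrite addrA subrK.
  by apply: le_lt_trans (ler_enormD _ _) _; rewrite (splitr r) ltrD// enormB.
move=> /esym/eqP; apply/negP; rewrite gt_eqF//.
rewrite (_ : \int[m2]_y _ = L (eball 0 (r / 2)) * m2 S).
  by rewrite mule_gt0// lebesgue_eball_gt0.
rewrite -(integral_indic1 m2 mS) -ge0_integralZl//; last first.
  by apply/measurable_EFinP; exact: measurable_indic.
apply: eq_integral => y _.
rewrite (_ : \int[L]_x _ = L (ysection W y)); last first.
  rewrite -(integral_indic1 L (my y)); apply: eq_integral => x _.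
  by rewrite !indicE mem_ysection.
have [yS|yS] := boolP (y \in S); last first.
  rewrite indicE (negbTE yS) mulr0n mule0 (_ : ysection W y = set0) ?measure0// -subset0 => x.
  by rewrite /ysection/= inE => -[[_ /= Sy] _]; move: yS; rewrite notin_setE.
rewrite indicE yS mulr1n mule1 -[RHS](lebesgue_rV_translation (- y)%R).2; last exact: measurable_eball.
congr (L _); apply/seteqP; split => x; rewrite /ysection/= inE /eball/= sub0r opprB.
  by move=> [_ /=]; rewrite enormB.
by rewrite enormB => xy; split => //; split => //; move: yS; rewrite inE.
Qed.

Lemma sphere_ball_ratio_eq (m1 m2 : {sigma_finite_measure set 'rV[R]_n -> \bar R})
    (x0 : 'rV[R]_n) r :
  refl_invariant m1 -> refl_invariant m2 -> S x0 ->
  m2 (S `&` eball x0 r) * m1 S = m1 (S `&` eball x0 r) * m2 S.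
Proof.
move=> P1 P2 Sx0; apply/eqP; rewrite eq_le.
have := @sphere_ball_ratio m1 m2 P1 P2 x0 Sx0 setT setT r measurableT measurableT.
have := @sphere_ball_ratio m2 m1 P2 P1 x0 Sx0 setT setT r measurableT measurableT.
by rewrite setIT => -> // -> //.
Qed.

(** An open set is the increasing union of the sets V of points whose r-ball it
contains, to which the comparison of balls applies. *)
Lemma sphere_open_le (m1 m2 : {sigma_finite_measure set 'rV[R]_n -> \bar R})
    (U : set 'rV[R]_n) :
  refl_invariant m1 -> refl_invariant m2 -> m1 S < +oo -> m2 S < +oo -> open U ->
  m2 S * m1 (S `&` U) <= m1 S * m2 (S `&` U).
Proof.
move=> P1 P2 F1 F2 oU; have mU := open_rV_measurable oU; have mS := measurable_sphere.
have [m2S0|m2S0] := eqVneq (m2 S) 0; first by rewrite m2S0 mul0e mule_ge0.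
have m2S : 0 < m2 S by rewrite lt0e m2S0 measure_ge0.
have [x0 Sx0] : exists x, S x.
  by apply/set0P; apply: contraNneq m2S0 => ->; rewrite measure0.
pose V (j : nat) : set 'rV[R]_n := [set x | eball x j.+1%:R^-1 `<=` U].
have mV j : measurable (V j).
  rewrite -[V j]setCK; apply: measurableC; apply: open_rV_measurable.
  rewrite (_ : ~` V j = \bigcup_(y in ~` U) eball y j.+1%:R^-1).
    by apply: bigcup_open => y _; exact: open_eball.
  apply/seteqP; split => [x /= /existsNP[y /not_implyP[xy Uy]]|x [y Uy yx] Vx].
    by exists y => //; rewrite /eball/= enormB.
  by apply: Uy; apply: Vx; rewrite /eball/= enormB.
have key j : m2 S * m1 (S `&` V j) <= m1 S * m2 (S `&` U).
  have j0 : (0 < j.+1%:R^-1 :> R)%R by rewrite invr_gt0.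
  have := sphere_ball_ratio_eq j.+1%:R^-1 P1 P2 Sx0.
  have := @sphere_ball_ratio m1 m2 P1 P2 x0 Sx0 U (V j) j.+1%:R^-1 mU (mV j) (fun x => id).
  have := @sphere_ball_gt0 m2 x0 _ P2 Sx0 j0 m2S.
  have : m2 (S `&` eball x0 j.+1%:R^-1) \is a fin_num.
    rewrite ge0_fin_numE ?measure_ge0//; apply: le_lt_trans F2.
    by apply: le_measure; rewrite ?inE//; apply: measurableI => //; exact: measurable_eball.
  set q := m2 (S `&` eball x0 _); set m := m1 (S `&` eball x0 _) => qf q0 qm E.
  rewrite -(lee_pmul2l qf q0) muleCA [leRHS]muleA E [m * _]muleC -muleA.
  by rewrite lee_wpmul2l.
have ndV : {homo (fun j => S `&` V j) : i j / (i <= j)%N >-> (i <= j)%O}.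
  move=> i j ij; apply/subsetPset => x [Sx Vx]; split => // y xy; apply: Vx.
  by apply: lt_le_trans xy _; rewrite lef_pV2 ?posrE// ler_nat ltnS.
have UV : \bigcup_j (S `&` V j) = S `&` U.
  apply/seteqP; split => [x [j _ [Sx Vx]]|x [Sx Ux]].
    by split => //; apply: Vx; rewrite /eball/= subrr enorm0 invr_gt0.
  have [r r0 xrU] := open_eballP oU Ux.
  have [m mP] : exists m : nat, (m.+1%:R^-1 < r)%R.
    have := @near_infty_natSinv_lt R (PosNum r0).
    by case=> m _ /(_ m (leqnn _)) /= h; exists m.
  by exists m => //; split => // y xy; apply: xrU; exact: lt_trans mP.
have := @nondecreasing_cvg_mu _ _ _ m1 (fun j => S `&` V j)
  (fun j => measurableI _ _ mS (mV j)).
rewrite UV => /(_ (measurableI _ _ mS mU) ndV) cm.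
have m2f : m2 S \is a fin_num by rewrite ge0_fin_numE ?measure_ge0.
have := cvgeZl m2f cm; move=> /cvg_lim <- //.
apply: lime_le; first by apply: cvgP; exact: cvgeZl m2f cm.
by apply: nearW => j; exact: key.
Qed.

(** On the sphere, finite measures invariant under reflections are proportional:
all balls of a given radius centred on the sphere have the same measure, so that
the ratio of the measures of small balls is that of the total masses; this
passes to open sets, hence to all Borel sets. *)
Theorem sphere_measure_unique
    (m1 m2 : {sigma_finite_measure set 'rV[R]_n -> \bar R}) (A : set 'rV[R]_n) :
  refl_invariant m1 -> refl_invariant m2 -> m1 S < +oo -> m2 S < +oo -> measurable A ->
  m2 S * m1 (S `&` A) = m1 S * m2 (S `&` A).
Proof.
move=> P1 P2 F1 F2 mA; have mS := measurable_sphere.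
have f1 : m1 S \is a fin_num by rewrite ge0_fin_numE ?measure_ge0.
have f2 : m2 S \is a fin_num by rewrite ge0_fin_numE ?measure_ge0.
have p1 : (0 <= fine (m1 S))%R by rewrite fine_ge0// measure_ge0.
have p2 : (0 <= fine (m2 S))%R by rewrite fine_ge0// measure_ge0.
pose n1 : {measure set 'rV[R]_n -> \bar R} := mscale (NngNum p2) (mrestr m1 mS).
pose n2 : {measure set 'rV[R]_n -> \bar R} := mscale (NngNum p1) (mrestr m2 mS).
have n1E B : n1 B = m2 S * m1 (S `&` B).
  by rewrite /n1/= /mscale/= fineK// /mrestr setIC.
have n2E B : n2 B = m1 S * m2 (S `&` B).
  by rewrite /n2/= /mscale/= fineK// /mrestr setIC.
rewrite -n1E -n2E.
apply: (@measure_unique _ R _ (@open 'rV[R]_n) (fun=> setT) _ _ _ _ n1 n2) => //.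
- by move=> B C; exact: openI.
- by move=> i; exact: openT.
- by rewrite bigcup_const.
- by move=> B oB; rewrite n1E n2E; apply/eqP; rewrite eq_le !sphere_open_le.
- by move=> _; rewrite n1E setIT lte_mul_pinfty.
Qed.

End sphere_uniqueness.
(** * The Hausdorff measure of the sphere *)

Section hausdorff_isometry.
Local Open Scope ereal_scope.
Context {R : realType} {n : nat} (m : nat).
Implicit Types U : set 'rV[R]_n.

Lemma lee_expe (x y : \bar R) k : 0 <= x -> x <= y -> x ^+ k <= y ^+ k.
Proof.
move=> x0 xy; elim: k => // k IH; rewrite !expeS.
by apply: lee_pmul => //; exact: expe_ge0.
Qed.

Lemma ediam_ge0 U x : U x -> 0 <= ediam U.
Proof.
move=> Ux; apply: (@le_trans _ _ (enorm (x - x))%:E); first by rewrite lee_fin enorm_ge0.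
by apply: ereal_sup_ubound; exists (x, x).
Qed.

Variable f : 'rV[R]_n -> 'rV[R]_n.
Hypothesis fP : forall x y, enorm (f x - f y) = enorm (x - y).

Lemma ediam_preimage U : ediam (f @^-1` U) <= ediam U.
Proof.
apply: ge_ereal_sup => _ [[x y] [Ux Uy] <-] /=.
by apply: ereal_sup_ubound; exists (f x, f y) => //=; rewrite fP.
Qed.

(** Only an inequality: f need not be onto, so that the preimage may have a smaller
diameter. For a reflection, which is an involution, equality follows by applying
it twice. *)
Lemma hausdorff_gauge_preimage U :
  hausdorff_gauge m (f @^-1` U) <= hausdorff_gauge m U.
Proof.
have [fU0|/set0P[x fUx]] := eqVneq (f @^-1` U) set0.
  by rewrite fU0 {1}/hausdorff_gauge eqxx; exact: hausdorff_gauge_ge0.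
rewrite /hausdorff_gauge !ifF; last 2 first.
- by apply/negbTE/set0P; exists (f x).
- by apply/negbTE/set0P; exists x.
rewrite lee_wpmul2l// lee_expe//.
  by rewrite mule_ge0//; exact: ediam_ge0 fUx.
by rewrite lee_wpmul2r//; exact: ediam_preimage.
Qed.

Lemma hausdorff_preimage_le U : hausdorff m (f @^-1` U) <= hausdorff m U.
Proof.
apply: ge_ereal_sup => _ [d /= d0 <-].
apply: (@le_trans _ _ (hausdorff_content m d U)); last first.
  by apply: ereal_sup_ubound; exists d.
apply: le_ereal_inf_tmp => _ [V [Vd UV] <-].
apply: (@le_trans _ _ (\sum_(i <oo) hausdorff_gauge m (f @^-1` V i))).
  apply: ereal_inf_lbound; exists (fun i => f @^-1` V i) => //; split.
    by move=> i; apply: le_trans (ediam_preimage _) _; exact: Vd.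
  by move=> x /UV [i _ Vi]; exists i.
apply: lee_nneseries => [i _ _|i _]; first exact: hausdorff_gauge_ge0.
exact: hausdorff_gauge_preimage.
Qed.

End hausdorff_isometry.

Lemma hausdorff_refl {R : realType} {n : nat} m :
  refl_invariant (@hausdorff R n m).
Proof.
move=> u A _.
have iso x y : enorm (refl u x - refl u y) = enorm (x - y).
  by rewrite -reflB enorm_refl.
apply/eqP; rewrite eq_le hausdorff_preimage_le//=.
rewrite [leLHS](_ : _ = hausdorff m (refl u @^-1` (refl u @^-1` A))).
  exact: hausdorff_preimage_le.
by congr (hausdorff m _); apply/seteqP; split => x /=; rewrite reflK.
Qed.

Section normalize.
Context {R : realType} {n : nat}.

Definition normalize (h : 'rV[R]_n) := (enorm h)^-1 *: h.

Lemma measurable_normalize : measurable_fun setT normalize.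
Proof.
apply: measurable_scalerV; last exact: measurable_id.
rewrite (_ : (fun _ => _) = (fun h : 'rV[R]_n => enorm h `^ (-1))); last first.
  by apply/funext => h; rewrite powR_inv1// enorm_ge0.
exact: measurableT_comp (measurable_powR _) (@measurable_enorm R n).
Qed.

Lemma normalize_sphere h : h != 0 -> unit_sphere (normalize h).
Proof.
move=> h0; rewrite /unit_sphere/= enormZ normfV ger0_norm ?enorm_ge0//.
by rewrite mulVf// enorm_eq0.
Qed.

Lemma normalize_refl u h : normalize (refl u h) = refl u (normalize h).
Proof. by rewrite /normalize enorm_refl reflZ. Qed.

Lemma normalizeK h : h != 0 -> enorm h *: normalize h = h.
Proof. by move=> h0; rewrite scalerA divff ?scale1r// enorm_eq0. Qed.

Lemma measurable_closed_ball (x : 'rV[R]_n) r : measurable [set y | enorm (y - x) <= r].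
Proof.
have mf : measurable_fun setT (fun y : 'rV[R]_n => enorm (y - x)).
  apply: measurableT_comp (@measurable_enorm R n) _.
  by apply: measurable_addrV => //; exact: measurable_id.
rewrite (_ : [set _ | _] = (fun y : 'rV[R]_n => enorm (y - x)) @^-1` `]-oo, r]).
  by rewrite -[X in measurable X]setTI; exact: mf.
by apply/seteqP; split => z /=; rewrite in_itv.
Qed.

Lemma measurable_neq0 : measurable [set h : 'rV[R]_n | h != 0].
Proof.
have mf := @measurable_enorm R n.
rewrite (_ : [set _ | _] = @enorm R n @^-1` `]0, +oo[).
  by rewrite -[X in measurable X]setTI; exact: mf.
by apply/seteqP; split => z /=; rewrite in_itv/= andbT enorm_gt0.
Qed.

End normalize.

Lemma subX_le (R : realFieldType) (a b : R) k : (0 <= b) -> (b <= a) -> (a <= 2) ->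
  (a ^+ k - b ^+ k <= k%:R * 2 ^+ k * (a - b)).
Proof.
move=> b0 ba a2; have a0 := le_trans b0 ba.
elim: k => [|k IH]; first by rewrite !expr0 subrr !mul0r.
rewrite (_ : _ - _ = a * (a ^+ k - b ^+ k) + (a - b) * b ^+ k); last first.
  by rewrite !exprS; ring.
have ab0 : (0 <= a - b) by rewrite subr_ge0.
apply: (@le_trans _ _ (2 * (k%:R * 2 ^+ k * (a - b)) + (a - b) * 2 ^+ k)).
  apply: lerD.
    apply: ler_pM => //; rewrite subr_ge0; exact: lerXn2r.
  by apply: ler_wpM2l => //; apply: lerXn2r; rewrite ?nnegrE// (le_trans ba).
have p0 : (0 <= (a - b) * 2 ^+ k) by rewrite mulr_ge0// exprn_ge0.
rewrite exprS -[k.+1%:R]natr1; move: p0; set p := (2 ^+ k); set q := k%:R; set c := (a - b) => p0.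
by rewrite (_ : (q + 1) * (2 * p) * c = 2 * (q * p * c) + c * p + c * p) ?lerDl//; ring.
Qed.

Section sphere_hausdorff.
Local Open Scope ereal_scope.
Context {R : realType} (m : nat).
Local Notation n := m.+1.
Local Notation S := (@unit_sphere R n).
Local Notation L := (@lebesgue_rV R n).

Let omega := @lebesgue_rV R m [set x : 'rV[R]_m | (enorm x <= 1)%R].

Let measurable_unit_ball : measurable [set x : 'rV[R]_m | (enorm x <= 1)%R].
Proof.
rewrite (_ : [set _ | _] = [set x : 'rV[R]_m | (enorm (x - 0) <= 1)%R]).
  exact: measurable_closed_ball.
by apply/seteqP; split => x /=; rewrite subr0.
Qed.

Let omega_gt0 : 0 < omega.
Proof.
apply: (@lt_le_trans _ _ (lebesgue_rV (eball (0 : 'rV[R]_m) 1))).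
  exact: lebesgue_eball_gt0.
apply: le_measure; rewrite ?inE//; first exact: measurable_eball.
by move=> x; rewrite /eball/= sub0r enormN => /ltW.
Qed.

Let omega_lty : omega < +oo.
Proof.
apply: (@le_lt_trans _ _ (lebesgue_rV (eball (0 : 'rV[R]_m) 2))); last exact: lebesgue_eball_lty.
apply: le_measure; rewrite ?inE//; first exact: measurable_eball.
by move=> x /= x1; rewrite /eball/= sub0r enormN (le_lt_trans x1)// ltr1n.
Qed.

Let w := fine omega.
Let wE : omega = w%:E. Proof. by rewrite fineK// gt0_fin_numE. Qed.
Let w_gt0 : (0 < w)%R. Proof. by rewrite -lte_fin -wE. Qed.

Definition ball_cone (x : 'rV[R]_n) (d : R) : set 'rV[R]_n :=
  [set h | (enorm h < 1)%R /\ h != 0%R /\ (enorm (normalize h - x) <= d)%R].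

Lemma measurable_ball_cone x d : measurable (ball_cone x d).
Proof.
rewrite (_ : ball_cone x d = eball 0 1 `&` ([set h | h != 0%R] `&`
    normalize @^-1` [set y | (enorm (y - x) <= d)%R])).
  apply: measurableI; first exact: measurable_eball.
  apply: measurableI; first exact: measurable_neq0.
  rewrite -[X in measurable X]setTI.
  by apply: measurable_normalize => //; exact: measurable_closed_ball.
by apply/seteqP; split => h; rewrite /eball/ball_cone/= sub0r enormN.
Qed.

(** By invariance under reflections the centre may be taken on a coordinate
axis, where the cone lies in a box with one side of length 2 and the others of
length 2d. *)
Lemma lebesgue_ball_cone x d : S x -> (0 <= d)%R ->
  L (ball_cone x d) <= (2 * (2 * d) ^+ m)%:E.
Proof.
move=> Sx d0.
pose e : 'rV[R]_n := delta_mx ord0 ord0.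
have e1 : enorm e = 1%R.
  rewrite enormE /dot (bigD1 ord0)//= big1 => [|i i0]; rewrite !mxE ?eqxx ?mulr1 ?addr0 ?sqrtr1//.
  by rewrite (negbTE i0) mul0r.
have xe : refl (x - e) x = e by apply: refl_swap; rewrite e1; exact: Sx.
pose u := (x - e)%R; have {}xe : refl u x = e by exact: xe.
have E h : enorm (normalize (refl u h) - e) = enorm (normalize h - x).
  by rewrite normalize_refl -xe -reflB enorm_refl.
rewrite (_ : ball_cone x d = refl u @^-1` ball_cone e d); last first.
  by apply/seteqP; split => h; rewrite /ball_cone/= E -!enorm_gt0 enorm_refl.
rewrite (lebesgue_refl _).2; last exact: measurable_ball_cone.
pose A (i : 'I_n) : set (measurableTypeR R) :=
  if i == ord0 then `](-1)%R, 1%R[%classic else `[(- d)%R, d]%classic.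
have mA i : measurable (A i) by rewrite /A; case: ifP.
apply: (@le_trans _ _ (L [set h : 'rV[R]_n | forall i, A i (h ord0 i)])).
  apply: le_measure; rewrite ?inE; first exact: measurable_ball_cone.
    exact: measurable_rV_box.
  move=> h [h1 [h0 hd]] i; rewrite /A; case: eqP => [->|/eqP i0]/=.
    by rewrite in_itv/= -ltr_norml; apply: le_lt_trans h1; exact: coord_le_enorm.
  rewrite in_itv/= -ler_norml.
  have := le_trans (coord_le_enorm _ i) hd.
  rewrite !mxE eqxx (negbTE i0) subr0 normrM normfV (ger0_norm (enorm_ge0 _)).
  rewrite mulrC ler_pdivrMr ?enorm_gt0// => /le_trans; apply.
  by rewrite ler_piMr// ltW.
rewrite lebesgue_rV_box// big_ord_recl /A eqxx lebesgue_measure_itv/= lte_fin.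
rewrite (eq_bigr (fun=> (2 * d)%:E)); last first.
  move=> i _; rewrite lebesgue_measure_itv/=.
  have [->|dn0] := eqVneq d 0%R; first by rewrite oppr0 lte_fin ltxx mulr0.
  by rewrite lte_fin gtrN ?lt0r ?dn0// -EFinB opprK mulr2n mulrDl mul1r.
rewrite prodEFin prodr_const card_ord gtrN// -EFinB opprK -EFinM.
by rewrite (_ : 1 + 1 = 2)%R.
Qed.

Lemma lebesgue_annulus_gt0 : 0 < L (eball 0 1 `\` eball 0 2^-1).
Proof.
have mB r : measurable (eball (0 : 'rV[R]_n) r) by exact: measurable_eball.
rewrite lt0e measure_ge0 andbT; apply/eqP => A0.
have sub : eball (0 : 'rV[R]_n) 2^-1 `<=` eball 0 1.
  by move=> x /lt_trans; apply; rewrite invf_lt1 ?ltr1n.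
have : L (eball 0 1 `\` eball 0 2^-1) = L (eball 0 1) - L (eball 0 1 `&` eball 0 2^-1).
  by apply: measureD => //; exact: lebesgue_eball_lty.
rewrite A0 setIidr// (@lebesgue_eball _ _ 2^-1%R)// ?invr_ge0//.
have L1 := @lebesgue_eball_gt0 R n _ ltr01.
have L1f : L (eball 0 1) = (fine (L (eball 0 1)))%:E.
  by rewrite fineK// gt0_fin_numE// lebesgue_eball_lty.
move: L1; rewrite L1f lte_fin; set l := fine _ => l0.
rewrite -EFinM -EFinB => -[/esym/eqP]; apply/negP.
rewrite gt_eqF// subr_gt0 gtr_pMl// exprn_ilt1// ?invr_ge0//.
by rewrite invf_lt1 ?ltr1n.
Qed.

(** A set of diameter d that meets the sphere covers at most a cone over a ball
of radius d, whose volume is at most a multiple of d ^ m: hence the gauges of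
the members of any cover of the sphere add up to at least a multiple of the
volume of an annulus. *)
Lemma hausdorff_sphere_gt0 : 0 < hausdorff m S.
Proof.
(* 2 (2 d)^m bounds the cone, w (d / 2)^m is the gauge. *)
pose C : R := (2 * 4 ^+ m / w)%R.
have C0 : (0 < C)%R by rewrite divr_gt0// mulr_gt0// exprn_gt0.
suff H d : (0 < d)%R -> C^-1%:E * L (eball 0 1 `\` eball 0 2^-1) <= hausdorff_content m d S.
  apply: (@lt_le_trans _ _ (C^-1%:E * L (eball 0 1 `\` eball 0 2^-1))).
    by rewrite mule_gt0 ?lte_fin ?invr_gt0// lebesgue_annulus_gt0.
  apply: le_trans (H 1%R ltr01) _.
  by apply: ereal_sup_ubound; exists 1%R => //=.
move=> d0; apply: le_ereal_inf_tmp => _ [U [Ud SU] <-]; rewrite lee_pdivrMl//.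
pose X i := xget 0%R (U i `&` S).
pose W i := if `[< U i `&` S !=set0 >] then ball_cone (X i) (fine (ediam (U i))) else set0.
have mW i : measurable (W i).
  by rewrite /W; case: ifP => // _; exact: measurable_ball_cone.
have Uf i x : U i x -> ediam (U i) \is a fin_num.
  move=> Ux; rewrite ge0_fin_numE; last exact: ediam_ge0 Ux.
  by apply: le_lt_trans (Ud i) _; exact: ltry.
apply: (@le_trans _ _ (\sum_(i <oo) L (W i))).
  apply: measure_sigma_subadditive => //.
    by apply: measurableD; exact: measurable_eball.
  move=> h [] /=; rewrite /eball/= sub0r enormN => h1 /negP; rewrite -leNgt => h2.
  have h0 : h != 0%R by rewrite -enorm_gt0 (lt_le_trans _ h2)// invr_gt0.
  have [i _ Ui] := SU _ (normalize_sphere h0).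
  exists i => //; rewrite /W ifT; last first.
    by apply/asboolP; exists (normalize h); split => //; exact: normalize_sphere.
  split => //; split => //; rewrite -lee_fin fineK; last exact: Uf Ui.
  apply: ereal_sup_ubound; exists (normalize h, X i) => //=; split => //=.
  have [] // : (U i `&` S) (X i).
  by apply: (@xgetPex _ 0%R (U i `&` S)); exists (normalize h); split => //; exact: normalize_sphere.
rewrite -nneseriesZl//; last by move=> i _; exact: hausdorff_gauge_ge0.
apply: lee_nneseries => [i _ _|i _]; first exact: measure_ge0.
rewrite /W; case: asboolP => [US|_]; last first.
  by rewrite measure0 mule_ge0 ?lee_fin ?(ltW C0)//; exact: hausdorff_gauge_ge0.
have [UX SX] : (U i `&` S) (X i) by exact: xgetPex.
have eE := fineK (Uf _ _ UX).
have e0 : (0 <= fine (ediam (U i)))%R by rewrite fine_ge0//; exact: ediam_ge0 UX.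
apply: le_trans (lebesgue_ball_cone SX e0) _.
rewrite /hausdorff_gauge ifF; last by apply/negbTE/set0P; exists (X i).
rewrite -/omega wE -{2}eE -EFinM -EFin_expe -!EFinM lee_fin.
rewrite /C mulrA divfK ?gt_eqF// -mulrA -exprMn ler_pM2l//.
by rewrite (_ : (4 * _ = 2 * fine (ediam (U i)))%R)//; field.
Qed.

(** A half-open cube of side 1/M; reading the index off with the floor function makes
the cells disjoint and exhaustive by construction. *)
Definition grid_cell (M : nat) (z : 'rV[int]_n) : set 'rV[R]_n :=
  [set v | forall i, Num.floor (M%:R * v ord0 i) = z ord0 i].

Lemma grid_cellE M z : (0 < M)%N -> grid_cell M z = [set v : 'rV[R]_n |
  forall i, (`[((z ord0 i)%:~R / M%:R)%R, ((z ord0 i + 1)%:~R / M%:R)%R[%classic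
    : set (measurableTypeR R)) (v ord0 i)].
Proof.
move=> M0; have M0' : (0 < M%:R :> R)%R by rewrite ltr0n.
apply/seteqP; split => v /= h i.
  rewrite in_itv/= ler_pdivrMr// ltr_pdivlMr// mulrC -(h i).
  exact: floor_itv.
have := h i; rewrite in_itv/= ler_pdivrMr// ltr_pdivlMr// mulrC => ?.
exact: floor_def.
Qed.

Lemma measurable_grid_cell M z : (0 < M)%N -> measurable (grid_cell M z).
Proof.
move=> M0; rewrite grid_cellE//; apply: (@measurable_rV_box R n (fun i =>
  `[((z ord0 i)%:~R / M%:R)%R, ((z ord0 i + 1)%:~R / M%:R)%R[%classic)) => i.
exact: measurable_itv.
Qed.

Lemma lebesgue_grid_cell M z : (0 < M)%N -> L (grid_cell M z) = (M%:R^-1 ^+ n)%:E.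
Proof.
move=> M0; have M0' : (0 < M%:R :> R)%R by rewrite ltr0n.
rewrite grid_cellE//.
rewrite (@lebesgue_rV_box R n (fun i =>
  `[((z ord0 i)%:~R / M%:R)%R, ((z ord0 i + 1)%:~R / M%:R)%R[%classic))//.
rewrite (eq_bigr (fun=> (M%:R^-1)%:E)); last first.
  move=> i _; rewrite lebesgue_measure_itv/= lte_fin ltr_pM2r ?invr_gt0//.
  rewrite ltr_int ltrDl ltr01 -EFinB -mulrBl; congr (_%:E).
  by rewrite -mulrzBr addrAC subrr add0r mul1r.
by rewrite prodEFin prodr_const card_ord.
Qed.

Lemma grid_cell_dist M z v v' : (0 < M)%N -> grid_cell M z v -> grid_cell M z v' ->
  (enorm (v - v')%R <= n%:R / M%:R)%R.
Proof.
move=> M0 vz v'z; have M0' : (0 < M%:R :> R)%R by rewrite ltr0n.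
apply: le_trans (enorm_le_sum _) _.
have -> : (n%:R / M%:R = \sum_(i < n) M%:R^-1 :> R)%R.
  by rewrite sumr_const card_ord -[RHS]mulr_natl.
apply: ler_sum => i _; rewrite !mxE -(ler_pM2l M0') divff ?gt_eqF//.
rewrite -{1}(gtr0_norm M0') -normrM mulrBr.
have := floor_itv (M%:R * v ord0 i)%R; have := floor_itv (M%:R * v' ord0 i)%R.
rewrite vz v'z intrD; set a := (M%:R * _)%R; set b := (M%:R * _)%R; set c := (_%:~R)%R.
by move=> /andP[? ?] /andP[? ?]; rewrite ler_norml; apply/andP; split; lra.
Qed.

(** The cells of a grid of mesh 1/M that meet the sphere lie in a shell of
thickness of order 1/M, so that there are at most O(M ^ m) of them. *)
Lemma hausdorff_sphere_lty : hausdorff m S < +oo.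
Proof.
pose l := fine (L (eball 0 1)).
have lE : L (eball 0 1) = l%:E.
  by rewrite fineK// gt0_fin_numE ?lebesgue_eball_lty// lebesgue_eball_gt0.
(* With t = n / M, the shell has volume at most n 2^n (3 t) l, each cell M^-n, and
   the gauge of a cell is at most w (t / 2)^m. The powers of M cancel. *)
pose C : R := (w * n%:R ^+ n * (n%:R * 2 * 3) * l)%R.
suff H d : (0 < d)%R -> hausdorff_content m d S <= C%:E.
  by apply: (@le_lt_trans _ _ C%:E); [apply: ge_ereal_sup => _ [d d0 <-]; exact: H|exact: ltry].
move=> d0.
have [M M0 Md] : exists2 M : nat, (0 < M)%N & (n%:R / M%:R <= Num.min d 2^-1 :> R)%R.
  have d'0 : (0 < Num.min d 2^-1)%R by rewrite lt_min d0 invr_gt0 ltr0n.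
  pose M := (Num.truncn (n%:R / Num.min d 2^-1)%R).+1.
  exists M => //; rewrite ler_pdivrMr ?ltr0n// mulrC -ler_pdivrMr// ltW//.
  exact: truncnS_gt.
move: Md; rewrite le_min => /andP[Md M2].
have M0' : (0 < M%:R :> R)%R by rewrite ltr0n.
set t := (n%:R / M%:R)%R in Md M2.
have t0 : (0 <= t)%R by rewrite divr_ge0.
pose U (j : nat) := if @pickle_inv 'rV[int]_n j is Some z then S `&` grid_cell M z else set0.
(* Only the cells that meet the sphere, so that they lie in the shell. *)
pose P (j : nat) := if @pickle_inv 'rV[int]_n j is Some z then
  (if `[< U j !=set0 >] then grid_cell M z else set0) else set0.
have mP j : measurable (P j).
  by rewrite /P; case: pickle_inv => // z; case: ifP => // _; exact: measurable_grid_cell.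
have PE j v : P j v -> exists2 z, pickle z = j & grid_cell M z v.
  rewrite /P; have := @pickle_invK 'rV[int]_n j.
  case: pickle_inv => [z /= zj|_]; last by case.
  by case: asboolP => [_ vz|_]; [exists z|case].
have tP : trivIset setT P.
  apply/trivIsetP => i j _ _ ij; rewrite -subset0 => v [/PE[zi iE vi] /PE[zj jE vj]].
  move/negP : ij; apply; rewrite -jE -iE; apply/eqP; congr pickle.
  by apply/rowP => k; rewrite -vi -vj.
have SU : S `<=` \bigcup_i U i.
  move=> v Sv; pose z : 'rV[int]_n := \row_i Num.floor (M%:R * v ord0 i)%R.
  exists (pickle z) => //; rewrite /U pickleK_inv; split => // i.
  by rewrite mxE.
have Ut j : ediam (U j) <= t%:E.
  apply: ge_ereal_sup => _ [[x y] [/= Ux Uy] <-]; move: Ux Uy; rewrite /U.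
  case: pickle_inv => // z [_ xz] [_ yz].
  by rewrite lee_fin; exact: grid_cell_dist xz yz.
apply: (@le_trans _ _ (\sum_(i <oo) hausdorff_gauge m (U i))).
  apply: ereal_inf_lbound; exists U => //; split => // i.
  by apply: le_trans (Ut i) _; rewrite lee_fin.
pose K : R := (w * (t / 2) ^+ m * M%:R ^+ n)%R.
have K0 : (0 <= K)%R by rewrite /K !mulr_ge0 ?exprn_ge0 ?divr_ge0// ltW.
apply: (@le_trans _ _ (\sum_(i <oo) K%:E * L (P i))).
  apply: lee_nneseries => [i _ _|i _]; first exact: hausdorff_gauge_ge0.
  have [Ui0|/set0P Ui0] := eqVneq (U i) set0.
    by rewrite Ui0 /hausdorff_gauge eqxx mule_ge0.
  have [x Ux] := Ui0.
  rewrite /hausdorff_gauge ifF; last exact/negbTE/set0P.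
  have -> : L (P i) = (M%:R^-1 ^+ n)%:E.
    rewrite /P; move: Ui0; rewrite {1}/U; case E : pickle_inv => [z|] Ui0; last by case: Ui0.
    rewrite ifT ?lebesgue_grid_cell//; apply/asboolP.
    by rewrite /U E.
  have KE : (K * M%:R^-1 ^+ n = w * (t / 2) ^+ m)%R.
    by rewrite /K exprVn mulfK// expf_neq0// gt_eqF.
  rewrite -[leRHS]EFinM KE [leRHS]EFinM -/omega wE.
  rewrite lee_wpmul2l ?lee_fin ?(ltW w_gt0)// EFin_expe lee_expe//.
    by rewrite mule_ge0//; exact: ediam_ge0 Ux.
  by rewrite EFinM lee_wpmul2r.
rewrite nneseriesZl//.
have -> : \sum_(i <oo) L (P i) = L (\bigcup_i P i).
  apply/cvg_lim => //; apply: (@measure_semi_sigma_additive _ _ _ L) => //.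
  exact: bigcup_measurable.
have -> : C = (K * (n%:R * 2 ^+ n * (3 * t) * l))%R.
  rewrite /C /K /t !expr_div_n (exprS M%:R) (exprS n%:R) (exprS 2).
  have := expf_neq0 m (lt0r_neq0 M0'); have := lt0r_neq0 M0'.
  have : (2 ^+ m != 0 :> R)%R by rewrite expf_neq0.
  set a := (2 ^+ m)%R; set b := (M%:R ^+ m)%R; set c := (n%:R ^+ m)%R.
  set d' := (M%:R)%R; set e := (n%:R)%R => a0 d'0 b0.
  by field; rewrite a0 b0 d'0.
rewrite [(K * _)%:E]EFinM lee_wpmul2l ?lee_fin//.
apply: (@le_trans _ _ (L (eball 0 (1 + 2 * t) `\` eball 0 (1 - t)))).
  apply: le_measure; rewrite ?inE//.
  - exact: bigcup_measurable.
  - by apply: measurableD; exact: measurable_eball.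
  move=> x [j _]; rewrite /P/U; case: pickle_inv => // z; case: asboolP => // -[s [Ss sz]] xz.
  have := grid_cell_dist M0 xz sz; rewrite -/t => xs.
  have s1 : enorm s = 1%R by [].
  have nge0 : (0 < t)%R by rewrite divr_gt0.
  rewrite /eball/= sub0r enormN; split.
    apply: (@le_lt_trans _ _ (enorm (x - s) + enorm s)%R).
      by rewrite -{1}(subrK s x) ler_enormD.
    rewrite s1; lra.
  apply/negP; rewrite -leNgt.
  have : (enorm s <= enorm (s - x) + enorm x)%R by rewrite -{1}(subrK x s) ler_enormD.
  rewrite enormB s1; lra.
have sub : eball (0 : 'rV[R]_n) (1 - t) `<=` eball 0 (1 + 2 * t).
  by move=> x /lt_le_trans; apply; lra.
rewrite [leLHS](_ : _ = L (eball 0 (1 + 2 * t)) - L (eball 0 (1 + 2 * t) `&` eball 0 (1 - t))); last first.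
  by apply: measureD; [exact: measurable_eball|exact: measurable_eball|exact: lebesgue_eball_lty].
have t1 : (0 <= 1 - t)%R by lra.
have t2 : (0 <= 1 + 2 * t)%R by lra.
rewrite setIidr// (lebesgue_eball t1)// (lebesgue_eball t2)//.
rewrite lE -!EFinM -EFinB lee_fin -mulrBl ler_wpM2r//.
  by rewrite -lee_fin -lE.
apply: le_trans (subX_le _ _ _ _) _; [lra|lra|lra|].
by rewrite (_ : (1 + 2 * t - (1 - t) = 3 * t)%R)//; ring.
Qed.

End sphere_hausdorff.
(** * Integration in polar coordinates *)

Lemma indic_iff (R : nzRingType) T T' (A : set T) (B : set T') x y :
  A x <-> B y -> \1_A x = \1_B y :> R.
Proof.
move=> AB; rewrite !indicE; suff -> : (x \in A) = (y \in B) by [].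
by apply/idP/idP; rewrite !inE AB.
Qed.

Section density.
Local Open Scope ereal_scope.
Context d (T : measurableType d) (R : realType) (mu : {measure set T -> \bar R}).
Variable f : T -> R.
Hypotheses (mf : measurable_fun setT f) (f0 : forall x, (0 <= f x)%R).

Definition density of measurable_fun setT f & (forall x, (0 <= f x)%R) :=
  fun A : set T => \int[mu]_(x in A) (f x)%:E.

Let density0 : density mf f0 set0 = 0.
Proof. by rewrite /density integral_set0. Qed.

Let density_ge0 A : 0 <= density mf f0 A.
Proof. by apply: integral_ge0 => x _; rewrite lee_fin. Qed.

Let density_sigma_additive : semi_sigma_additive (density mf f0).
Proof.
apply: semi_sigma_additive_nng_induced => [|x]; last by rewrite lee_fin.
exact/measurable_EFinP.
Qed.

HB.instance Definition _ := isMeasure.Build _ _ _ (density mf f0)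
  density0 density_ge0 density_sigma_additive.

Lemma densityE A : measurable A ->
  density mf f0 A = \int[mu]_x ((f x)%:E * (\1_A x)%:E).
Proof.
by move=> mA; rewrite /density integral_mkcond epatch_indic.
Qed.

Import HBNNSimple.

Lemma ge0_integral_density (g : T -> \bar R) :
  measurable_fun setT g -> (forall x, 0 <= g x) ->
  \int[density mf f0]_x g x = \int[mu]_x ((f x)%:E * g x).
Proof.
move=> mg g0; pose h := nnsfun_approx measurableT mg.
have ch x : (fun n => (h n x)%:E) @ \oo --> g x by exact: cvg_nnsfun_approx.
have ndh x : {homo (fun n => (h n x)%:E) : a b / (a <= b)%N >-> a <= b}.
  by move=> a b ab; rewrite lee_fin; exact/lefP/nd_nnsfun_approx.
have mh n : measurable_fun setT (fun x => (h n x)%:E) by exact/measurable_EFinP.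
transitivity (limn (fun n => \int[density mf f0]_x (h n x)%:E)).
  rewrite -monotone_convergence//; last by move=> n x _; rewrite lee_fin.
  by apply: eq_integral => x _; apply/esym/cvg_lim => //; exact: ch.
have mfh n : measurable_fun setT (fun x => (f x)%:E * (h n x)%:E).
  by apply: emeasurable_funM => //; exact/measurable_EFinP.
transitivity (limn (fun n => \int[mu]_x ((f x)%:E * (h n x)%:E))); last first.
  rewrite -monotone_convergence//.
  - apply: eq_integral => x _; apply/cvg_lim => //.
    by apply: cvgeZl => //; exact: ch.
  - by move=> n x _; rewrite mule_ge0// lee_fin.
  - by move=> x _ a b ab; rewrite lee_wpmul2l// ?lee_fin//; exact: ndh.
congr (limn _); apply/funext => n.
rewrite integralT_nnsfun sintegralE.
transitivity (\int[mu]_x \sum_(k \in range (h n)) (k * \1_(h n @^-1` [set k]) x)%:E * (f x)%:E).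
  rewrite ge0_integral_fsum//; last 2 first.
  - move=> k; apply: emeasurable_funM; last exact/measurable_EFinP.
    by apply/measurable_EFinP; apply: measurable_funM.
  - move=> k x _; apply: mule_ge0; last by rewrite lee_fin.
    by rewrite EFinM; exact: nnfun_muleindic_ge0.
  apply: eq_fsbigr => k; rewrite inE => -[y _ <-].
  rewrite [X in _ * X](_ : _ = \int[mu]_x ((f x)%:E * (\1_(h n @^-1` [set h n y]) x)%:E)); last exact: densityE.
  rewrite -ge0_integralZl//.
  - by apply: eq_integral => x _; rewrite EFinM -muleA [in RHS](muleC _ (f x)%:E).
  - by apply: emeasurable_funM; apply/measurable_EFinP.
  - by move=> x _; rewrite mule_ge0 ?lee_fin.
  - by rewrite lee_fin.
apply: eq_integral => x _.
rewrite -ge0_mule_fsuml; last by move=> k; rewrite nnfun_muleindic_ge0.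
by rewrite fsumEFin// -fimfunE muleC.
Qed.

End density.

Section annuli.
Local Open Scope ereal_scope.
Context {R : realType} (m : nat).
Local Notation n := m.+1.
Local Notation L := (@lebesgue_rV R n).

Lemma integral_lebesgue_scale (r : R) (g : 'rV[R]_n -> \bar R) : (0 < r)%R ->
  measurable_fun setT g -> (forall x, 0 <= g x) ->
  \int[L]_x g x = (r ^+ n)%:E * \int[L]_x g (r *: x).
Proof.
move=> r0 mg g0.
have ms : measurable_fun setT ( *:%R r : 'rV[R]_n -> 'rV[R]_n).
  by apply: measurable_scalerV => //; exact: measurable_id.
have rn0 : (0 <= r ^- n)%R by rewrite invr_ge0 exprn_ge0// ltW.
rewrite -(@integral_image_measure _ _ _ _ R L (mscale (NngNum rn0) L) _ g ms)//; last first.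
  by move=> A mA; exact/esym/lebesgue_scale.
rewrite ge0_integral_mscale//= muleA -EFinM mulfV ?mul1e//.
by rewrite expf_neq0// gt_eqF.
Qed.

Definition annulus (r : R) : set 'rV[R]_n := eball 0 r `\` eball 0 (r / 2).

Lemma measurable_annulus r : measurable (annulus r).
Proof. by apply: measurableD; exact: measurable_eball. Qed.

Lemma annulusE r h : annulus r h <-> (r / 2 <= enorm h < r)%R.
Proof.
rewrite /annulus/= /eball/= sub0r enormN; split.
  by move=> [-> /negP]; rewrite -leNgt => ->.
by move=> /andP[h1 h2]; split => //; apply/negP; rewrite -leNgt.
Qed.

(** With the Lebesgue measure this is, up to the area of the sphere, the density
rho ^ (a - 1) in the radius rho. *)
Definition radial (a : R) (h : 'rV[R]_n) : R := enorm h `^ (a - n%:R).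

Lemma measurable_radial a : measurable_fun setT (radial a).
Proof. exact: measurableT_comp (measurable_powR _) (@measurable_enorm R n). Qed.

Lemma radial_ge0 a h : (0 <= radial a h)%R.
Proof. exact: powR_ge0. Qed.

Lemma measurable_radialE a (D : set 'rV[R]_n) : measurable_fun D (fun h => (radial a h)%:E).
Proof.
by apply/measurable_funTS; apply/measurable_EFinP; exact: measurable_radial.
Qed.

Lemma integral_annulus_scale a r : (0 < r)%R ->
  \int[L]_(h in annulus r) (radial a h)%:E =
  (r `^ a)%:E * \int[L]_(h in annulus 1) (radial a h)%:E.
Proof.
move=> r0; have mA := measurable_annulus.
have mI r' : measurable_fun setT (fun h => (radial a h)%:E * (\1_(annulus r') h : R)%:E).
  by apply: emeasurable_funM; [exact: measurable_radialE|exact/measurable_EFinP].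
rewrite integral_mkcond [in RHS]integral_mkcond !epatch_indic.
rewrite (integral_lebesgue_scale r0); last 2 first.
- exact: mI.
- by move=> x; rewrite mule_ge0 ?lee_fin ?radial_ge0.
transitivity ((r ^+ n)%:E * \int[L]_h ((r `^ (a - n%:R))%:E *
    ((radial a h)%:E * (\1_(annulus 1) h : R)%:E))).
  congr (_ * _); apply: eq_integral => h _.
  have -> : radial a (r *: h) = (r `^ (a - n%:R) * radial a h)%R.
    by rewrite /radial enormZ gtr0_norm// powRM// ?enorm_ge0// ltW.
  rewrite EFinM -muleA; do 2 congr (_ * _).
  congr EFin; apply: indic_iff; rewrite !annulusE enormZ gtr0_norm// div1r.
  by rewrite ler_pM2l// gtr_pMr.
rewrite ge0_integralZl//; last 2 first.
- by move=> h _; rewrite mule_ge0 ?lee_fin ?radial_ge0.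
- by rewrite lee_fin powR_ge0.
rewrite muleA -EFinM; congr (_%:E * _).
rewrite -powR_mulrn ?(ltW r0)// -powRD; first by rewrite addrC subrK.
by apply/implyP => _; rewrite gt_eqF.
Qed.

Definition annulus_mass a := \int[L]_(h in annulus 1) (radial a h)%:E.

Lemma annulus_radial_bounds a h : (0 <= a)%R -> annulus 1 h ->
  (2^-1 `^ a * radial 0 h <= radial a h <= radial 0 h)%R.
Proof.
move=> a0 /annulusE; rewrite div1r => /andP[h1 h2].
have h0 : (0 < enorm h)%R by apply: lt_le_trans h1; rewrite invr_gt0.
have E : (enorm h `^ (a - n%:R) = enorm h `^ a * enorm h `^ (- n%:R))%R.
  by rewrite powRD//; apply/implyP => _; rewrite gt_eqF.
rewrite /radial sub0r E; apply/andP; split.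
  by rewrite ler_wpM2r ?powR_ge0// ge0_ler_powR// nnegrE ?invr_ge0// ltW.
have P1 : (1 `^ a = 1 :> R)%R by rewrite powR1.
rewrite ler_piMl ?powR_ge0// -[leRHS]P1.
by rewrite ge0_ler_powR// ?nnegrE ltW.
Qed.

Lemma annulus_radial0 h : annulus 1 h -> (1 <= radial 0 h <= 2 ^+ n)%R.
Proof.
move=> /annulusE; rewrite div1r => /andP[h1 h2].
have h0 : (0 < enorm h)%R by apply: lt_le_trans h1; rewrite invr_gt0.
rewrite /radial sub0r powRN powR_mulrn ?(ltW h0)//; apply/andP; split.
  by rewrite invf_ge1 ?exprn_gt0// exprn_ile1// ltW.
rewrite -[leRHS]invrK lef_pV2 ?posrE ?exprn_gt0// ?invr_gt0 ?exprn_gt0//.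
by rewrite -exprVn; apply: lerXn2r => //; rewrite nnegrE ?invr_ge0// ltW.
Qed.

Lemma annulus_mass0 : 0 < annulus_mass 0 < +oo.
Proof.
have mA := measurable_annulus 1; apply/andP; split.
  apply: (@lt_le_trans _ _ (L (annulus 1))).
    by rewrite /annulus div1r; exact: lebesgue_annulus_gt0.
  rewrite -[leLHS]mul1e -integral_cst//; apply: ge0_le_integral => //.
  - exact: measurable_radialE.
  - by move=> h /annulus_radial0/andP[]; rewrite lee_fin.
apply: (@le_lt_trans _ _ ((2 ^+ n)%:E * L (annulus 1))).
  rewrite -integral_cst//; apply: ge0_le_integral => //.
  - by move=> h _; rewrite lee_fin radial_ge0.
  - exact: measurable_radialE.
  - by move=> h /annulus_radial0/andP[]; rewrite lee_fin.
rewrite lte_mul_pinfty ?lee_fin ?exprn_ge0//.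
apply: (@le_lt_trans _ _ (L (eball 0 1))); last exact: lebesgue_eball_lty.
by apply: le_measure; rewrite ?inE//; [exact: measurable_eball|exact: subDsetl].
Qed.

(** The mass of the annulus is continuous at a = 0, where it is positive. *)
Lemma annulus_mass_bounds a : (0 <= a)%R ->
  (2^-1 `^ a)%:E * annulus_mass 0 <= annulus_mass a <= annulus_mass 0.
Proof.
move=> a0; have mA := measurable_annulus 1; apply/andP; split.
  rewrite -ge0_integralZl//; last 2 first.
  - exact: measurable_radialE.
  - by move=> h _; rewrite lee_fin radial_ge0.
  apply: ge0_le_integral => //.
  - by move=> h _; rewrite -EFinM lee_fin mulr_ge0 ?powR_ge0.
  - by apply: measurable_funeM; exact: measurable_radialE.
  - exact: measurable_radialE.
  - by move=> h /(annulus_radial_bounds a0)/andP[]; rewrite -EFinM lee_fin.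
apply: ge0_le_integral => //.
- by move=> h _; rewrite lee_fin radial_ge0.
- exact: measurable_radialE.
- exact: measurable_radialE.
- by move=> h /(annulus_radial_bounds a0)/andP[]; rewrite lee_fin.
Qed.

Definition punctured_ball (r : R) : set 'rV[R]_n := eball 0 r `&` [set h | h != 0%R].

Lemma measurable_punctured_ball r : measurable (punctured_ball r).
Proof. by apply: measurableI; [exact: measurable_eball|exact: measurable_neq0]. Qed.

Lemma punctured_ballE (r : R) : (0 < r)%R ->
  punctured_ball r = \bigcup_j annulus (r * 2^-1 ^+ j).
Proof.
move=> r0; apply/seteqP; split => [h []|h [j _ /annulusE/andP[h1 h2]]]; last first.
  have rj0 : (0 < r * 2^-1 ^+ j)%R by rewrite mulr_gt0// exprn_gt0// invr_gt0.
  rewrite /punctured_ball/= /eball/= sub0r enormN; split.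
    by apply: lt_le_trans h2 _; rewrite ler_piMr ?(ltW r0)// exprn_ile1// invf_le1 ?ler1n.
  by rewrite -enorm_gt0; apply: lt_le_trans h1; rewrite divr_gt0.
rewrite /eball/= sub0r enormN => hr h0.
have hr0 : (0 < enorm h / r)%R by rewrite divr_gt0// enorm_gt0.
have ex : exists j, (r * 2^-1 ^+ j.+1 <= enorm h)%R.
  have [j jr] : exists j : nat, (j.+1%:R^-1 < enorm h / r)%R.
    have := @near_infty_natSinv_lt R (PosNum hr0).
    by case=> j _ /(_ j (leqnn _)) /= hj; exists j.
  exists j; rewrite mulrC -ler_pdivlMr// ltW//; apply: le_lt_trans jr.
  rewrite exprVn lef_pV2 ?posrE ?exprn_gt0// -natrX ler_nat.
  exact: ltnW (ltn_expl _ _).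
have [j jP jmin] := ex_minnP ex; exists j => //; apply/annulusE.
rewrite -mulrA -exprSr jP/=.
case: j jP jmin => [|j] jP jmin; first by rewrite expr0 mulr1.
by rewrite ltNge; apply/negP => /jmin; rewrite ltnn.
Qed.

Lemma trivIset_annulus (r : R) : (0 < r)%R ->
  trivIset setT (fun j => annulus (r * 2^-1 ^+ j)).
Proof.
move=> r0; apply/trivIsetP => i j _ _.
wlog ij : i j / (i < j)%N.
  move=> H; rewrite neq_ltn => /orP[ij|ji]; first by apply: H; rewrite ?ltn_eqF.
  by rewrite setIC; apply: H; rewrite ?ltn_eqF.
move=> _; rewrite -subset0 => h [/annulusE/andP[h1 _] /annulusE/andP[_ h2]].
have := le_lt_trans h1 h2; rewrite -mulrA -exprSr ltr_pM2l// ltNge; apply/negP/negPn.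
by rewrite ler_wiXn2l ?invr_ge0// invf_le1 ?ler1n.
Qed.

(** Summing over dyadic annuli, whose masses form a geometric progression. *)
Lemma integral_radial (a r : R) : (0 < a)%R -> (0 < r)%R ->
  \int[L]_(h in punctured_ball r) (radial a h)%:E =
  (r `^ a * fine (annulus_mass a) / (1 - 2^-1 `^ a))%:E.
Proof.
move=> a0 r0; pose z : R := (2^-1 `^ a)%R.
have z0 : (0 < z)%R by rewrite powR_gt0// invr_gt0.
have z1 : (z < 1)%R.
  have P1 : (1 `^ a = 1 :> R)%R by rewrite powR1.
  by rewrite -[ltRHS]P1; apply: gt0_ltr_powR => //; rewrite ?nnegrE ?invr_ge0// invf_lt1 ?ltr1n.
have Mf : annulus_mass a = (fine (annulus_mass a))%:E.
  rewrite fineK// ge0_fin_numE.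
    have /andP[_ h] := annulus_mass_bounds (ltW a0).
    by apply: le_lt_trans h _; have /andP[] := annulus_mass0.
  by apply: integral_ge0 => h _; rewrite lee_fin radial_ge0.
rewrite punctured_ballE// ge0_integral_bigcup//; last 4 first.
- by move=> j; exact: measurable_annulus.
- exact: measurable_radialE.
- by move=> h _; rewrite lee_fin radial_ge0.
- exact: trivIset_annulus.
set M := fine _.
rewrite (eq_eseriesr (g := fun j => (geometric (r `^ a * M) z j)%:E)); last first.
  move=> j _; have rj0 : (0 < r * 2^-1 ^+ j)%R by rewrite mulr_gt0// exprn_gt0// invr_gt0.
  rewrite integral_annulus_scale// -/(annulus_mass a) Mf -EFinM; congr (_%:E).
  rewrite powRM ?(ltW r0) ?exprn_ge0 ?invr_ge0// -powR_mulrn ?invr_ge0// powRAC.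
  by rewrite powR_mulrn ?powR_ge0//= mulrAC.
apply/cvg_lim => //.
rewrite (_ : (fun _ => _) = EFin \o series (geometric (r `^ a * M) z)); last first.
  by apply/funext => k /=; rewrite sumEFin.
apply: cvg_EFin; first exact: nearW.
by apply: cvg_geometric_series; rewrite gtr0_norm.
Qed.

End annuli.

Section slot_weight.
Context {R : realType} {n : nat}.

(** The kernel of one edge in the functional, cut off at radius r. *)
Definition slot_weight (p theta r : R) (h : 'rV[R]_n) : R :=
  ((1 - theta) * enorm h `^ (- (n%:R + theta * p)) * \1_(eball 0 r) h)%R.

Lemma measurable_slot_weight p theta r : measurable_fun setT (slot_weight p theta r).
Proof.
apply: measurable_funM; last by apply: measurable_indic; exact: measurable_eball.
apply: measurable_funM => //.
exact: measurableT_comp (measurable_powR _) (@measurable_enorm R n).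
Qed.

Lemma slot_weight_ge0 p theta r h : (theta < 1)%R -> (0 <= slot_weight p theta r h)%R.
Proof. by move=> t1; rewrite !mulr_ge0 ?powR_ge0// subr_ge0 ltW. Qed.

End slot_weight.

Section polar.
Local Open Scope ereal_scope.
Context {R : realType} (m : nat).
Local Notation n := m.+1.
Local Notation S := (@unit_sphere R n).
Local Notation L := (@lebesgue_rV R n).
Local Notation H := (@hausdorff R n m).

Definition sphere_area : R := fine (H S).

Lemma sphere_areaE : H S = sphere_area%:E.
Proof. by rewrite fineK// gt0_fin_numE ?hausdorff_sphere_lty// hausdorff_sphere_gt0. Qed.

Lemma sphere_area_gt0 : (0 < sphere_area)%R.
Proof. by rewrite -lte_fin -sphere_areaE hausdorff_sphere_gt0. Qed.

Lemma finite_sigma_finite d (T : measurableType d) (mu : {measure set T -> \bar R}) :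
  mu setT < +oo -> sigma_finite setT mu.
Proof. by move=> muoo; exists (fun=> setT) => //; rewrite bigcup_const. Qed.

Definition polar_const (a r : R) : R :=
  (r `^ a * fine (annulus_mass m a) / (1 - 2^-1 `^ a) / sphere_area)%R.

(** The image on the sphere of a radial measure is invariant under reflections,
so that it is a multiple of the Hausdorff measure, the factor being found from
the total masses. *)
Lemma integral_polar a r (g : 'rV[R]_n -> \bar R) : (0 < a)%R -> (0 < r)%R ->
  measurable_fun setT g -> (forall v, 0 <= g v) ->
  \int[L]_h ((radial a h * \1_(punctured_ball r) h)%:E * g (normalize h)) =
  (polar_const a r)%:E * \int[H]_(v in S) g v.
Proof.
move=> a0 r0 mg g0; have mS := @measurable_sphere R n.
have mB := @measurable_punctured_ball R m r.
pose f (h : 'rV[R]_n) : R := (radial a h * \1_(punctured_ball r) h)%R.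
have mf : measurable_fun setT f.
  by apply: measurable_funM; [exact: measurable_radial|exact: measurable_indic].
have f0 h : (0 <= f h)%R by rewrite mulr_ge0 ?radial_ge0.
have mN := @measurable_normalize R n.
pose D : {measure set 'rV[R]_n -> \bar R} := density L mf f0.
pose tau : {measure set 'rV[R]_n -> \bar R} :=
  measure_function_pushforward__canonical__measure_function_Measure D mN.
pose q := (r `^ a * fine (annulus_mass m a) / (1 - 2^-1 `^ a))%R.
have mI (A : set 'rV[R]_n) : measurable A ->
    measurable_fun setT (fun h => (f h)%:E * (\1_A h : R)%:E).
  by move=> mA; apply: emeasurable_funM; apply/measurable_EFinP.
have mpre (h : 'rV[R]_n -> 'rV[R]_n) A : measurable_fun setT h -> measurable A -> measurable (h @^-1` A).
  by move=> mh mA; rewrite -[X in measurable X]setTI; exact: mh.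
have tauE A : measurable A -> tau A = \int[L]_h ((f h)%:E * (\1_A (normalize h) : R)%:E).
  move=> mA; rewrite -[LHS]/(density L mf f0 (normalize @^-1` A)) densityE//.
  exact: mpre.
have fS h : f h != 0%R -> S (normalize h).
  rewrite /f indicE; case: (boolP (h \in _)) => [|_]; last by rewrite mulr0 eqxx.
  by rewrite inE => -[_ h0] _; exact: normalize_sphere.
have tauS : tau S = q%:E.
  rewrite tauE// -integral_radial//  [RHS]integral_mkcond epatch_indic.
  apply: eq_integral => h _; rewrite -[RHS]/(_%:E) -[RHS]/((f h)%:E).
  have [->|/fS fh] := eqVneq (f h) 0%R; first by rewrite mul0e.
  by rewrite indicE mem_set// mule1.
have tauT : tau setT = tau S.
  rewrite !tauE//; apply: eq_integral => h _.
  have [->|/fS fh] := eqVneq (f h) 0%R; first by rewrite !mul0e.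
  by rewrite !indicE !mem_set.
pose nu : {measure set 'rV[R]_n -> \bar R} := mrestr H mS.
have nuE A : nu A = H (A `&` S) by [].
have sft : sigma_finite setT tau by apply: finite_sigma_finite; rewrite tauT tauS ltry.
have sfn : sigma_finite setT nu.
  by apply: finite_sigma_finite; rewrite nuE setTI sphere_areaE ltry.
have tP : refl_invariant tau.
  move=> u A mA; rewrite !tauE//; last exact: mpre (measurable_refl u) mA.
  have E := integral_preserving (lebesgue_refl u) (mI _ (mpre _ _ mN mA)).
  rewrite -[RHS]E//; last by move=> x; rewrite mule_ge0 ?lee_fin.
  apply: eq_integral => h _; congr (_%:E * _); last first.
    by congr EFin; apply: indic_iff; rewrite /preimage/= normalize_refl.
  rewrite /f /radial enorm_refl; congr (_ * _)%R; apply: indic_iff.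
  by rewrite /punctured_ball/= /eball/= !sub0r !enormN
    -!enorm_gt0 enorm_refl.
have nP : refl_invariant nu.
  move=> u A mA; rewrite !nuE -[in RHS](hausdorff_refl _ u)//; last exact: measurableI.
  congr (H _); apply/seteqP; split => x /=; by rewrite /unit_sphere/= enorm_refl.
have tauH A : measurable A -> A `<=` S -> tau A = (q / sphere_area)%:E * H A.
  move=> mA AS.
  have E : nu S * tau (S `&` A) = tau S * nu (S `&` A).
    apply: (@sphere_measure_unique R n (as_sigma_finite sft) (as_sigma_finite sfn)) => //.
      by rewrite -[X in X < _]/(tau S) tauS ltry.
    by rewrite -[X in X < _]/(nu S) nuE setIid sphere_areaE ltry.
  move: E; rewrite !nuE setIid sphere_areaE tauS (setIidr AS) (setIidl AS) => E.
  rewrite mulrC EFinM -muleA -E muleA -EFinM mulVf ?mul1e//.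
  by rewrite gt_eqF// sphere_area_gt0.
have q0 : (0 <= q)%R.
  by rewrite -lee_fin -tauS.
have qs0 : (0 <= q / sphere_area)%R by rewrite divr_ge0// ltW// sphere_area_gt0.
transitivity (\int[tau]_(v in S) g v); last first.
  rewrite (eq_measure_integral (mscale (NngNum qs0) H)); last first.
    by move=> A mA AS; rewrite tauH.
  by rewrite ge0_integral_mscale//; exact: measurable_funTS.
rewrite [RHS]integral_mkcond [RHS](@integral_image_measure _ _ _ _ R D tau normalize)//; last 2 first.
- by apply/(measurable_restrictT _ _).1 => //; exact: measurable_funTS.
- by move=> v; rewrite erestrict_ge0.
rewrite [RHS]ge0_integral_density//.
- apply: eq_integral => h _.
  have [fh|/fS fh] := eqVneq (f h) 0%R; first by rewrite -/(f h) fh !mul0e.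
  by rewrite patchE mem_set.
- apply: measurableT_comp (@measurable_normalize R n).
  by apply/(measurable_restrictT _ _).1 => //; exact: measurable_funTS.
- by move=> v; rewrite erestrict_ge0.
Qed.

Definition slot_const (p theta : R) : R :=
  ((1 - theta) * polar_const (p * (1 - theta)) 1)%R.

(** Homogeneity of g leaves the radial exponent p (1 - theta), so that the radial
integral has a pole at theta = 1 that the factor 1 - theta cancels. *)
Lemma integral_slot (p theta r : R) (g : 'rV[R]_n -> \bar R) :
  (0 < p)%R -> (0 < theta < 1)%R -> (0 < r)%R ->
  measurable_fun setT g -> (forall v, 0 <= g v) ->
  (forall c v, (0 < c)%R -> g (c *: v) = (c `^ p)%:E * g v) ->
  \int[L]_h ((slot_weight p theta r h)%:E * g h) =
  (slot_const p theta * r `^ (p * (1 - theta)))%:E * \int[H]_(v in S) g v.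
Proof.
move=> p0 /andP[t0 t1] r0 mg g0 gp.
have t10 : (0 < 1 - theta)%R by rewrite subr_gt0.
have a0 : (0 < p * (1 - theta))%R by rewrite mulr_gt0.
have -> : (slot_const p theta * r `^ (p * (1 - theta)) =
    (1 - theta) * polar_const (p * (1 - theta)) r)%R.
  rewrite /slot_const /polar_const -[in RHS]mulrA -!mulrA powR1 mul1r.
  by congr (_ * _)%R; rewrite [RHS]mulrC !mulrA.
rewrite EFinM -muleA -integral_polar// -ge0_integralZl//; last 3 first.
- apply: emeasurable_funM.
    apply/measurable_EFinP; apply: measurable_funM; first exact: measurable_radial.
    by apply: measurable_indic; exact: measurable_punctured_ball.
  exact: measurableT_comp mg (@measurable_normalize R n).
- by move=> h _; rewrite mule_ge0// lee_fin mulr_ge0 ?radial_ge0.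
- by rewrite lee_fin ltW.
apply: eq_integral => h _; rewrite /slot_weight.
have [->|h0] := eqVneq h 0%R.
  rewrite enorm0 powR0 ?mulr0 ?mul0r ?mul0e; last first.
    by rewrite oppr_eq0 gt_eqF// ltr_wpDl// mulr_gt0.
  by rewrite [X in (_ * X)%R]indicE memNset ?mulr0 ?mul0e ?mule0// => -[_ /=]; rewrite eqxx.
have hh : (0 < enorm h)%R by rewrite enorm_gt0.
rewrite -[in LHS](normalizeK h0) [in LHS]gp//.
rewrite !normalizeK// muleA -EFinM muleA -EFinM; congr (_%:E * _).
have -> : \1_(eball 0 r) h = \1_(punctured_ball r) h :> R.
  by apply: indic_iff; split => [hr|[]].
rewrite /radial -mulrA mulrAC -!mulrA; congr (_ * _)%R.
rewrite mulrA; congr (_ * _)%R.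
rewrite -powRD; last by apply/implyP => _; rewrite gt_eqF.
by congr (_ `^ _)%R; ring.
Qed.

Lemma annulus_massE (a : R) : (0 <= a)%R ->
  annulus_mass m a = (fine (annulus_mass m a))%:E.
Proof.
move=> a0; rewrite fineK// ge0_fin_numE.
  have /andP[_ h] := annulus_mass_bounds m a0.
  by apply: le_lt_trans h _; have /andP[] := @annulus_mass0 R m.
by apply: integral_ge0 => h _; rewrite lee_fin radial_ge0.
Qed.

(** The denominator comes from 1 - 2 ^ (- a) being equivalent to a ln 2 as a tends
to 0, with a = p (1 - theta). *)
Definition slot_lim (p : R) : R :=
  (fine (annulus_mass m 0) / (p * ln 2) / sphere_area)%R.

Lemma annulus_mass0_gt0 : (0 < fine (annulus_mass m 0) :> R)%R.
Proof. by apply: fine_gt0; exact: annulus_mass0. Qed.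

Lemma slot_lim_gt0 (p : R) : (0 < p)%R -> (0 < slot_lim p)%R.
Proof.
move=> p0; rewrite !divr_gt0 ?annulus_mass0_gt0 ?sphere_area_gt0//.
by rewrite mulr_gt0// ln_gt0// ltr1n.
Qed.

(** With x = p (1 - theta) ln 2, the denominator 1 - exp (- x) of the geometric series
lies between x / (1 + x) and x, and the mass of the annulus is monotone up to
the factor exp (- x). *)
Lemma slot_const_bounds p theta : (0 < p)%R -> (theta < 1)%R ->
  (slot_lim p * (1 - p * (1 - theta) * ln 2) <= slot_const p theta <=
   slot_lim p * (1 + p * (1 - theta) * ln 2))%R.
Proof.
move=> p0 t1.
have e0 : (0 < 1 - theta)%R by rewrite subr_gt0.
have a0 : (0 < p * (1 - theta))%R by rewrite mulr_gt0.
have l2 : (0 < ln 2 :> R)%R by rewrite ln_gt0// ltr1n.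
rewrite /slot_const /slot_lim /polar_const powR1 mul1r.
have := annulus_mass_bounds m (ltW a0).
rewrite (annulus_massE (ltW a0)) (annulus_massE (lexx _)).
rewrite -EFinM !lee_fin /=; have := annulus_mass0_gt0; have := sphere_area_gt0.
set A := sphere_area; set I0 := fine (annulus_mass m 0); set Ia := fine _.
clearbody A I0 Ia => A0 I00 /andP[zI II].
set x := (p * (1 - theta) * ln 2)%R.
have x0 : (0 < x)%R by rewrite mulr_gt0.
have -> : (2^-1 `^ (p * (1 - theta)) = expR (- x) :> R)%R.
  by rewrite /powR gt_eqF ?invr_gt0// lnV ?posrE// mulrN.
move: zI.
have -> : (2^-1 `^ (p * (1 - theta)) = expR (- x) :> R)%R.
  by rewrite /powR gt_eqF ?invr_gt0// lnV ?posrE// mulrN.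
have zx : (1 - x <= expR (- x))%R by exact: expR_ge1Dx.
have z0 : (0 < expR (- x))%R by exact: expR_gt0.
have xz : (x / (1 + x) <= 1 - expR (- x))%R.
  have x10 : (1 + x != 0)%R by rewrite gt_eqF// ltr_pwDl// ltW.
  have -> : (x / (1 + x) = 1 - (1 + x)^-1)%R by field.
  by rewrite lerD2l lerN2 expRN lef_pV2 ?posrE ?expR_gt0// ?expR_ge1Dx// ltr_pwDl// ltW.
have x1 : (0 < x / (1 + x))%R by rewrite divr_gt0// ltr_pwDl// ltW.
have z1 := lt_le_trans x1 xz.
move=> zI; apply/andP; split.
  apply: (@le_trans _ _ ((1 - theta) * (I0 * (1 - x) / x / A))%R).
    rewrite le_eqVlt; apply/orP; left; apply/eqP; rewrite /x; field.
    by rewrite !gt_eqF.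
  rewrite ler_pM2l// ler_pM2r ?invr_gt0//.
  apply: (@le_trans _ _ (Ia / x)%R).
    rewrite ler_pM2r ?invr_gt0//; apply: le_trans zI.
    by rewrite mulrC ler_pM2r.
  rewrite ler_wpM2l//.
    by apply: le_trans zI; rewrite mulr_ge0// ltW.
  by rewrite lef_pV2 ?posrE//; lra.
apply: (@le_trans _ _ ((1 - theta) * (I0 / (x / (1 + x)) / A))%R); last first.
  rewrite le_eqVlt; apply/orP; left; apply/eqP; rewrite /x; field.
  by rewrite !gt_eqF//= ltr_pwDl// ltW.
rewrite ler_pM2l// ler_pM2r ?invr_gt0//.
apply: ler_pM; [|by rewrite invr_ge0 ltW|exact: II|by rewrite lef_pV2].
by apply: le_trans zI; rewrite mulr_ge0// ltW.
Qed.

Lemma slot_const_cvg p : (0 < p)%R -> slot_const p theta @[theta --> 1%R^'-] --> slot_lim p.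
Proof.
move=> p0.
have aff (c : R) : (slot_lim p + c * (1 - theta) @[theta --> 1^'-] --> slot_lim p)%R.
  rewrite -[X in _ --> X](_ : slot_lim p + c * (1 - 1) = _)%R; last first.
    by rewrite subrr mulr0 addr0.
  apply: cvg_at_left_filter; apply: cvgD; first exact: cvg_cst.
  by apply: cvgZl_tmp; apply: cvgB; [exact: cvg_cst|exact: cvg_id].
apply: (@squeeze_cvgr _ _ _ _ (fun theta => slot_lim p + (- (slot_lim p * p * ln 2)) * (1 - theta))%R
  (fun theta => slot_lim p + (slot_lim p * p * ln 2) * (1 - theta))%R); last 2 first.
- exact: aff.
- exact: aff.
near=> theta.
have t1 : (theta < 1)%R by near: theta; exact: nbhs_left_lt.
have E (c : R) : (slot_lim p + c * (slot_lim p * p * ln 2) * (1 - theta) =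
    slot_lim p * (1 + c * (p * (1 - theta) * ln 2)))%R by ring.
have := slot_const_bounds p0 t1; have := E 1%R; have := E (-1)%R.
by rewrite !mulN1r !mul1r => -> ->.
Unshelve. all: by end_near. Qed.

Lemma slot_const_gt0 p theta : (0 < p)%R -> (theta < 1)%R -> (0 < slot_const p theta)%R.
Proof.
move=> p0 t1.
have e0 : (0 < 1 - theta)%R by rewrite subr_gt0.
have a0 : (0 < p * (1 - theta))%R by rewrite mulr_gt0.
have z0 : (0 < 2^-1 `^ (p * (1 - theta)) :> R)%R by rewrite powR_gt0// invr_gt0.
rewrite /slot_const /polar_const powR1 mul1r mulr_gt0// divr_gt0 ?sphere_area_gt0// divr_gt0//.
  have /andP[+ _] := annulus_mass_bounds m (ltW a0).
  rewrite (annulus_massE (ltW a0)) (annulus_massE (lexx _)) -EFinM lee_fin.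
  by apply: lt_le_trans; rewrite mulr_gt0// annulus_mass0_gt0.
have P1 : (1 `^ (p * (1 - theta)) = 1 :> R)%R by rewrite powR1.
rewrite subr_gt0 -[ltRHS]P1; apply: gt0_ltr_powR => //; rewrite ?nnegrE ?invr_ge0//.
by rewrite invf_lt1 ?ltr1n.
Qed.

End polar.
(** * Iterated polar coordinates *)

Section slots.
Context {R : realType} {n : nat}.
Local Notation V := 'rV[R]_n.

(** Stated by recursion on the slots, in the same order as the iterated integral, so
that the inductions match. *)
Fixpoint slotwise_homogeneous (p : R) (k : nat) : (k.-tuple V -> \bar R) -> Prop :=
  match k with
  | 0 => fun=> True
  | k'.+1 => fun F =>
    (forall c v (t : k'.-tuple V), 0 < c ->
      F [tuple of c *: v :: t] = ((c `^ p)%:E * F [tuple of v :: t])%E) /\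
    forall v, @slotwise_homogeneous p k' (fun t : k'.-tuple V => F [tuple of v :: t])
  end.

Fixpoint slotwise_linear (k : nat) : (k.-tuple V -> R) -> Prop :=
  match k with
  | 0 => fun=> True
  | k'.+1 => fun F =>
    (forall c u v (t : k'.-tuple V),
      F [tuple of c *: u + v :: t] = c * F [tuple of u :: t] + F [tuple of v :: t]) /\
    forall v, @slotwise_linear k' (fun t : k'.-tuple V => F [tuple of v :: t])
  end.

Lemma linear_headZ k (F : k.+1.-tuple V -> R) c v (t : k.-tuple V) :
  (forall c u v (t : k.-tuple V),
      F [tuple of c *: u + v :: t] = c * F [tuple of u :: t] + F [tuple of v :: t]) ->
  F [tuple of c *: v :: t] = c * F [tuple of v :: t].
Proof.
move=> FL; have F0 : F [tuple of 0 :: t] = 0.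
  by have := FL 1 0 0 t; rewrite scale1r addr0 mul1r => /eqP; rewrite -subr_eq0 opprD addrA subrr sub0r oppr_eq0 => /eqP.
by have := FL c v 0 t; rewrite addr0 F0 addr0.
Qed.

Lemma slotwise_linear_powR p k (F : k.-tuple V -> R) : slotwise_linear F ->
  slotwise_homogeneous p (fun t => (`|F t| `^ p)%:E).
Proof.
elim: k F => //= k IH F [FL FS]; split; last by move=> v; exact: IH (FS v).
move=> c v t c0; rewrite linear_headZ// normrM gtr0_norm//.
by rewrite powRM ?EFinM// ltW.
Qed.

Definition tuple_upd T k (t : k.-tuple T) (i : 'I_k) (x : T) : k.-tuple T :=
  [tuple if j == i then x else tnth t j | j < k].

Lemma tuple_upd_head T k (x y : T) (t : k.-tuple T) :
  tuple_upd [tuple of x :: t] ord0 y = [tuple of y :: t].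
Proof.
apply: eq_from_tnth => j; rewrite tnth_mktuple.
by case: (unliftP ord0 j) => [j' ->|->]; rewrite ?tnthS ?tnth0.
Qed.

Lemma tuple_upd_tail T k (x y : T) (t : k.-tuple T) i :
  tuple_upd [tuple of x :: t] (lift ord0 i) y = [tuple of x :: tuple_upd t i y].
Proof.
apply: eq_from_tnth => j; rewrite tnth_mktuple.
case: (unliftP ord0 j) => [j' ->|->]; last by rewrite !tnth0.
by rewrite !tnthS tnth_mktuple (inj_eq lift_inj).
Qed.

Lemma slotwise_linear_upd k (F : k.-tuple V -> R) :
  (forall i t c u v, F (tuple_upd t i (c *: u + v)) =
     c * F (tuple_upd t i u) + F (tuple_upd t i v)) ->
  slotwise_linear F.
Proof.
elim: k F => //= k IH F FL; split.
  by move=> c u v t; have := FL ord0 [tuple of u :: t] c u v; rewrite !tuple_upd_head.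
move=> x; apply: IH => i t c u v.
by have := FL (lift ord0 i) [tuple of x :: t] c u v; rewrite !tuple_upd_tail.
Qed.

Lemma kcov_eval_linear k (a : kcovector R n k) : slotwise_linear (kcov_eval a).
Proof.
apply: slotwise_linear_upd => i t c u v.
rewrite /kcov_eval mulr_sumr -big_split; apply: eq_bigr => I _ /=.
rewrite mulrCA -mulrDr; congr (_ * _).
rewrite -[LHS]det_tr -[X in _ = c * X + _]det_tr -[X in _ = _ + X]det_tr -[X in _ = _ + X]mul1r.
apply: (@determinant_multilinear _ _ _ _ _ i).
- by apply/rowP => j; rewrite !mxE !tnth_mktuple eqxx !mxE mul1r.
- by apply/matrixP => j l; rewrite !mxE !tnth_mktuple eq_sym (negbTE (neq_lift _ _)).
- by apply/matrixP => j l; rewrite !mxE !tnth_mktuple eq_sym (negbTE (neq_lift _ _)).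
Qed.

Lemma measurable_kcov_eval d (T : measurableType d) k (a : T -> kcovector R n k)
    (t : T -> k.-tuple V) :
  (forall I, measurable_fun setT (fun x => a x I)) -> measurable_fun setT t ->
  measurable_fun setT (fun x => kcov_eval (a x) (t x)).
Proof.
move=> ma mt; apply: measurable_sum => I; apply: measurable_funM; first exact: ma.
rewrite /determinant; apply: measurable_sum => s; apply: measurable_funM => //.
apply: measurable_prod => i _.
under eq_fun do rewrite mxE.
apply: measurable_coord.
exact: measurableT_comp (measurable_tnth _) mt.
Qed.

Definition slot_weights k (p theta r : R) (t : k.-tuple V) : R :=
  \prod_(i < k) slot_weight p theta r (tnth t i).

Lemma slot_weights_cons k p theta r v (t : k.-tuple V) :
  slot_weights p theta r [tuple of v :: t] =
  slot_weight p theta r v * slot_weights p theta r t.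
Proof.
rewrite /slot_weights big_ord_recl tnth0; congr (_ * _).
by apply: eq_bigr => i _; rewrite tnthS.
Qed.

Lemma slot_weights_ge0 k p theta r (t : k.-tuple V) : theta < 1 ->
  0 <= slot_weights p theta r t.
Proof. by move=> t1; apply: prodr_ge0 => i _; exact: slot_weight_ge0. Qed.

Lemma measurable_slot_weights k p theta r :
  measurable_fun setT (@slot_weights k p theta r).
Proof.
apply: measurable_prod => i _.
exact: measurableT_comp (measurable_slot_weight _ _ _) (measurable_tnth i).
Qed.

End slots.

Section iterated_polar.
Local Open Scope ereal_scope.
Context {R : realType} (m : nat).
Local Notation n := m.+1.
Local Notation V := 'rV[R]_n.
Local Notation S := (@unit_sphere R n).
Local Notation L := (@lebesgue_rV R n).
Local Notation H := (@hausdorff R n m).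

Variables (p theta r : R).
Hypotheses (p0 : (0 < p)%R) (t01 : (0 < theta < 1)%R) (r0 : (0 < r)%R).

Let C := (slot_const m p theta * r `^ (p * (1 - theta)))%R.

Let t1 : (theta < 1)%R. Proof. by case/andP: t01. Qed.

Let C0 : (0 < C)%R.
Proof. by rewrite mulr_gt0 ?slot_const_gt0// powR_gt0. Qed.

(** The function of the first slot obtained by integrating the others inherits
homogeneity and measurability from its expression as an integral against slot
weights; the iterated integral over spheres is then a constant multiple of it. *)
Lemma integral_slots_aux k (F : k.-tuple V -> \bar R) :
  measurable_fun setT F -> (forall t, 0 <= F t) -> slotwise_homogeneous p F ->
  \int[tuple_measure L k]_t ((slot_weights p theta r t)%:E * F t) =
  (C ^+ k)%:E * iterated_integral H S F.
Proof.
elim: k F => [|k IH] F mF F0 FH.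
  by rewrite integral_tuple0 /slot_weights big_ord0 expr0.
have mWF : measurable_fun setT (fun t : k.+1.-tuple V => (slot_weights p theta r t)%:E * F t).
  by apply: emeasurable_funM => //; apply/measurable_EFinP; exact: measurable_slot_weights.
have WF0 (t : k.+1.-tuple V) : 0 <= (slot_weights p theta r t)%:E * F t.
  by rewrite mule_ge0// lee_fin slot_weights_ge0.
have mW : measurable_fun setT (fun t : k.-tuple V => (slot_weights p theta r t)%:E).
  by apply/measurable_EFinP; exact: measurable_slot_weights.
have mFv v : measurable_fun setT (fun t : k.-tuple V => F [tuple of v :: t]).
  exact: measurableT_comp mF (@measurable_cons1 _ _ k v).
pose g v := \int[tuple_measure L k]_t ((slot_weights p theta r t)%:E * F [tuple of v :: t]).
have g0 v : 0 <= g v.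
  by apply: integral_ge0 => t _; rewrite mule_ge0// lee_fin slot_weights_ge0.
have mg : measurable_fun setT g.
  pose G (z : V * k.-tuple V) := (slot_weights p theta r z.2)%:E * F [tuple of z.1 :: z.2].
  have mG : measurable_fun setT G.
    apply: emeasurable_funM; first exact: measurableT_comp mW _.
    exact: measurableT_comp mF (@measurable_consP _ _ k).
  have G0 z : 0 <= G z by rewrite mule_ge0// lee_fin slot_weights_ge0.
  exact: (measurable_fun_fubini_tonelli_F (m2 := tuple_measure L k) G mG G0).
have gE v : g v = (C ^+ k)%:E * iterated_integral H S (fun t : k.-tuple V => F [tuple of v :: t]).
  by apply: IH => //; exact: FH.2.
have gH c v : (0 < c)%R -> g (c *: v) = (c `^ p)%:E * g v.
  move=> c0; rewrite -ge0_integralZl//; last 3 first.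
  - exact: emeasurable_funM.
  - by move=> t _; rewrite mule_ge0// lee_fin slot_weights_ge0.
  - by rewrite lee_fin powR_ge0.
  by apply: eq_integral => t _; rewrite FH.1// muleCA.
rewrite integral_tuple_cons//.
rewrite (eq_integral (fun v => (slot_weight p theta r v)%:E * g v)); last first.
  move=> v _; rewrite -ge0_integralZl//; last 3 first.
  - exact: emeasurable_funM.
  - by move=> t _; rewrite mule_ge0// lee_fin slot_weights_ge0.
  - by rewrite lee_fin slot_weight_ge0.
  by apply: eq_integral => t _; rewrite slot_weights_cons EFinM muleA.
rewrite integral_slot// -/C exprS [(C * C ^+ k)%:E]EFinM -muleA; congr (_ * _).
have iE v : iterated_integral H S (fun t : k.-tuple V => F [tuple of v :: t]) =
    (C ^- k)%:E * g v.
  by rewrite gE muleA -EFinM mulVf ?mul1e// expf_neq0// gt_eqF.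
have -> : iterated_integral H S F = \int[H]_(v in S) ((C ^- k)%:E * g v).
  by apply: eq_integral => v _; exact: iE.
rewrite ge0_integralZl//; last 3 first.
- exact: measurable_sphere.
- exact: measurable_funTS.
- by rewrite lee_fin invr_ge0 exprn_ge0// ltW.
by rewrite muleA -EFinM mulfV ?mul1e// expf_neq0// gt_eqF.
Qed.

End iterated_polar.

Section slots_general.
Local Open Scope ereal_scope.
Context {R : realType} {n : nat}.
Local Notation V := 'rV[R]_n.
Local Notation S := (@unit_sphere R n).
Local Notation L := (@lebesgue_rV R n).
Local Notation H := (@hausdorff R n n.-1).

(** The value 1 at n = 0 keeps the factors positive, with limit 1; then k = 0 and
only their power 0 occurs. *)
Definition slot_factor (p theta : R) : R :=
  if n is m.+1 then slot_const m p theta else 1%R.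

Definition slot_factor_lim (p : R) : R := if n is m.+1 then slot_lim m p else 1%R.

Definition area : R := if n is m.+1 then sphere_area m else 1%R.

Lemma slot_factor_gt0 p theta : (0 < p)%R -> (theta < 1)%R -> (0 < slot_factor p theta)%R.
Proof. by rewrite /slot_factor => p0 t1; case: n => // m; exact: slot_const_gt0. Qed.

Lemma slot_factor_lim_gt0 p : (0 < p)%R -> (0 < slot_factor_lim p)%R.
Proof. by rewrite /slot_factor_lim => p0; case: n => // m; exact: slot_lim_gt0. Qed.

Lemma slot_factor_cvg p : (0 < p)%R ->
  slot_factor p theta @[theta --> 1%R^'-] --> slot_factor_lim p.
Proof.
rewrite /slot_factor /slot_factor_lim => p0; case: n => [|m]; first exact: cvg_cst.
exact: slot_const_cvg.
Qed.

Lemma area_gt0 : (0 < area)%R.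
Proof. by rewrite /area; case: n => // m; exact: sphere_area_gt0. Qed.

Definition slots_factor k (p theta r : R) := ((slot_factor p theta * r `^ (p * (1 - theta))) ^+ k)%R.

Lemma slots_factor_gt0 k p theta r : (0 < p)%R -> (theta < 1)%R -> (0 < r)%R ->
  (0 < slots_factor k p theta r)%R.
Proof. by move=> p0 t1 r0; rewrite exprn_gt0// mulr_gt0 ?slot_factor_gt0// powR_gt0. Qed.

End slots_general.
Arguments slot_factor {R} n p theta.
Arguments slot_factor_lim {R} n p.
Arguments slots_factor {R} n k p theta r.
Arguments area {R} n.

Section integral_slots.
Local Open Scope ereal_scope.
Context {R : realType} {n : nat} (p : R).
Local Notation V := 'rV[R]_n.
Local Notation S := (@unit_sphere R n).
Local Notation L := (@lebesgue_rV R n).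
Local Notation H := (@hausdorff R n n.-1).
Hypothesis p0 : (0 < p)%R.

Lemma integral_slots k theta r (F : k.-tuple V -> \bar R) :
  (k <= n)%N -> (0 < theta < 1)%R -> (0 < r)%R ->
  measurable_fun setT F -> (forall t, 0 <= F t) -> slotwise_homogeneous p F ->
  \int[tuple_measure L k]_t ((slot_weights p theta r t)%:E * F t) =
  (slots_factor n k p theta r)%:E * iterated_integral H S F.
Proof.
case: k F => [|k] F.
  by rewrite integral_tuple0 /slot_weights /slots_factor big_ord0 expr0.
move: F; rewrite /slots_factor; case: n => // m F _ t01 r0 mF F0 FH.
exact: integral_slots_aux.
Qed.

Let half01 : (0 < (2^-1 : R) < 1)%R.
Proof. by rewrite invr_gt0 ltr0n invf_lt1 ?ltr1n. Qed.

Let c k : R := slots_factor n k p 2^-1 1.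

Let c0 k : (0 < c k)%R.
Proof. by apply: slots_factor_gt0 => //; case/andP: half01. Qed.

Lemma iterated_integralE k (F : k.-tuple V -> \bar R) : (k <= n)%N ->
  measurable_fun setT F -> (forall t, 0 <= F t) -> slotwise_homogeneous p F ->
  iterated_integral H S F =
  (c k)^-1%:E * \int[tuple_measure L k]_t ((slot_weights p 2^-1 1 t)%:E * F t).
Proof.
move=> kn mF F0 FH; rewrite integral_slots//.
by rewrite muleA -EFinM mulVf ?mul1e// gt_eqF.
Qed.

(** The Hausdorff measure is not sigma-finite on the whole space, so that Tonelli does
not apply to it directly; for homogeneous functions the iterated integral is a
multiple of an integral against slot weights, at theta = 1/2 and r = 1, which is
measurable in x. *)
Lemma measurable_iterated_integral d (T : measurableType d) k
    (F : T * k.-tuple V -> \bar R) : (k <= n)%N ->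
  measurable_fun setT F -> (forall z, 0 <= F z) ->
  (forall x, slotwise_homogeneous p (fun t => F (x, t))) ->
  measurable_fun setT (fun x => iterated_integral H S (fun t => F (x, t))).
Proof.
move=> kn mF F0 FH.
have mFx x : measurable_fun setT (fun t => F (x, t)).
  exact: measurableT_comp mF (measurable_pair1 x).
under eq_fun do rewrite iterated_integralE//.
apply: measurable_funeM.
pose G (z : T * k.-tuple V) := (slot_weights p 2^-1 1 z.2)%:E * F z.
have mG : measurable_fun setT G.
  apply: emeasurable_funM => //; apply/measurable_EFinP.
  exact: measurableT_comp (measurable_slot_weights _ _ _) _.
have G0 z : 0 <= G z by rewrite mule_ge0// lee_fin slot_weights_ge0//; case/andP: half01.
exact: (measurable_fun_fubini_tonelli_F (m2 := tuple_measure L k) G mG G0).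
Qed.

Lemma iterated_integral_ge0 k (F : k.-tuple V -> \bar R) :
  (forall t, 0 <= F t) -> 0 <= iterated_integral H S F.
Proof. by elim: k F => //= k IH F F0; apply: integral_ge0 => v _; exact: IH. Qed.

Definition norm_prod k (t : k.-tuple V) : R := \prod_(i < k) enorm (tnth t i).

Lemma norm_prod_ge0 k (t : k.-tuple V) : (0 <= norm_prod t)%R.
Proof. by apply: prodr_ge0 => i _; exact: enorm_ge0. Qed.

Lemma norm_prod_cons k v (t : k.-tuple V) :
  norm_prod [tuple of v :: t] = (enorm v * norm_prod t)%R.
Proof.
rewrite /norm_prod big_ord_recl tnth0; congr (_ * _)%R.
by apply: eq_bigr => i _; rewrite tnthS.
Qed.

Lemma measurable_norm_prod k : measurable_fun setT (@norm_prod k).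
Proof.
apply: measurable_prod => i _.
exact: measurableT_comp (@measurable_enorm R n) (measurable_tnth i).
Qed.

Lemma norm_prod_homogeneous k :
  slotwise_homogeneous p (fun t : k.-tuple V => (norm_prod t `^ p)%:E).
Proof.
suff H' (b : R) : (0 <= b)%R -> slotwise_homogeneous p (fun t : k.-tuple V => ((b * norm_prod t) `^ p)%:E).
  by have := H' 1%R ler01; congr slotwise_homogeneous; apply/funext => t; rewrite mul1r.
elim: k b => //= k IH b b0; split.
  move=> e v t e0; rewrite !norm_prod_cons enormZ gtr0_norm// -EFinM -powRM ?(ltW e0)//.
    by congr (_ `^ _)%:E; ring.
  by rewrite !mulr_ge0// ?enorm_ge0// norm_prod_ge0.
move=> v; have := IH (b * enorm v)%R; rewrite mulr_ge0 ?enorm_ge0// => /(_ isT).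
congr slotwise_homogeneous.
by apply/funext => t; rewrite norm_prod_cons mulrA.
Qed.

Lemma iterated_norm_prod k : (k <= n)%N ->
  iterated_integral H S (fun t : k.-tuple V => (norm_prod t `^ p)%:E) = (area n ^+ k)%:E.
Proof.
elim: k => [|k IH] kn; first by rewrite /= /norm_prod big_ord0 powR1 expr0.
rewrite /=; transitivity (\int[H]_(v in S) (area n ^+ k)%:E).
  apply: eq_integral => v; rewrite inE => Sv; rewrite -IH ?(ltnW kn)//.
  by congr iterated_integral; apply/funext => t; rewrite norm_prod_cons (Sv : enorm v = 1%R) mul1r.
rewrite integral_cst//; last exact: measurable_sphere.
rewrite exprSr EFinM; congr (_ * _).
by rewrite /area; case: (n) kn => // m _; exact: sphere_areaE.
Qed.

Lemma integral_slots_norm_prod k theta r : (k <= n)%N -> (0 < theta < 1)%R -> (0 < r)%R ->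
  \int[tuple_measure L k]_t ((slot_weights p theta r t)%:E * (norm_prod t `^ p)%:E) =
  (slots_factor n k p theta r * area n ^+ k)%:E.
Proof.
move=> kn t01 r0; rewrite integral_slots//.
- by rewrite iterated_norm_prod// EFinM.
- apply/measurable_EFinP; exact: measurableT_comp (measurable_powR _) (@measurable_norm_prod k).
- by move=> t; rewrite lee_fin powR_ge0.
- exact: norm_prod_homogeneous.
Qed.

End integral_slots.

Section covector_bounds.
Context {R : realType} {n k : nat}.
Local Notation V := 'rV[R]_n.

(** The Leibniz formula suffices, at the price of k! in place of the constant 1 of
the inequality of Hadamard. *)
Lemma det_le_prod (M : 'M[R]_k) (b : 'I_k -> R) :
  (forall i j, `|M i j| <= b j) -> `|\det M| <= k`!%:R * \prod_j b j.
Proof.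
move=> Mb; have b0 j : 0 <= b j by apply: le_trans (Mb j j).
apply: le_trans (ler_norm_sum _ _ _) _.
apply: (@le_trans _ _ (\sum_(s : 'S_k) \prod_j b j)).
  apply: ler_sum => s _; rewrite normrM normrX normrN1 expr1n mul1r normr_prod.
  rewrite [leRHS](reindex_inj (@perm_inj _ s)).
  by apply: ler_prod => i _; rewrite normr_ge0 Mb.
by rewrite sumr_const card_Sn mulr_natl.
Qed.

Lemma coef_le_kcov_norm (a : kcovector R n k) I : `|a I| <= kcov_norm a.
Proof.
rewrite -sqrtr_sqr ler_wsqrtr// (bigD1 I)//= lerDl.
by apply: sumr_ge0 => J _; exact: sqr_ge0.
Qed.

Lemma kcov_norm_ge0 (a : kcovector R n k) : 0 <= kcov_norm a.
Proof. exact: sqrtr_ge0. Qed.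

Lemma kcov_norm_le_sum (a : kcovector R n k) : kcov_norm a <= \sum_I `|a I|.
Proof.
have s0 : 0 <= \sum_I `|a I| by apply: sumr_ge0.
rewrite -[leRHS]ger0_norm// -sqrtr_sqr ler_wsqrtr//.
rewrite expr2 mulr_suml; apply: ler_sum => I _.
rewrite -[leLHS]ger0_norm ?sqr_ge0// normrX expr2 ler_wpM2l//.
by rewrite (bigD1 I)//= lerDl sumr_ge0.
Qed.

Lemma kcov_eval_le (a : kcovector R n k) (t : k.-tuple V) :
  `|kcov_eval a t| <= (\sum_I `|a I|) * k`!%:R * norm_prod t.
Proof.
rewrite -mulrA mulr_suml; apply: le_trans (ler_norm_sum _ _ _) _.
apply: ler_sum => I _; rewrite normrM ler_wpM2l//.
apply: det_le_prod => i j; rewrite mxE; exact: coord_le_enorm.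
Qed.

Definition basis_tuple (I : multi_index n k) : k.-tuple V :=
  [tuple delta_mx ord0 (tnth (val I) i) | i < k].

Lemma multi_index_inj (I J : multi_index n k) :
  (forall i, tnth (val I) i \in (val J : seq 'I_n)) -> I = J.
Proof.
move=> IJ; apply/val_inj/val_inj => /=.
have srt (K : multi_index n k) : sorted ltn [seq val i | i <- val (val K)] by exact: (valP K).
have tr : transitive ltn by move=> a b c; exact: ltn_trans.
have uI : uniq (val (val I)) by apply: (@map_uniq _ _ val); apply: sorted_uniq (srt I) => //; exact: ltnn.
apply: (inj_map val_inj).
have sub : {subset val (val I) <= val (val J)} by move=> y /tnthP[i ->]; exact: IJ.
have sz : (size (val (val J)) <= size (val (val I)))%N by rewrite !size_tuple.
have [_ E] := uniq_min_size uI sub sz.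
apply: (irr_sorted_eq tr ltnn (srt I) (srt J)) => x.
by apply/mapP/mapP => -[y yK ->]; exists y; rewrite ?E// -E.
Qed.

(** Dual bases: the minor of the identity matrix with rows J and columns I vanishes
unless the increasing indices I and J agree. *)
Lemma kcov_eval_basis (a : kcovector R n k) I : kcov_eval a (basis_tuple I) = a I.
Proof.
rewrite /kcov_eval (bigD1 I)//= big1 ?addr0.
  rewrite (_ : \matrix_(_, _) _ = 1%:M) ?det1 ?mulr1//.
  apply/matrixP => i j; rewrite !mxE tnth_mktuple mxE eqxx/=; congr (_%:R); congr nat_of_bool.
  apply/eqP/eqP => [|->//] E; apply: val_inj => /=.
  have u : uniq (val (val I)).
    apply: (@map_uniq _ _ val); apply: (@sorted_uniq _ ltn); [|exact: ltnn|exact: (valP I)].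
    by move=> x y z; exact: ltn_trans.
  by move/tuple_uniqP: u => /(_ _ _ E) ->.
move=> J JI.
have [/forallP JinI|/forallPn[i iI]] := boolP [forall i, tnth (val J) i \in (val I : seq 'I_n)].
  by move: JI; rewrite (multi_index_inj JinI) eqxx.
rewrite (expand_det_row _ i) big1 ?mulr0// => j _.
rewrite !mxE tnth_mktuple mxE eqxx/=; case: eqP => [E|_]; last by rewrite mul0r.
by move: iI; rewrite E mem_tnth.
Qed.

End covector_bounds.

Section sphere_norm.
Local Open Scope ereal_scope.
Context {R : realType} {n : nat}.
Local Notation V := 'rV[R]_n.
Local Notation S := (@unit_sphere R n).
Local Notation H := (@hausdorff R n n.-1).

Lemma integral_sphere_refl (u : V) (g : V -> \bar R) :
  measurable_fun setT g -> (forall v, 0 <= g v) ->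
  \int[H]_(v in S) g (refl u v) = \int[H]_(v in S) g v.
Proof.
move=> mg g0; have mS := @measurable_sphere R n.
have mP : measure_preserving H (refl u).
  by split; [exact: measurable_refl|exact: hausdorff_refl].
rewrite [LHS]integral_mkcond [RHS]integral_mkcond.
rewrite -[RHS](integral_preserving mP); last 2 first.
- by apply/(measurable_restrictT _ _).1 => //; exact: measurable_funTS.
- by move=> v; rewrite erestrict_ge0.
apply: eq_integral => v _; rewrite !patchE.
suff -> : (v \in S) = (refl u v \in S) by [].
by apply/idP/idP; rewrite !inE /unit_sphere/= enorm_refl.
Qed.

Variables (p : R).
Hypothesis p0 : (0 < p)%R.

Lemma measurable_dot_powR (a : V) : measurable_fun setT (fun v => (`|dot a v| `^ p)%:E).
Proof.
apply/measurable_EFinP; apply: measurableT_comp (measurable_powR _) _.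
apply: measurableT_comp => //; apply: measurable_sum => i.
by apply: measurable_funM => //; exact: measurable_rV_coord.
Qed.

(** By invariance under reflections the p-th moment of a linear form depends
only on the norm of its gradient; the moments of the coordinates cannot vanish
since the coordinates have no common zero on the sphere. *)
Lemma sphere_linear_ge : (0 < n)%N -> exists2 c : R, (0 < c)%R &
  forall f : V -> R, (forall b u v, f (b *: u + v) = b * f u + f v)%R ->
  forall e, S e -> (c * `|f e| `^ p)%:E <= \int[H]_(v in S) (`|f v| `^ p)%:E.
Proof.
move=> n0; have mS := @measurable_sphere R n.
have Hfin : H S < +oo /\ 0 < H S.
  by move: n0; case: (n) => // m _; rewrite hausdorff_sphere_lty hausdorff_sphere_gt0.
pose M (a : V) := \int[H]_(v in S) (`|dot a v| `^ p)%:E.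
have Meq (a b : V) : enorm a = enorm b -> M a = M b.
  move=> ab; rewrite /M -(refl_swap (esym ab)) -(@integral_sphere_refl (b - a)); last 2 first.
  - exact: measurable_dot_powR.
  - by move=> v; rewrite lee_fin powR_ge0.
  by apply: eq_integral => v _; rewrite dot_refl.
have MZ (b : R) (a : V) : M (b *: a) = (`|b| `^ p)%:E * M a.
  rewrite /M -ge0_integralZl//; last first.
    by apply: measurable_funTS; exact: measurable_dot_powR.
  by apply: eq_integral => v _; rewrite dotZl normrM powRM ?EFinM.
pose d (i : 'I_n) : V := delta_mx ord0 i.
have dE (i : 'I_n) v : dot (d i) v = v ord0 i.
  rewrite /dot (bigD1 i)//= big1 ?mxE ?eqxx ?mul1r ?addr0// => j ji.
  by rewrite mxE (negbTE ji) andbF mul0r.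
have d1 i : enorm (d i) = 1%R by rewrite enormE dE mxE !eqxx sqrtr1.
pose i0 : 'I_n := Ordinal n0.
have dot1 (a v : V) : enorm a = 1%R -> S v -> (`|dot a v| <= 1)%R.
  move=> a1 v1; rewrite ler_norml; have := dot_le_enorm a v; have := dot_le_enorm (- a) v.
  by rewrite dotNl enormN a1 (v1 : enorm v = 1%R) mulr1 => *; apply/andP; split; lra.
have Mfin : M (d i0) < +oo.
  apply: le_lt_trans Hfin.1; rewrite -[leRHS]mul1e -integral_cst//.
  apply: ge0_le_integral => //.
  - by apply: measurable_funTS; exact: measurable_dot_powR.
  - move=> v Sv; rewrite lee_fin; apply: (@le_trans _ _ (1 `^ p)%R); last by rewrite powR1.
    by apply: ge0_ler_powR; rewrite ?nnegrE ?(ltW p0)// dot1.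
have M0 : 0 < M (d i0).
  rewrite lt0e integral_ge0 ?andbT; last by move=> v _; rewrite lee_fin powR_ge0.
  apply/eqP => Md; have Mi i : M (d i) = 0 by rewrite -Md; apply: Meq; rewrite !d1.
  have : (n%:R^-1 `^ p)%:E * H S <= \sum_(i < n) M (d i).
    rewrite -ge0_integral_sum//; last first.
      by move=> i; apply: measurable_funTS; exact: measurable_dot_powR.
    rewrite -integral_cst//; apply: ge0_le_integral => //.
    - by move=> v _; rewrite lee_fin powR_ge0.
    - by apply: emeasurable_sum => i; apply: measurable_funTS; exact: measurable_dot_powR.
    move=> v Sv; rewrite sumEFin lee_fin.
    have [i vi] : exists i, (n%:R^-1 <= `|v ord0 i|)%R.
      apply: contrapT => /forallNP nv.
      have : (\sum_i `|v ord0 i| < \sum_(i < n) n%:R^-1)%R.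
        apply: ltr_sum; first by apply/hasP; exists i0; rewrite ?mem_index_enum.
        by move=> i _; rewrite ltNge; exact/negP/nv.
      rewrite sumr_const card_ord -[X in (_ < X)%R]mulr_natl divff ?pnatr_eq0 -?lt0n//.
      by rewrite ltNge -{1}(Sv : enorm v = 1%R) enorm_le_sum.
    rewrite (bigD1 i)//=; apply: (@le_trans _ _ (`|dot (d i) v| `^ p)%R); last first.
      by rewrite lerDl sumr_ge0// => j _; exact: powR_ge0.
    by rewrite dE ge0_ler_powR ?nnegrE ?(ltW p0)// invr_ge0.
  rewrite (eq_bigr (fun=> 0)); last by move=> i _; exact: Mi.
  rewrite big1_eq; apply/negP; rewrite -ltNge; apply: mule_gt0; last exact: Hfin.2.
  by rewrite lte_fin powR_gt0// invr_gt0 ltr0n.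
have ME : M (d i0) = (fine (M (d i0)))%:E by rewrite fineK// gt0_fin_numE.
exists (fine (M (d i0))); first by rewrite -lte_fin -ME.
move=> f fL e Se.
have f0 : f 0%R = 0%R by have := fL 1%R 0%R 0%R; rewrite scale1r addr0 mul1r; lra.
pose a : V := \row_i f (d i).
have fE v : f v = dot a v.
  have -> : v = (\sum_i v ord0 i *: d i)%R.
    exact: row_sum_delta.
  rewrite dotC /dot.
  have -> : f (\sum_i v ord0 i *: d i)%R = (\sum_i v ord0 i * f (d i))%R.
    elim/big_rec2 : _ => [|i y x _ <-]; first exact: f0.
    by rewrite fL.
  have -> : (\sum_i v ord0 i *: d i)%R = v.
    exact/esym/row_sum_delta.
  by apply: eq_bigr => i _; rewrite mxE.
under eq_integral do rewrite fE.
rewrite -/(M a) (Meq a (enorm a *: d i0)); last first.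
  by rewrite enormZ d1 mulr1 ger0_norm// enorm_ge0.
rewrite MZ {2}ME -EFinM lee_fin mulrC ler_wpM2r//.
  by rewrite -lee_fin -ME ltW.
rewrite (ger0_norm (enorm_ge0 a)); apply: ge0_ler_powR; rewrite ?nnegrE ?enorm_ge0 ?(ltW p0)//.
rewrite fE ler_norml; have := dot_le_enorm a e; have := dot_le_enorm (- a) e.
by rewrite dotNl enormN (Se : enorm e = 1%R) mulr1 => *; apply/andP; split; lra.
Qed.

(** Each integration over a sphere replaces one entry of e, by [sphere_linear_ge]. *)
Lemma iterated_linear_ge : exists2 c : R, (0 < c)%R &
  forall k (F : k.-tuple V -> R), (k <= n)%N -> measurable_fun setT F -> slotwise_linear F ->
  forall e : k.-tuple V, (forall i, S (tnth e i)) ->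
  (c ^+ k * `|F e| `^ p)%:E <= iterated_integral H S (fun t => (`|F t| `^ p)%:E).
Proof.
have [n0|n0] := posnP n.
  exists 1%R => // -[|k] F; last by rewrite {1}n0.
  by move=> _ _ _ e _; rewrite expr0 mul1r (tuple0 e).
have [c c0 cP] := sphere_linear_ge n0; exists c => //.
elim=> [|k IH] F kn mF FL e eS; first by rewrite expr0 mul1r (tuple0 e).
have -> : e = [tuple of tnth e ord0 :: [tuple of behead e]].
  by rewrite {1}(tuple_eta e).
set v0 := tnth e ord0; set e' := [tuple of behead e].
have e'S i : S (tnth e' i) by rewrite tnth_behead.
have Sv0 : S v0 by exact: eS.
apply: (@le_trans _ _ (\int[H]_(v in S) (c ^+ k * `|F [tuple of v :: e']| `^ p)%:E)).
  have := cP (fun v => F [tuple of v :: e']) (fun b u v => FL.1 b u v e') _ Sv0.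
  move=> /(lee_wpmul2l _) h; rewrite exprSr -mulrA EFinM.
  have mFe : measurable_fun setT (fun v => F [tuple of v :: e']).
    exact: measurableT_comp mF (@measurable_cons2 _ _ k e').
  under eq_integral do rewrite EFinM.
  rewrite ge0_integralZl//.
  - by apply: h; rewrite lee_fin exprn_ge0// ltW.
  - exact: measurable_sphere.
  - apply: measurable_funTS; apply/measurable_EFinP.
    by apply: measurableT_comp (measurable_powR _) _; exact: measurableT_comp.
  - by rewrite lee_fin exprn_ge0// ltW.
rewrite /=; apply: ge0_le_integral => //.
- exact: measurable_sphere.
- by move=> v _; rewrite lee_fin mulr_ge0 ?powR_ge0// exprn_ge0// ltW.
- apply: measurable_funTS; apply/measurable_EFinP; apply: measurable_funM => //.
  apply: measurableT_comp (measurable_powR _) _; apply: measurableT_comp => //.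
  exact: measurableT_comp mF (@measurable_cons2 _ _ k e').
- apply: measurable_funTS.
  pose G (z : V * k.-tuple V) := (`|F [tuple of z.1 :: z.2]| `^ p)%:E.
  apply: (@measurable_iterated_integral _ _ p p0 _ _ k G).
  + exact: ltnW.
  + apply/measurable_EFinP; apply: measurableT_comp (measurable_powR _) _; apply: measurableT_comp => //.
    exact: measurableT_comp mF (@measurable_consP _ _ k).
  + by move=> z; rewrite lee_fin powR_ge0.
  + by move=> v; apply: slotwise_linear_powR; exact: FL.2.
- move=> v Sv; apply: IH => //; first exact: ltnW.
    exact: measurableT_comp mF (@measurable_cons1 _ _ k v).
  exact: FL.2.
Qed.

End sphere_norm.

Section sphere_power.
Local Open Scope ereal_scope.
Context {R : realType} {n k : nat} (p : R).
Hypotheses (p0 : (0 < p)%R) (kn : (k <= n)%N).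
Local Notation V := 'rV[R]_n.
Local Notation S := (@unit_sphere R n).
Local Notation H := (@hausdorff R n n.-1).

Definition sphere_power (a : kcovector R n k) : \bar R :=
  iterated_integral H S (fun v : k.-tuple V => (`|kcov_eval a v| `^ p)%:E).

Lemma sphere_power_ge0 a : 0 <= sphere_power a.
Proof. by apply: iterated_integral_ge0 => t; rewrite lee_fin powR_ge0. Qed.

Lemma measurable_kcov_eval_powR d (T : measurableType d) (a : T -> kcovector R n k)
    (t : T -> k.-tuple V) :
  (forall I, measurable_fun setT (fun x => a x I)) -> measurable_fun setT t ->
  measurable_fun setT (fun x => (`|kcov_eval (a x) (t x)| `^ p)%:E).
Proof.
move=> ma mt; apply/measurable_EFinP; apply: measurableT_comp (measurable_powR _) _.
by apply: measurableT_comp => //; exact: measurable_kcov_eval.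
Qed.

Lemma kcov_eval_homogeneous (a : kcovector R n k) :
  slotwise_homogeneous p (fun v => (`|kcov_eval a v| `^ p)%:E).
Proof. by apply: slotwise_linear_powR; exact: kcov_eval_linear. Qed.

Lemma measurable_sphere_power d (T : measurableType d) (a : T -> kcovector R n k) :
  (forall I, measurable_fun setT (fun x => a x I)) ->
  measurable_fun setT (fun x => sphere_power (a x)).
Proof.
move=> ma; pose F (z : T * k.-tuple V) := (`|kcov_eval (a z.1) z.2| `^ p)%:E.
apply: (@measurable_iterated_integral _ _ p p0 _ _ k F) => //.
- by apply: measurable_kcov_eval_powR => // I; exact: (measurableT_comp (ma I) measurable_fst).
- by move=> z; rewrite lee_fin powR_ge0.
- by move=> x; exact: (kcov_eval_homogeneous (a x)).
Qed.

Lemma integral_slots_sphere_power theta r a : (0 < theta < 1)%R -> (0 < r)%R ->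
  \int[tuple_measure lebesgue_rV k]_t
    ((slot_weights p theta r t)%:E * (`|kcov_eval a t| `^ p)%:E) =
  (slots_factor n k p theta r)%:E * sphere_power a.
Proof.
move=> t01 r0; rewrite integral_slots//; first exact: measurable_kcov_eval_powR.
exact: kcov_eval_homogeneous.
Qed.

Lemma sum_coef_le (a : kcovector R n k) :
  (\sum_I `|a I| <= (\sum_(I : multi_index n k) 1) * kcov_norm a)%R.
Proof.
rewrite mulr_suml; apply: ler_sum => I _; rewrite mul1r; exact: coef_le_kcov_norm.
Qed.

(** Slot weights turn the iterated integral into a single one, in which |a(t)| is
bounded by the product of the norms of the slots. *)
Lemma sphere_power_le : exists2 C : R, (0 < C)%R &
  forall a, sphere_power a <= (C * kcov_norm a `^ p)%:E.
Proof.
have s0 : (0 <= \sum_(I : multi_index n k) (1 : R))%R by rewrite sumr_ge0.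
pose M : R := ((\sum_(I : multi_index n k) 1) * k`!%:R)%R.
have M0 : (0 <= M)%R by rewrite mulr_ge0.
exists (M `^ p * area n ^+ k + 1)%R.
  by rewrite ltr_wpDl// mulr_ge0 ?powR_ge0// exprn_ge0// ltW// area_gt0.
move=> a; have half01 : (0 < (2^-1 : R) < 1)%R by rewrite invr_gt0 ltr0n invf_lt1 ?ltr1n.
have c0 : (0 < slots_factor n k p (2^-1 : R) 1)%R.
  by apply: slots_factor_gt0 => //; case/andP: half01.
have W0 (t : k.-tuple V) : (0 <= slot_weights p 2^-1 1 t)%R.
  by apply: slot_weights_ge0; case/andP: half01.
rewrite -(@lee_pmul2l _ (slots_factor n k p (2^-1 : R) 1)%:E)//.
rewrite -integral_slots_sphere_power//.
apply: (@le_trans _ _ (\int[tuple_measure lebesgue_rV k]_t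
    (((M * kcov_norm a) `^ p)%:E *
      ((slot_weights p 2^-1 1 t)%:E * (norm_prod t `^ p)%:E)))).
  apply: ge0_le_integral => //.
  - by move=> t _; rewrite mule_ge0// lee_fin ?powR_ge0.
  - apply: emeasurable_funM; first by apply/measurable_EFinP; exact: measurable_slot_weights.
    exact: measurable_kcov_eval_powR.
  - apply: measurable_funeM; apply: emeasurable_funM.
      by apply/measurable_EFinP; exact: measurable_slot_weights.
    by apply/measurable_EFinP; exact: measurableT_comp (measurable_powR _) (@measurable_norm_prod R n k).
  - move=> t _; rewrite muleCA lee_wpmul2l ?lee_fin//.
    rewrite -powRM ?mulr_ge0 ?kcov_norm_ge0 ?norm_prod_ge0//.
    apply: ge0_ler_powR; rewrite ?nnegrE ?(ltW p0)// ?mulr_ge0 ?kcov_norm_ge0 ?norm_prod_ge0//.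
    apply: le_trans (kcov_eval_le _ _) _; rewrite ler_wpM2r ?norm_prod_ge0//.
    by rewrite mulrAC ler_wpM2r// sum_coef_le.
rewrite ge0_integralZl//; last 3 first.
- apply: emeasurable_funM; first by apply/measurable_EFinP; exact: measurable_slot_weights.
  by apply/measurable_EFinP; exact: measurableT_comp (measurable_powR _) (@measurable_norm_prod R n k).
- by move=> t _; rewrite mule_ge0// lee_fin ?powR_ge0.
- by rewrite lee_fin powR_ge0.
rewrite integral_slots_norm_prod// -!EFinM lee_fin mulrCA ler_wpM2l ?(ltW c0)//.
rewrite powRM ?kcov_norm_ge0// mulrAC ler_wpM2r ?powR_ge0//.
by rewrite lerDl.
Qed.

(** Some coefficient of a is comparable with its norm, and it is the value of a at a
tuple of coordinate vectors. *)
Lemma sphere_power_ge : exists2 c : R, (0 < c)%R &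
  forall a, (c * kcov_norm a `^ p)%:E <= sphere_power a.
Proof.
have [c c0 cP] := @iterated_linear_ge R n p p0.
pose M : R := (1 + \sum_(I : multi_index n k) 1)%R.
have M0 : (0 < M)%R by rewrite ltr_pwDl// sumr_ge0.
exists (c ^+ k * (M^-1) `^ p)%R; first by rewrite mulr_gt0 ?exprn_gt0// powR_gt0// invr_gt0.
move=> a; have [a0|a0] := eqVneq (kcov_norm a) 0%R.
  by rewrite a0 powR0 ?gt_eqF// mulr0 sphere_power_ge0.
have a1 : (0 < kcov_norm a)%R by rewrite lt0r a0 kcov_norm_ge0.
have [I aI] : exists I, (M^-1 * kcov_norm a <= `|a I|)%R.
  apply: contrapT => /forallNP nI.
  have : (\sum_I `|a I| <= \sum_(I : multi_index n k) (M^-1 * kcov_norm a))%R.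
    by apply: ler_sum => I _; rewrite ltW// ltNge; exact/negP/nI.
  move=> /(le_trans (kcov_norm_le_sum a)).
  have -> : (\sum_(I : multi_index n k) (M^-1 * kcov_norm a) = (M - 1) * (M^-1 * kcov_norm a))%R.
    by rewrite /M [X in (X - 1)%R]addrC addrK mulr_suml; apply: eq_bigr => I _; rewrite mul1r.
  apply/negP; rewrite -ltNge mulrA mulrBl mulfV ?gt_eqF// mul1r gtr_pMl//.
  by rewrite gtrBl invr_gt0.
apply: (@le_trans _ _ (c ^+ k * `|kcov_eval a (basis_tuple I)| `^ p)%:E).
  rewrite lee_fin -mulrA ler_wpM2l ?exprn_ge0 ?(ltW c0)// kcov_eval_basis.
  rewrite -powRM ?invr_ge0 ?(ltW M0) ?(ltW a1)//.
  by apply: ge0_ler_powR; rewrite ?nnegrE ?(ltW p0)// mulr_ge0 ?invr_ge0 ?(ltW M0) ?(ltW a1).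
apply: cP => //.
- exact: measurable_kcov_eval.
- exact: kcov_eval_linear.
- move=> i; rewrite tnth_mktuple /unit_sphere/= enormE /dot (bigD1 (tnth (val I) i))//= big1.
    by rewrite mxE !eqxx mulr1 addr0 sqrtr1.
  by move=> j ji; rewrite mxE (negbTE ji) andbF mul0r.
Qed.

End sphere_power.
(** * Continuity of translations in the mean *)

Lemma lee_prod (R : realType) I (s : seq I) (P : pred I) (F G : I -> \bar R) :
  (forall i, P i -> 0 <= F i <= G i)%E ->
  (\prod_(i <- s | P i) F i <= \prod_(i <- s | P i) G i)%E.
Proof.
move=> FG; pose K (x y : \bar R) := (0 <= x /\ x <= y)%E.
suff [] : K (\prod_(i <- s | P i) F i)%E (\prod_(i <- s | P i) G i)%E by [].
apply: (big_ind2 K) => [|a b c d [a0 ab] [c0 cd]|i /FG/andP[]].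
- by split => //; rewrite lee_fin.
- by split; [exact: mule_ge0|exact: lee_pmul].
- by [].
Qed.

Section shift_sets.
Local Open Scope ereal_scope.
Context {R : realType} {n : nat}.
Local Notation V := 'rV[R]_n.
Local Notation L := (@lebesgue_rV R n).

Lemma measurable_shift d (T : measurableType d) (f : V -> T) (y : V) :
  measurable_fun setT f -> measurable_fun setT (fun x : V => f (x + y)%R).
Proof.
move=> mf; apply: measurableT_comp mf _.
by have [] := lebesgue_rV_translation y.
Qed.

Lemma measurable_indic_shift (A : set V) (y : V) : measurable A ->
  measurable_fun setT (fun x : V => \1_A (x + y)%R : R).
Proof.
move=> mA; apply: (@measurableT_comp _ _ _ _ _ _ (\1_A : V -> R) _ (fun x : V => (x + y)%R)).
  exact: measurable_indic.
by have [] := lebesgue_rV_translation y.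
Qed.

Lemma integral_shift (f : V -> \bar R) (y : V) :
  measurable_fun setT f -> (forall x, 0 <= f x) ->
  \int[L]_x f (x + y)%R = \int[L]_x f x.
Proof. by move=> mf f0; exact: (integral_preserving (lebesgue_rV_translation y) mf f0). Qed.

(** The indicator, at x, of the symmetric difference of A and A - y. *)
Definition indic_diff (A : set V) (y x : V) : R := `|\1_A (x + y)%R - \1_A x|%R.

Lemma indic_diff_ge0 A y x : (0 <= indic_diff A y x)%R.
Proof. exact: normr_ge0. Qed.

Lemma measurable_indic_diff A y : measurable A -> measurable_fun setT (indic_diff A y).
Proof.
move=> mA; apply: measurableT_comp => //; apply: measurable_funB.
  exact: measurable_indic_shift.
exact: measurable_indic.
Qed.

(** Localized to cubes, since a half-space and its translates differ by sets of
infinite measure. *)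
Definition local_shift (A : set V) := measurable A /\
  forall r e : R, (0 <= r)%R -> (0 < e)%R -> exists2 d : R, (0 < d)%R &
    forall y, (enorm y < d)%R -> \int[L]_(x in cube r) (indic_diff A y x)%:E <= e%:E.

Lemma local_shiftC A : local_shift A -> local_shift (~` A).
Proof.
move=> [mA AS]; split; first exact: measurableC.
move=> r e r0 e0; have [d d0 dP] := AS r e r0 e0; exists d => // y yd.
apply: le_trans (dP y yd); rewrite le_eqVlt; apply/orP; left; apply/eqP.
apply: eq_integral => x _; congr EFin; rewrite /indic_diff !indicE !in_setC.
by case: (_ \in _); case: (_ \in _); rewrite //= ?subr0 ?sub0r ?subrr ?normrN.
Qed.

(** The indicator of a set described by the i-th coordinate only changes, under
a small translation, in a thin slab around the jump. *)
Lemma local_shift_coord (P : set R) (i : 'I_n) (a : R) :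
  measurable (P : set (measurableTypeR R)) ->
  (forall s t, P s -> ~ P t -> (s <= a <= t) || (t <= a <= s))%R ->
  local_shift [set x | P (x ord0 i)].
Proof.
move=> mP Pa; pose A := [set x : V | P (x ord0 i)].
have mA : measurable A by rewrite -[A]setTI; exact: measurable_rV_coord.
split => // r e r0 e0.
pose K : R := ((2 * r + 1) ^+ n)%R.
have K0 : (0 < K)%R by rewrite exprn_gt0// ltr_wpDl// mulr_ge0.
exists (e / (2 * K))%R; first by rewrite divr_gt0// mulr_gt0.
move=> y; set d := (e / _)%R => yd.
pose D (j : 'I_n) : set (measurableTypeR R) :=
  if j == i then [set` `[(a - d)%R, (a + d)%R]] else [set` `](- r)%R, r[].
have d0 : (0 < d)%R by rewrite divr_gt0// mulr_gt0.
have mD j : measurable (D j) by rewrite /D; case: ifP.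
pose box := [set x : V | forall j, D j (x ord0 j)].
have mbox : measurable box by exact: measurable_rV_box.
apply: (@le_trans _ _ (L box)); last first.
  rewrite lebesgue_rV_box// (bigD1 i)//=.
  have -> : lebesgue_measure (D i) = (2 * d)%:E.
    rewrite /D eqxx lebesgue_measure_itv/= lte_fin.
    rewrite ifT; first by rewrite -EFinB; congr EFin; ring.
    by rewrite ltrBlDr -addrA ltrDl addr_gt0.
  apply: (@le_trans _ _ ((2 * d)%:E * \prod_(j | j != i) (2 * r + 1)%:E)).
    rewrite lee_pmul2l ?lte_fin ?(mulr_gt0 _ d0)//.
    apply: lee_prod => j ji; rewrite measure_ge0/=.
    rewrite /D (negbTE ji) lebesgue_measure_itv/= lte_fin; case: ifP => _.
      by rewrite -EFinB lee_fin; lra.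
    by rewrite lee_fin; lra.
  rewrite prodEFin -EFinM lee_fin.
  apply: (@le_trans _ _ (2 * d * K)%R); last first.
    by rewrite /d le_eqVlt; apply/orP; left; apply/eqP; field; rewrite gt_eqF.
  rewrite ler_pM2l ?(mulr_gt0 _ d0)// /K -[X in (_ ^+ X)%R](card_ord n) -prodr_const.
  rewrite [leRHS](bigD1 i)//= ler_peMl ?prodr_ge0//; last lra.
  by move=> j _; lra.
rewrite -(integral_indic1 _ mbox) [leLHS]integral_mkcond.
apply: ge0_le_integral => //.
- by move=> x _; rewrite erestrict_ge0// => z _; rewrite lee_fin indic_diff_ge0.
- apply: (iffLR (measurable_restrictT _ (measurable_cube r))); apply: measurable_funTS.
  by apply/measurable_EFinP; exact: measurable_indic_diff.
- by apply/measurable_EFinP; exact: measurable_indic.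
move=> x _; rewrite patchE; case: ifPn => [|_]; last by rewrite lee_fin.
rewrite inE => xr; rewrite lee_fin /indic_diff.
have ydi : (`|y ord0 i| < d)%R by apply: le_lt_trans yd; exact: coord_le_enorm.
have bx : (x ord0 i) \in `[(a - d)%R, (a + d)%R] -> \1_box x = 1%R :> R.
  move=> xi; rewrite indicE mem_set// => j; rewrite /D.
  have [->//|ji] := eqVneq j i.
  by have := xr j; rewrite /= in_itv/= ltr_norml.
change (`|\1_A (x + y)%R - \1_A x| <= \1_box x :> R)%R.
have [Ax|nAx] := pselect (A x); have [Axy|nAxy] := pselect (A (x + y)%R).
- have -> : \1_A (x + y)%R = \1_A x :> R by rewrite !indicE !mem_set.
  by rewrite subrr normr0.
- rewrite bx ?indicE ?(memNset nAxy) ?(mem_set Ax) ?sub0r ?normrN ?normr1//.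
  rewrite in_itv/=; have := Pa _ _ Ax nAxy; move: ydi; rewrite mxE ltr_norml.
  by move=> /andP[? ?] /orP[/andP[? ?]|/andP[? ?]]; apply/andP; split; lra.
- rewrite bx ?indicE ?(memNset nAx) ?(mem_set Axy) ?subr0 ?normr1//.
  rewrite in_itv/=; have := Pa _ _ Axy nAx; move: ydi; rewrite mxE ltr_norml.
  by move=> /andP[? ?] /orP[/andP[? ?]|/andP[? ?]]; apply/andP; split; lra.
- have -> : \1_A (x + y)%R = \1_A x :> R by rewrite !indicE !memNset.
  by rewrite subrr normr0.
Qed.

Lemma indic_diff_setU A B y x :
  (indic_diff (A `|` B) y x <= indic_diff A y x + indic_diff B y x)%R.
Proof.
rewrite /indic_diff !indicE !in_setU.
by do 4 case: (_ \in _); rewrite //= ?subrr ?subr0 ?sub0r ?normrN ?normr0 ?normr1 ?addr0 ?add0r; lra.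
Qed.

Lemma local_shiftU A B : local_shift A -> local_shift B -> local_shift (A `|` B).
Proof.
move=> [mA AS] [mB BS]; split; first exact: measurableU.
move=> r e r0 e0; have e2 : (0 < e / 2)%R by rewrite divr_gt0.
have [d d0 dP] := AS r _ r0 e2; have [d' d'0 dP'] := BS r _ r0 e2.
exists (minr d d'); first by rewrite lt_min d0.
move=> y; rewrite lt_min => /andP[yd yd'].
apply: (@le_trans _ _ (\int[L]_(x in cube r) ((indic_diff A y x)%:E + (indic_diff B y x)%:E))).
  apply: ge0_le_integral.
  - exact: measurable_cube.
  - by move=> x _; rewrite lee_fin indic_diff_ge0.
  - apply: measurable_funTS; apply/measurable_EFinP; apply: measurable_indic_diff; exact: measurableU.
  - by apply: measurable_funTS; apply: emeasurable_funD; apply/measurable_EFinP; exact: measurable_indic_diff.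
  - by move=> x _; rewrite -EFinD lee_fin indic_diff_setU.
rewrite ge0_integralD//.
- by rewrite [e]splitr EFinD leeD// ?dP// dP'.
- exact: measurable_cube.
- by move=> x _; rewrite lee_fin indic_diff_ge0.
- by apply: measurable_funTS; apply/measurable_EFinP; exact: measurable_indic_diff.
- by move=> x _; rewrite lee_fin indic_diff_ge0.
- by apply: measurable_funTS; apply/measurable_EFinP; exact: measurable_indic_diff.
Qed.

Lemma local_shift0 : local_shift set0.
Proof.
split => // r e r0 e0; exists 1%R => // y _.
by rewrite integral0_eq ?lee_fin ?(ltW e0)// => x _; rewrite /indic_diff !indic0 subrr normr0.
Qed.

Lemma cube_lty r : L (cube r) < +oo.
Proof.
apply: (@le_lt_trans _ _ (L (cube `|r|%R))); last by rewrite lebesgue_cube// ltry.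
apply: le_measure; rewrite ?inE; [exact: measurable_cube|exact: measurable_cube|].
by move=> x xr i; apply: lt_le_trans (xr i) (ler_norm r).
Qed.

Lemma integral_cube_shift (A : set V) r y : measurable A -> (enorm y < 1)%R ->
  \int[L]_(x in cube r) (\1_A (x + y)%R)%:E <= L (A `&` cube (r + 1)%R).
Proof.
move=> mA y1; have mB : measurable (A `&` cube (r + 1)%R).
  by apply: measurableI => //; exact: measurable_cube.
rewrite -(integral_indic1 _ mB) -(integral_shift y); last 2 first.
- by apply/measurable_EFinP; exact: measurable_indic.
- by move=> x; rewrite lee_fin.
rewrite integral_mkcond; apply: ge0_le_integral => //.
- by move=> x _; rewrite erestrict_ge0// => z _; rewrite lee_fin.
- apply: (iffLR (measurable_restrictT _ (measurable_cube r))); apply: measurable_funTS.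
  by apply/measurable_EFinP; exact: measurable_indic_shift.
- apply/measurable_EFinP; exact: measurable_indic_shift.
move=> x _; rewrite patchE; case: ifPn => [|_]; last by rewrite lee_fin.
rewrite inE => xr; rewrite lee_fin !indicE in_setI.
rewrite [X in _ && X]mem_set ?andbT// => i; rewrite mxE.
apply: le_lt_trans (ler_normD _ _) _; apply: ltrD; first exact: xr.
by apply: le_lt_trans y1; exact: coord_le_enorm.
Qed.

Lemma indic_diff_sub A B y x : A `<=` B ->
  (indic_diff B y x <= indic_diff A y x + (\1_(B `\` A) (x + y)%R + \1_(B `\` A) x))%R.
Proof.
move=> AB; rewrite /indic_diff !indicE !in_setD.
have sub z : (z \in A) ==> (z \in B) by apply/implyP; rewrite !inE; exact: AB.
have := sub x; have := sub (x + y)%R.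
by do 4 case: (_ \in _); rewrite //= ?subrr ?subr0 ?sub0r ?normrN ?normr0 ?normr1 ?addr0 ?add0r => *; lra.
Qed.

(** Within a cube a countable union is approximated in measure by a finite one; the
translate of the cube by a vector of length less than 1 lies in the cube enlarged
by 1. *)
Lemma local_shift_bigcup (F : (set V)^nat) :
  (forall i, local_shift (F i)) -> local_shift (\bigcup_i F i).
Proof.
move=> FS; have mF i : measurable (F i) by have [] := FS i.
have mU : measurable (\bigcup_i F i) by exact: bigcup_measurable.
split => // r e r0 e0; have e3 : (0 < e / 3)%R by rewrite divr_gt0.
pose G N := \big[setU/set0]_(i < N) F i.
have GS N : local_shift (G N).
  rewrite /G; elim: N => [|N IH]; first by rewrite big_ord0; exact: local_shift0.
  by rewrite big_ord_recr; exact: local_shiftU.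
have mG N : measurable (G N) by have [] := GS N.
have GU N : G N `<=` \bigcup_i F i.
  by move=> x; rewrite /G -bigcup_mkord => -[i _ Fx]; exists i.
pose D N := (\bigcup_i F i `\` G N) `&` cube (r + 1)%R.
have mD N : measurable (D N).
  by apply: measurableI; [exact: measurableD|exact: measurable_cube].
have D0 : \bigcap_N D N = set0.
  apply/seteqP; split => // x Dx; have [[[i _ Fx] _] _] := Dx 0%N Logic.I.
  have [[_ nG] _] := Dx i.+1 Logic.I; apply: nG.
  by rewrite /G -bigcup_mkord; exists i => //=.
have : L \o D @ \oo --> L (\bigcap_N D N).
  apply: nonincreasing_cvg_mu => //.
  - apply: le_lt_trans (cube_lty (r + 1)%R).
    by apply: le_measure; rewrite ?inE//; [exact: measurable_cube|exact: subIsetr].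
  - by rewrite D0.
  - move=> a b ab; apply/subsetPset => x [[Ux nGx] xr]; split => //; split => // Gx; apply: nGx.
    by move: Gx; rewrite /G -!bigcup_mkord => -[i /= ia Fx]; exists i => //=; exact: leq_trans ab.
rewrite D0 measure0 => /fine_cvgP[Dfin /cvgrPdist_lt/(_ _ e3)[N1 _ DN1]].
case: Dfin => N0 _ DN0; pose N := maxn N0 N1.
have DN : L (D N) <= (e / 3)%:E.
  have /= f := DN0 N (leq_maxl _ _); have /= := DN1 N (leq_maxr _ _).
  rewrite sub0r normrN => h; rewrite -(fineK f) lee_fin.
  by apply: le_trans (ltW h); exact: ler_norm.
have [d d0 dP] := (GS N).2 r _ r0 e3.
exists (minr d 1%R); first by rewrite lt_min d0/=.
move=> y; rewrite lt_min => /andP[yd y1].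
have mGU : measurable (\bigcup_i F i `\` G N) by exact: measurableD.
have mi1 : measurable_fun setT (fun x : V => (\1_(\bigcup_i F i `\` G N) x)%:E : \bar R).
  by apply/measurable_EFinP; exact: measurable_indic.
have mi2 : measurable_fun setT (fun x : V => (\1_(\bigcup_i F i `\` G N) (x + y)%R)%:E : \bar R).
  exact: (measurable_shift y mi1).
have mi3 : measurable_fun setT (fun x : V => (indic_diff (G N) y x)%:E).
  by apply/measurable_EFinP; exact: measurable_indic_diff.
apply: (@le_trans _ _ (\int[L]_(x in cube r) ((indic_diff (G N) y x)%:E +
   ((\1_(\bigcup_i F i `\` G N) (x + y)%R)%:E + (\1_(\bigcup_i F i `\` G N) x)%:E)))).
  apply: ge0_le_integral.
  - exact: measurable_cube.
  - by move=> x _; rewrite lee_fin indic_diff_ge0.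
  - apply: measurable_funTS; apply/measurable_EFinP; exact: measurable_indic_diff.
  - by apply: measurable_funTS; apply: emeasurable_funD => //; exact: emeasurable_funD.
  - by move=> x _; rewrite -!EFinD lee_fin indic_diff_sub.
have mc := measurable_cube (n := n) r.
rewrite ge0_integralD//; last 4 first.
- by move=> x _; rewrite lee_fin indic_diff_ge0.
- exact: measurable_funTS.
- by move=> x _; rewrite adde_ge0// lee_fin.
- by apply: measurable_funTS; exact: emeasurable_funD.
rewrite ge0_integralD//; [|exact: measurable_funTS|exact: measurable_funTS].
have -> : e%:E = (e / 3)%:E + ((e / 3)%:E + (e / 3)%:E).
  by rewrite -!EFinD; congr EFin; field.
rewrite leeD ?dP// leeD//.
  exact: le_trans (integral_cube_shift _ mGU y1) DN.
rewrite integral_indic// (le_trans _ DN)// le_measure ?inE//.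
  exact: measurableI.
by move=> x [Ux xr]; split => // i; apply: lt_le_trans (xr i) _; rewrite lerDl.
Qed.

Lemma local_shift_borel A : measurable A -> local_shift A.
Proof.
have sS : sigma_algebra setT local_shift.
  split; first exact: local_shift0.
    by move=> B SB; rewrite setTD; exact: local_shiftC.
  exact: local_shift_bigcup.
apply: (smallest_sub sS); apply: sigma_algebra_open_rV => // i a.
  apply: (@local_shift_coord [set x | (x < a)%R] i a).
    by rewrite -set_itvNyo; exact: measurable_itv.
  by move=> s t /= sa /negP; rewrite -leNgt => ta; rewrite (ltW sa) ta.
apply: (@local_shift_coord [set x | (a < x)%R] i a).
  by rewrite -set_itvoy; exact: measurable_itv.
by move=> s t /= sa /negP; rewrite -leNgt => ta; rewrite (ltW sa) ta orbT.
Qed.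

End shift_sets.

Section shift_functions.
Local Open Scope ereal_scope.
Context {R : realType} {n : nat}.
Local Notation V := 'rV[R]_n.
Local Notation L := (@lebesgue_rV R n).

Definition shift_diff (F : V -> R) (y : V) : \bar R :=
  \int[L]_x (`|F (x + y)%R - F x|)%:E.

Definition shift_continuous (F : V -> R) := forall e : R, (0 < e)%R ->
  exists2 d : R, (0 < d)%R & forall y, (enorm y < d)%R -> shift_diff F y <= e%:E.

Lemma measurable_shift_diff (F : V -> R) y : measurable_fun setT F ->
  measurable_fun setT (fun x : V => (`|F (x + y)%R - F x|)%:E : \bar R).
Proof.
move=> mF; apply/measurable_EFinP; apply: measurableT_comp => //.
by apply: measurable_funB => //; exact: measurable_shift.
Qed.

Lemma shift_diffD (F G : V -> R) y : measurable_fun setT F -> measurable_fun setT G ->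
  shift_diff (F \+ G)%R y <= shift_diff F y + shift_diff G y.
Proof.
move=> mF mG; rewrite /shift_diff -ge0_integralD//.
- apply: ge0_le_integral => //.
  + by apply: measurable_shift_diff; exact: measurable_funD.
  + by apply: emeasurable_funD; exact: measurable_shift_diff.
  + move=> x _; rewrite -EFinD lee_fin /=.
    by rewrite opprD addrACA ler_normD.
- exact: measurable_shift_diff.
- exact: measurable_shift_diff.
Qed.

Lemma shift_continuousD (F G : V -> R) : measurable_fun setT F -> measurable_fun setT G ->
  shift_continuous F -> shift_continuous G -> shift_continuous (F \+ G)%R.
Proof.
move=> mF mG cF cG e e0; have e2 : (0 < e / 2)%R by rewrite divr_gt0.
have [d d0 dP] := cF _ e2; have [d' d'0 dP'] := cG _ e2.
exists (minr d d'); first by rewrite lt_min d0.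
move=> y; rewrite lt_min => /andP[yd yd'].
apply: le_trans (shift_diffD _ mF mG) _.
by rewrite [e]splitr EFinD leeD// ?dP// dP'.
Qed.

Lemma shift_continuousZ (c : R) (F : V -> R) : measurable_fun setT F ->
  shift_continuous F -> shift_continuous (fun x => c * F x)%R.
Proof.
move=> mF cF e e0.
have e1 : (0 < e / (`|c| + 1))%R by rewrite divr_gt0// ltr_wpDl.
have [d d0 dP] := cF _ e1; exists d => // y yd; rewrite /shift_diff.
apply: (@le_trans _ _ (`|c|%:E * shift_diff F y)).
  rewrite -ge0_integralZl//; last exact: measurable_shift_diff.
  rewrite le_eqVlt; apply/orP; left; apply/eqP; apply: eq_integral => x _.
  by rewrite -EFinM -normrM mulrBr.
apply: (@le_trans _ _ (`|c|%:E * (e / (`|c| + 1))%:E)).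
  by rewrite lee_wpmul2l ?lee_fin// dP.
rewrite -EFinM lee_fin mulrA ler_pdivrMr ?ltr_wpDl// mulrC ler_wpM2l ?(ltW e0)//.
by rewrite lerDl.
Qed.

Lemma shift_continuous_approx (F : V -> R) : measurable_fun setT F ->
  (forall e : R, (0 < e)%R -> exists G : V -> R, [/\ measurable_fun setT G,
     shift_continuous G & \int[L]_x (`|F x - G x|)%:E <= e%:E]) ->
  shift_continuous F.
Proof.
move=> mF FG e e0; have e3 : (0 < e / 3)%R by rewrite divr_gt0.
have [G [mG cG FGe]] := FG _ e3; have [d d0 dP] := cG _ e3.
exists d => // y yd.
have mD : measurable_fun setT (fun x : V => (`|F x - G x|)%:E : \bar R).
  by apply/measurable_EFinP; apply: measurableT_comp => //; exact: measurable_funB.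
have mDy : measurable_fun setT (fun x : V => (`|F (x + y)%R - G (x + y)%R|)%:E : \bar R).
  exact: (measurable_shift y mD).
have mGd := measurable_shift_diff y mG.
apply: (@le_trans _ _ (\int[L]_x ((`|F (x + y)%R - G (x + y)%R|)%:E +
    ((`|G (x + y)%R - G x|)%:E + (`|F x - G x|)%:E)))).
  apply: ge0_le_integral => //.
  - exact: measurable_shift_diff.
  - by apply: emeasurable_funD => //; exact: emeasurable_funD.
  - move=> x _; rewrite -!EFinD lee_fin (distrC (F x)).
    have -> : (F (x + y)%R - F x = (F (x + y)%R - G (x + y)%R) + ((G (x + y)%R - G x) + (G x - F x)))%R by ring.
    by apply: le_trans (ler_normD _ _) _; rewrite lerD2l ler_normD.
rewrite ge0_integralD//; last 2 first.
- by move=> x _; rewrite -EFinD lee_fin addr_ge0.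
- exact: emeasurable_funD.
rewrite ge0_integralD//.
have -> : e%:E = (e / 3)%:E + ((e / 3)%:E + (e / 3)%:E).
  by rewrite -!EFinD; congr EFin; field.
rewrite leeD// ?leeD// ?dP//.
by rewrite (integral_shift y mD).
Qed.

Lemma shift_continuous_indic (A : set V) r : (0 <= r)%R -> measurable A -> A `<=` cube r ->
  shift_continuous (\1_A).
Proof.
move=> r0 mA Ar e e0; have r1 : (0 <= r + 1)%R by rewrite addr_ge0.
have [d d0 dP] := (local_shift_borel mA).2 _ _ r1 e0.
exists (minr d 1%R); first by rewrite lt_min d0/=.
move=> y; rewrite lt_min => /andP[yd y1].
apply: le_trans (dP y yd); rewrite /shift_diff [leRHS]integral_mkcond.
rewrite le_eqVlt; apply/orP; left; apply/eqP; apply: eq_integral => x _.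
rewrite patchE; case: ifPn => // xr; rewrite !indicE !memNset ?subrr ?normr0//.
- by move=> /Ar xr'; move: xr; rewrite notin_setE; apply => i; apply: lt_le_trans (xr' i) _; rewrite lerDl.
- move=> /Ar xr'; move: xr; rewrite notin_setE; apply => i.
  have -> : x ord0 i = ((x + y)%R ord0 i - y ord0 i)%R by rewrite mxE addrK.
  apply: le_lt_trans (ler_normB _ _) _; apply: ltrD; first exact: xr'.
  by apply: le_lt_trans y1; exact: coord_le_enorm.
Qed.

Lemma shift_continuous_sum I (s : seq I) (F : I -> V -> R) :
  (forall i, measurable_fun setT (F i)) -> (forall i, shift_continuous (F i)) ->
  shift_continuous (fun x => \sum_(i <- s) F i x)%R.
Proof.
move=> mF cF; elim: s => [|i s IH].
  move=> e e0; exists 1%R => // y _; rewrite /shift_diff integral0_eq ?lee_fin ?(ltW e0)// => x _.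
  by rewrite !big_nil subrr normr0.
rewrite (_ : (fun x => _) = (F i \+ (fun x => \sum_(i <- s) F i x))%R); last first.
  by apply/funext => x; rewrite big_cons.
by apply: shift_continuousD => //; exact: measurable_sum.
Qed.

Import HBNNSimple.

Lemma shift_continuous_simple (g : {nnsfun V >-> R}) r : (0 <= r)%R ->
  shift_continuous (fun x => g x * \1_(cube r) x)%R.
Proof.
move=> r0; have [s gE] : exists s : seq R,
    forall x, g x = (\sum_(i <- s) i * \1_(g @^-1` [set i]) x)%R.
  by eexists => x; rewrite {1}fimfunE fsbig_finite.
have -> : (fun x => g x * \1_(cube r) x)%R =
    (fun x => \sum_(i <- s) i * \1_(g @^-1` [set i] `&` cube r) x)%R.
  apply/funext => x; rewrite gE mulr_suml; apply: eq_bigr => i _.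
  by rewrite -mulrA indicI.
have mA i : measurable (g @^-1` [set i] `&` cube r).
  apply: measurableI; last exact: measurable_cube.
  by rewrite -[X in measurable X]setTI; exact: measurable_funP.
apply: shift_continuous_sum => i.
  by apply: measurable_funM => //; exact: measurable_indic.
apply: shift_continuousZ; first exact: measurable_indic.
by apply: (@shift_continuous_indic _ r) => //; exact: subIsetr.
Qed.

(** F is the limit in L^1 of simple functions supported in cubes, which increase
to it. *)
Lemma integrable_shift_continuous (F : V -> R) : measurable_fun setT F ->
  (forall x, 0 <= F x)%R -> \int[L]_x (F x)%:E < +oo -> shift_continuous F.
Proof.
move=> mF F0 Foo; apply: shift_continuous_approx => // e e0.
have mEF : measurable_fun setT (EFin \o F) by exact/measurable_EFinP.
pose g := nnsfun_approx measurableT mEF.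
have ndg : nondecreasing_seq (g : (V -> R)^nat) by exact: nd_nnsfun_approx.
pose h (k : nat) (x : V) : R := (g k x * \1_(cube k%:R) x)%R.
have h0 k x : (0 <= h k x)%R by rewrite mulr_ge0.
have mh k : measurable_fun setT (h k).
  by apply: measurable_funM => //; apply: measurable_indic; exact: measurable_cube.
have mEh k : measurable_fun setT (EFin \o h k) by exact/measurable_EFinP.
have ndh x : {homo (fun k => (h k x)%:E) : a b / (a <= b)%N >-> a <= b}.
  move=> a b ab; rewrite lee_fin; apply: ler_pM => //.
    by have /lefP := ndg _ _ ab; exact.
  rewrite !indicE ler_nat; case: (boolP (x \in cube a%:R)) => //; rewrite inE => xa.
  rewrite mem_set// => i; apply: lt_le_trans (xa i) _; by rewrite ler_nat.
have hF x : (h k x)%:E @[k --> \oo] --> (F x)%:E.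
  have gF : (g k x)%:E @[k --> \oo] --> (F x)%:E.
    by apply: (cvg_nnsfun_approx measurableT mEF) => // z _; rewrite lee_fin.
  apply: cvg_trans gF; apply: near_eq_cvg.
  have [N xN] : exists N : nat, (enorm x < N%:R)%R.
    exists (truncn (enorm x)).+1; rewrite truncnS_gt//.
  near=> k; congr EFin; rewrite /h indicE mem_set ?mulr1// => i.
  apply: le_lt_trans (coord_le_enorm _ _) _; apply: lt_le_trans xN _.
  by rewrite ler_nat; near: k; exists N.
have limF x : limn (fun k => (h k x)%:E) = (F x)%:E by apply/cvg_lim => //; exact: hF.
have := @cvg_monotone_convergence _ _ _ L setT measurableT (fun k => EFin \o h k)
  (fun k => mEh k) (fun k x _ => (h0 k x : 0 <= (h k x)%:E)) (fun x _ => ndh x).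
under [in X in _ --> X -> _]eq_integral do rewrite /= limF.
have Ffin : \int[L]_x (F x)%:E \is a fin_num.
  by rewrite ge0_fin_numE// integral_ge0// => x _; rewrite lee_fin.
rewrite -(fineK Ffin) => /fine_cvgP[hfin /cvgrPdist_lt/(_ _ e0)[N1 _ hN1]].
case: hfin => N0 _ hN0; pose N := maxn N0 N1; exists (h N).
have fN := hN0 N (leq_maxl _ _); have := hN1 N (leq_maxr _ _) => /=.
move: fN => /= fN dN.
have hF' x : (h N x <= F x)%R.
  rewrite -lee_fin -limF (cvg_lim _ (ereal_nondecreasing_cvgn (ndh x)))//.
  by apply: ereal_sup_ubound; exists N.
split => //; first exact: shift_continuous_simple.
have mD : measurable_fun setT (fun x : V => (`|F x - h N x|)%:E : \bar R).
  by apply/measurable_EFinP; apply: measurableT_comp => //; exact: measurable_funB.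
have FE : \int[L]_x (F x)%:E = \int[L]_x (h N x)%:E + \int[L]_x (`|F x - h N x|)%:E.
  rewrite -ge0_integralD//; [|by move=> x _; rewrite lee_fin|exact: mEh].
  apply: eq_integral => x _.
  by rewrite -EFinD ger0_norm ?subr_ge0// addrC subrK.
have Xfin : \int[L]_x (`|F x - h N x|)%:E \is a fin_num.
  rewrite ge0_fin_numE ?integral_ge0//; apply: le_lt_trans Foo; rewrite FE leeDr//.
  by apply: integral_ge0 => x _; rewrite lee_fin.
rewrite -(fineK Xfin) lee_fin; move: dN; rewrite FE fineD// addrAC subrr add0r => dN.
by apply: le_trans (ltW dN); exact: ler_norm.
Unshelve. all: by end_near. Qed.

End shift_functions.

Section powR_inequalities.
Context {R : realType} (p : R).
Hypothesis p1 : 1 <= p.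

Let p0 : 0 < p. Proof. exact: lt_le_trans p1. Qed.

Lemma ler_powR2r (a b : R) : 0 <= a -> a <= b -> a `^ p <= b `^ p.
Proof.
by move=> a0 ab; apply: ge0_ler_powR; rewrite ?nnegrE ?(ltW p0)// (le_trans a0).
Qed.

Lemma powR_superadditive (a b : R) : 0 <= a -> 0 <= b -> a `^ p + b `^ p <= (a + b) `^ p.
Proof.
move=> a0 b0; rewrite -(mulr_powRB1 a0 p0) -(mulr_powRB1 b0 p0) -(mulr_powRB1 (addr_ge0 a0 b0) p0) mulrDl.
have q0 : 0 <= p - 1 by rewrite subr_ge0.
have ab0 : 0 <= a + b by exact: addr_ge0.
have mon (x : R) : 0 <= x -> x <= a + b -> x `^ (p - 1) <= (a + b) `^ (p - 1).
  by move=> x0 xab; apply: ge0_ler_powR.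
by apply: lerD; apply: ler_wpM2l => //; apply: mon; rewrite ?lerDl ?lerDr.
Qed.

(** Through this inequality continuity of translations in L^p follows from that in
L^1 applied to the p-th power. *)
Lemma powR_dist_le (a b : R) : 0 <= a -> 0 <= b -> `|a - b| `^ p <= `|a `^ p - b `^ p|.
Proof.
wlog ba : a b / b <= a.
  move=> H a0 b0; have [ba|/ltW ab] := leP b a; first by apply: H.
  by rewrite distrC (distrC (a `^ p)); exact: H.
move=> a0 b0; rewrite !ger0_norm ?subr_ge0//; last exact: ler_powR2r.
rewrite lerBrDr; have := @powR_superadditive (a - b) b.
by rewrite subr_ge0 subrK; exact.
Qed.

(** Each term is at most the p-th root of the sum of the p-th powers. *)
Lemma powR_sum_le I (s : seq I) (a : I -> R) : (forall i, 0 <= a i) ->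
  (\sum_(i <- s) a i) `^ p <= (size s)%:R `^ p * \sum_(i <- s) a i `^ p.
Proof.
move=> a0; pose A := (\sum_(i <- s) a i `^ p) `^ p^-1.
have S0 : 0 <= \sum_(i <- s) a i `^ p by apply: sumr_ge0 => i _; exact: powR_ge0.
have AE : A `^ p = \sum_(i <- s) a i `^ p.
  by rewrite /A -powRrM mulVf ?gt_eqF// powRr1.
rewrite -AE -powRM ?powR_ge0//; apply: ler_powR2r; first exact: sumr_ge0.
rewrite /A; elim: s {A AE S0} => [|i s IH]; first by rewrite !big_nil mul0r.
rewrite !big_cons /= -addn1 natrD mulrDl addrC mul1r.
have S0 : 0 <= \sum_(j <- s) a j `^ p by apply: sumr_ge0 => j _; exact: powR_ge0.
have mon (u v : R) : 0 <= u -> u <= v -> u `^ p^-1 <= v `^ p^-1.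
  move=> u0 uv; apply: ge0_ler_powR; rewrite ?nnegrE ?invr_ge0 ?(ltW p0)//.
  exact: le_trans uv.
apply: lerD.
  apply: le_trans IH _; rewrite ler_wpM2l//; apply: mon => //.
  by rewrite lerDr powR_ge0.
rewrite -[a i in leLHS]powRr1// -[X in _ `^ X](mulfV (lt0r_neq0 p0)) powRrM.
by apply: mon; [exact: powR_ge0|rewrite lerDl].
Qed.

End powR_inequalities.

Section Lp_shift.
Local Open Scope ereal_scope.
Context {R : realType} {n : nat} (p : R).
Hypothesis p1 : (1 <= p)%R.
Local Notation V := 'rV[R]_n.
Local Notation L := (@lebesgue_rV R n).

Let p0 : (0 < p)%R. Proof. exact: lt_le_trans p1. Qed.

Lemma measurable_normr_powR d (T : measurableType d) (f : T -> R) : measurable_fun setT f ->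
  measurable_fun setT (fun x => (`|f x| `^ p)%:E).
Proof.
move=> mf; apply/measurable_EFinP; apply: measurableT_comp (measurable_powR _) _.
exact: measurableT_comp.
Qed.

Lemma nneg_Lp_shift (f : V -> R) (e : R) : measurable_fun setT f -> (forall x, 0 <= f x)%R ->
  \int[L]_x (f x `^ p)%:E < +oo -> (0 < e)%R -> exists2 d : R, (0 < d)%R &
  forall y, (enorm y < d)%R -> \int[L]_x (`|f (x + y)%R - f x| `^ p)%:E <= e%:E.
Proof.
move=> mf f0 foo e0.
have mfp : measurable_fun setT (fun x => f x `^ p)%R.
  exact: measurableT_comp (measurable_powR _) mf.
have [|d d0 dP] := integrable_shift_continuous mfp _ foo e0.
  by move=> x; exact: powR_ge0.
exists d => // y /dP; apply: le_trans; apply: ge0_le_integral => //.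
- by apply: measurable_normr_powR; apply: measurable_funB => //; exact: measurable_shift.
- exact: measurable_shift_diff.
- by move=> x _; rewrite lee_fin powR_dist_le.
Qed.

(** The positive and negative parts are translated separately. *)
Lemma Lp_shift (f : V -> R) (e : R) : measurable_fun setT f ->
  \int[L]_x (`|f x| `^ p)%:E < +oo -> (0 < e)%R -> exists2 d : R, (0 < d)%R &
  forall y, (enorm y < d)%R -> \int[L]_x (`|f (x + y)%R - f x| `^ p)%:E <= e%:E.
Proof.
move=> mf foo e0.
pose g (b : bool) (x : V) : R := Num.max ((-1) ^+ b * f x)%R 0%R.
have mg b : measurable_fun setT (g b).
  by apply: measurable_maxr => //; exact: measurable_funM.
have g0 b x : (0 <= g b x)%R by rewrite /g le_max lexx orbT.
have gf b x : (g b x <= `|f x|)%R.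
  by rewrite /g ge_max normr_ge0 andbT; case: b; rewrite ?expr1 ?expr0 ?mulN1r ?mul1r ?ler_norm// -normrN ler_norm.
have fE x : f x = (g false x - g true x)%R.
  rewrite /g expr0 expr1 mul1r mulN1r; have [fx|fx] := leP 0%R (f x).
    by rewrite (max_idPr _) ?oppr_le0// subr0.
  by rewrite (max_idPl _) ?oppr_ge0 ?(ltW fx)// sub0r opprK.
have goo b : \int[L]_x (g b x `^ p)%:E < +oo.
  apply: le_lt_trans foo; apply: ge0_le_integral => //.
  - by move=> x _; rewrite lee_fin powR_ge0.
  - by apply/measurable_EFinP; apply: measurableT_comp (measurable_powR _) _; exact: mg.
  - exact: measurable_normr_powR.
  - by move=> x _; rewrite lee_fin ler_powR2r.
have [K KE] : exists K : R, K = (2 `^ p * 2)%R by eexists.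
have K0 : (0 < K)%R by rewrite KE mulr_gt0// powR_gt0.
have eK : (0 < e / K)%R by rewrite divr_gt0.
have [d1 d10 d1P] := nneg_Lp_shift (mg true) (g0 true) (goo true) eK.
have [d2 d20 d2P] := nneg_Lp_shift (mg false) (g0 false) (goo false) eK.
exists (minr d1 d2); first by rewrite lt_min d10.
move=> y; rewrite lt_min => /andP[/d1P y1 /d2P y2].
pose D b x := `|g b (x + y)%R - g b x|%R.
have mD b : measurable_fun setT (fun x => (D b x `^ p)%:E).
  apply: measurable_normr_powR; apply: measurable_funB => //.
  exact: (measurable_shift y (mg b)).
apply: (@le_trans _ _ (\int[L]_x ((2 `^ p)%:E * ((D true x `^ p)%:E + (D false x `^ p)%:E)))).
  apply: ge0_le_integral => //.
  - by apply: measurable_normr_powR; apply: measurable_funB => //; exact: measurable_shift.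
  - by apply: measurable_funeM; exact: emeasurable_funD.
  - move=> x _; rewrite -EFinD -EFinM lee_fin.
    have := @powR_sum_le R p p1 bool [:: true; false] (D ^~ x) (fun b => normr_ge0 _).
    rewrite /= !big_cons !big_nil !addr0; apply: le_trans.
    apply: ler_powR2r => //; rewrite /D !fE.
    rewrite (_ : (_ - _)%R = ((g false (x + y)%R - g false x) - (g true (x + y)%R - g true x))%R); last by ring.
    by rewrite [leRHS]addrC; exact: ler_normB.
rewrite ge0_integralZl//; last 2 first.
- exact: emeasurable_funD.
- by move=> x _; rewrite -EFinD lee_fin addr_ge0// powR_ge0.
rewrite ge0_integralD//; [|by move=> x _; rewrite lee_fin powR_ge0..].
apply: (@le_trans _ _ ((2 `^ p)%:E * ((e / K)%:E + (e / K)%:E))).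
  have P0 : 0 <= (2 `^ p)%:E :> \bar R by rewrite lee_fin powR_ge0.
  exact: (lee_wpmul2l P0 (leeD y1 y2)).
rewrite -EFinD -EFinM lee_fin KE le_eqVlt; apply/orP; left; apply/eqP.
by field; rewrite gt_eqF// powR_gt0.
Qed.

(** The coefficients of a form are translated together, one modulus serving all. *)
Lemma family_shift (I : finType) (w : V -> I -> R) (e : R) :
  (forall i, measurable_fun setT (fun x => w x i)) ->
  (forall i, \int[L]_x (`|w x i| `^ p)%:E < +oo) -> (0 < e)%R ->
  exists2 d : R, (0 < d)%R & forall y, (enorm y < d)%R ->
  \int[L]_x ((\sum_i `|w (x + y)%R i - w x i|) `^ p)%:E <= e%:E.
Proof.
move=> mw woo e0; pose M : R := ((size (index_enum I))%:R `^ p)%R.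
have M0 : (0 <= M)%R by exact: powR_ge0.
pose e' : R := (e / (M * (size (index_enum I))%:R + 1))%R.
have K0 : (0 < M * (size (index_enum I))%:R + 1)%R by rewrite ltr_wpDl// mulr_ge0.
have e'0 : (0 < e')%R by rewrite divr_gt0.
have /choice[d dP] : forall i, exists d : R, (0 < d)%R /\ forall y, (enorm y < d)%R ->
    \int[L]_x (`|w (x + y)%R i - w x i| `^ p)%:E <= e'%:E.
  by move=> i; have [d d0 dP] := Lp_shift (mw i) (woo i) e'0; exists d.
have [D D0 DP] : exists2 D : R, (0 < D)%R & forall i, (D <= d i)%R.
  exists (\big[minr/1%R]_i d i); last by move=> i; exact: bigmin_le_cond.
  by apply: (big_ind (fun a : R => (0 < a)%R)) => // [a b a0 b0|i _]; [rewrite lt_min a0|exact: (dP i).1].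
exists D => // y yD.
have mD i : measurable_fun setT (fun x : V => (`|w (x + y)%R i - w x i| `^ p)%:E).
  apply: measurable_normr_powR; apply: measurable_funB => //.
  exact: (measurable_shift y (mw i)).
apply: (@le_trans _ _ (\int[L]_x (M%:E * \sum_i (`|w (x + y)%R i - w x i| `^ p)%:E))).
  apply: ge0_le_integral => //.
  - by move=> x _; rewrite lee_fin powR_ge0.
  - apply/measurable_EFinP; apply: measurableT_comp (measurable_powR _) _.
    apply: measurable_sum => i; apply: measurableT_comp => //; apply: measurable_funB => //.
    exact: (measurable_shift y (mw i)).
  - by apply: measurable_funeM; exact: emeasurable_sum.
  - by move=> x _; rewrite sumEFin -EFinM lee_fin; apply: powR_sum_le.
rewrite ge0_integralZl//; last 2 first.
- exact: emeasurable_sum.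
- by move=> x _; apply: sume_ge0 => i _; rewrite lee_fin powR_ge0.
rewrite ge0_integral_sum//.
apply: (@le_trans _ _ (M%:E * \sum_(i : I) e'%:E)).
  rewrite lee_wpmul2l ?lee_fin//; apply: lee_sum => i _.
  by apply: (dP i).2; exact: lt_le_trans (DP i).
rewrite sumEFin -EFinM lee_fin big_const_seq count_predT iter_addr_0 -mulr_natr.
rewrite /e' mulrCA mulrAC -mulrA ler_piMr ?(ltW e0)//.
by rewrite ler_pdivrMr// mul1r lerDl.
Qed.

End Lp_shift.
(** * Averages over the simplex *)

Section powR_perturbation.
Context {R : realType} (p : R).
Hypothesis p1 : 1 <= p.

Let p0 : 0 < p. Proof. exact: lt_le_trans p1. Qed.

(** The p-th power lies above its tangent line at m: this is the inequality of Young. *)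
Lemma young_powR (a m : R) : 0 <= a -> 0 <= m ->
  p * (m `^ (p - 1) * a) <= a `^ p + (p - 1) * m `^ p.
Proof.
move=> a0 m0; have [->|pn1] := eqVneq p 1.
  by rewrite subrr powRr0 !mul1r mul0r addr0 powRr1.
have p10 : 0 < p - 1 by rewrite subr_gt0 lt_neqAle eq_sym pn1.
have q0 : 0 < p / (p - 1) by rewrite divr_gt0.
have pq : p^-1 + (p / (p - 1))^-1 = 1.
  by rewrite invf_div; field; rewrite !gt_eqF.
have := conjugate_powR a0 (powR_ge0 m (p - 1)) p0 q0 pq.
rewrite -powRrM mulrCA mulfV ?gt_eqF// mulr1 invf_div => /(ler_wpM2l (ltW p0)).
rewrite (mulrC a); move/le_trans; apply.
by rewrite le_eqVlt; apply/orP; left; apply/eqP; field; rewrite gt_eqF.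
Qed.

(** Either v is small compared with u, and u + v is close to u, or u is bounded by
a multiple of v. *)
Lemma powR_perturb (lam : R) : 1 < lam -> exists2 C : R, 0 < C &
  forall u v : R, 0 <= u -> 0 <= v -> (u + v) `^ p <= lam * u `^ p + C * v `^ p.
Proof.
move=> lam1; have lam0 : 0 < lam by exact: lt_trans lam1.
pose tau := lam `^ p^-1 - 1.
have tau0 : 0 < tau.
  rewrite subr_gt0; have := @gt0_ltr_powR R p^-1; rewrite invr_gt0 p0 => /(_ isT 1 lam).
  by rewrite powR1; apply; rewrite ?nnegrE// ltW.
have tauE : (1 + tau) `^ p = lam.
  by rewrite /tau addrC subrK -powRrM mulVf ?gt_eqF// powRr1// ltW.
have C0 : 0 < 1 + tau^-1 by rewrite ltr_wpDl// invr_gt0.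
exists ((1 + tau^-1) `^ p); first exact: powR_gt0.
move=> u v u0 v0; have [vu|uv] := leP v (tau * u).
  apply: (@le_trans _ _ (((1 + tau) * u) `^ p)).
    by apply: ler_powR2r => //; [exact: addr_ge0|rewrite mulrDl mul1r lerD2l].
  have t10 : 0 <= 1 + tau by rewrite addr_ge0// ltW.
  by rewrite (powRM _ t10 u0) tauE lerDl mulr_ge0 ?powR_ge0.
apply: (@le_trans _ _ (((1 + tau^-1) * v) `^ p)).
  apply: ler_powR2r => //; first exact: addr_ge0.
  rewrite mulrDl mul1r addrC lerD2l mulrC ler_pdivlMr// mulrC; exact: ltW.
by rewrite powRM ?(ltW C0)// lerDr mulr_ge0 ?powR_ge0// ltW.
Qed.

End powR_perturbation.

Section averages.
Local Open Scope ereal_scope.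
Context d (S : measurableType d) (R : realType) (nu : {measure set S -> \bar R}).
Variables (p D : R).
Hypotheses (p1 : (1 <= p)%R) (D0 : (0 < D)%R) (nuT : nu setT = D%:E).

Let p0 : (0 < p)%R. Proof. exact: lt_le_trans p1. Qed.

(** The inequality of Jensen, by integrating the tangent line at the mean of f. *)
Lemma integral_powR_mean (f : S -> R) : measurable_fun setT f -> (forall s, 0 <= f s)%R ->
  \int[nu]_s (f s `^ p)%:E < +oo -> \int[nu]_s (f s)%:E < +oo /\
  ((\int[nu]_s f s)%R `^ p)%:E <= (D `^ (p - 1))%:E * \int[nu]_s (f s `^ p)%:E.
Proof.
move=> mf f0 foo.
have mEf : measurable_fun setT (EFin \o f) by exact/measurable_EFinP.
have mfp : measurable_fun setT (fun s => (f s `^ p)%:E).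
  by apply/measurable_EFinP; apply: measurableT_comp (measurable_powR _) _.
have fp0 s : 0 <= (f s `^ p)%:E by rewrite lee_fin powR_ge0.
have fE s : 0 <= (f s)%:E by rewrite lee_fin.
have foo1 : \int[nu]_s (f s)%:E < +oo.
  apply: (@le_lt_trans _ _ (\int[nu]_s (1 + (f s `^ p)%:E))).
    apply: ge0_le_integral => //.
    - by apply: emeasurable_funD.
    - move=> s _; rewrite -EFinD lee_fin; have [f1|/ltW f1] := leP (f s) 1%R.
        by apply: le_trans f1 _; rewrite lerDl powR_ge0.
      by apply: le_trans (le1r_powR f1 p1) _; rewrite lerDr.
  rewrite ge0_integralD// integral_cst// mul1e nuT.
  by rewrite lte_add_pinfty// ltry.
split=> //; set M : R := (\int[nu]_s f s)%R.
have ME : \int[nu]_s (f s)%:E = M%:E.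
  by rewrite /M /Rintegral fineK// ge0_fin_numE ?integral_ge0.
have M0 : (0 <= M)%R by rewrite -lee_fin -ME integral_ge0.
pose m : R := (M / D)%R; have m0 : (0 <= m)%R by rewrite divr_ge0// ltW.
have key : (p * m `^ (p - 1))%:E * M%:E <= \int[nu]_s (f s `^ p)%:E + ((p - 1) * m `^ p * D)%:E.
  rewrite -ME -ge0_integralZl//; last by rewrite lee_fin mulr_ge0 ?powR_ge0// ltW.
  have c0 : 0 <= ((p - 1) * m `^ p)%:E by rewrite lee_fin mulr_ge0 ?powR_ge0// subr_ge0.
  rewrite [X in _ <= _ + X]EFinM -nuT -integral_cst// -ge0_integralD//.
  apply: ge0_le_integral => //.
  - by move=> s _; rewrite mule_ge0// lee_fin mulr_ge0 ?powR_ge0// ltW.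
  - exact: measurable_funeM.
  - exact: emeasurable_funD.
  - by move=> s _; rewrite -EFinM -EFinD lee_fin -mulrA young_powR.
have mpE : (m `^ (p - 1) * M = m `^ p * D)%R.
  rewrite -(mulr_powRB1 m0 p0) (mulrC m) -mulrA; congr (_ * _)%R.
  by rewrite /m divfK// gt_eqF.
have Ifin : \int[nu]_s (f s `^ p)%:E \is a fin_num by rewrite ge0_fin_numE ?integral_ge0.
move: key; rewrite -(fineK Ifin) -!EFinM -EFinD !lee_fin -!mulrA mpE.
move=> key; have {}key : (m `^ p * D <= fine (\int[nu]_s (f s `^ p)%:E))%R by lra.
rewrite (_ : M `^ p = D `^ (p - 1) * (m `^ p * D))%R ?ler_wpM2l ?powR_ge0//.
rewrite mulrCA (mulrC _ D) (mulr_powRB1 (ltW D0) p0) -powRM ?(ltW D0)//.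
by rewrite /m divfK// gt_eqF.
Qed.

(** Jensen for the deviation from a constant: a = 0 serves the upper bound, a equal to
the value at the base point the oscillation. An infinite right side
makes the inequality trivial, a finite one makes g integrable. *)
Lemma Rintegral_powR_le (g : S -> R) (a : R) : measurable_fun setT g ->
  (`|\int[nu]_s g s - a * D| `^ p)%:E <=
  (D `^ (p - 1))%:E * \int[nu]_s (`|g s - a| `^ p)%:E.
Proof.
move=> mg; have mf : measurable_fun setT (fun s => g s - a)%R by exact: measurable_funB.
have [foo|] := ltP (\int[nu]_s (`|g s - a| `^ p)%:E) +oo; last first.
  by rewrite leye_eq => /eqP ->; rewrite gt0_muley ?leey// lte_fin powR_gt0.
have mnf : measurable_fun setT (fun s => `|g s - a|)%R by exact: measurableT_comp.
have [f1 fP] := integral_powR_mean mnf (fun s => normr_ge0 _) foo.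
apply: le_trans fP; rewrite lee_fin; apply: ler_powR2r => //.
have ia : nu.-integrable setT (EFin \o (fun=> a)).
  apply/integrableP; split; first exact: measurable_cst.
  by rewrite /= integral_cst// nuT ltry.
have ifa : nu.-integrable setT (EFin \o (fun s => g s - a)%R).
  by apply/integrableP; split => //; exact/measurable_EFinP.
have ig : nu.-integrable setT (EFin \o g).
  have := integrableD measurableT ifa ia; apply: eq_integrable => // s _ /=.
  by rewrite -EFinD subrK.
have -> : (\int[nu]_s g s - a * D = \int[nu]_s (g s - a))%R.
  by rewrite RintegralB// Rintegral_cst// nuT.
exact: le_normr_Rintegral.
Qed.

End averages.

Section simplex.
Local Open Scope ereal_scope.
Context {R : realType} {k : nat}.
Local Notation W := 'rV[R]_k.
Local Notation L := (@lebesgue_rV R k).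
Local Notation Delta := (@std_simplex R k).

Lemma measurable_std_simplex : measurable Delta.
Proof.
rewrite (_ : Delta = [set s : W | forall i, (`[0%R, +oo[%classic : set R) (s ord0 i)] `&`
    ((fun s : W => \sum_i s ord0 i)%R @^-1` `]-oo, 1%R])).
  apply: measurableI; first by apply: (@measurable_rV_box R k (fun=> `[0%R, +oo[%classic)).
  rewrite -[X in measurable X]setTI.
  have : measurable_fun setT (fun s : W => \sum_i s ord0 i : measurableTypeR R)%R.
    by apply: measurable_sum => i; exact: measurable_rV_coord.
  by apply.
apply/seteqP; split => [s [s0 s1]|s [s0 s1]]; split => /=.
- by move=> i; rewrite /= in_itv/= andbT.
- by rewrite in_itv/=.
- by move=> i; have := s0 i; rewrite /= in_itv/= andbT.
- by move: s1; rewrite /= in_itv/=.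
Qed.

Lemma simplex_lty : L Delta < +oo.
Proof.
apply: le_lt_trans (cube_lty (n := k) (2 : R)); apply: le_measure; rewrite ?inE.
- exact: measurable_std_simplex.
- exact: measurable_cube.
move=> s [s0 s1] i; rewrite ger0_norm//; apply: (@le_lt_trans _ _ 1%R); last by rewrite ltr1n.
by apply: le_trans s1; rewrite (bigD1 i)//= lerDl sumr_ge0.
Qed.

Lemma simplex_gt0 : 0 < L Delta.
Proof.
pose a : R := (k.+1%:R^-1)%R; have a0 : (0 < a)%R by rewrite invr_gt0.
pose box := [set s : W | forall i, (`]0%R, a[%classic : set R) (s ord0 i)].
have mbox : measurable box.
  by apply: (@measurable_rV_box R k (fun=> `]0%R, a[%classic)).
apply: (@lt_le_trans _ _ (L box)).
  rewrite (@lebesgue_rV_box R k (fun=> `]0%R, a[%classic))//.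
  rewrite (eq_bigr (fun=> a%:E)); last first.
    by move=> i _; rewrite lebesgue_measure_itv/= lte_fin a0 sube0.
  by rewrite prodEFin lte_fin prodr_gt0.
apply: le_measure; rewrite ?inE//; first exact: measurable_std_simplex.
move=> s sbox; split => [i|].
  by have := sbox i; rewrite /= in_itv/= => /andP[/ltW].
apply: (@le_trans _ _ (\sum_(i < k) a)%R).
  by apply: ler_sum => i _; have := sbox i; rewrite /= in_itv/= => /andP[_ /ltW].
rewrite sumr_const card_ord -mulr_natr /a mulrC ler_pdivrMr// mul1r.
by rewrite ler_nat.
Qed.

Definition simplex_volume : R := fine (L Delta).

Lemma simplex_volumeE : L Delta = simplex_volume%:E.
Proof. by rewrite fineK// ge0_fin_numE ?simplex_lty. Qed.

Lemma simplex_volume_gt0 : (0 < simplex_volume)%R.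
Proof. by rewrite -lte_fin -simplex_volumeE simplex_gt0. Qed.

Let msimplex_indic : measurable_fun setT (\1_Delta : W -> R).
Proof. by apply: measurable_indic; exact: measurable_std_simplex. Qed.

Let simplex_indic_ge0 (s : W) : (0 <= \1_Delta s :> R)%R.
Proof. by rewrite indicE. Qed.

Let simplex_density : {measure set W -> \bar R} :=
  density L msimplex_indic simplex_indic_ge0.

Let simplex_densityT : simplex_density setT = simplex_volume%:E.
Proof.
rewrite -simplex_volumeE -(integral_indic1 _ measurable_std_simplex).
by [].
Qed.

Let simplex_density_sf : sigma_finite setT simplex_density.
Proof. by apply: finite_sigma_finite; rewrite simplex_densityT ltry. Qed.

(** The restriction to the simplex as a measure on the whole space, so that Tonelli
can be used with it. *)
Definition simplex_measure : {sigma_finite_measure set W -> \bar R} :=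
  as_sigma_finite simplex_density_sf.

Lemma simplex_measureT : simplex_measure setT = simplex_volume%:E.
Proof. exact: simplex_densityT. Qed.

Lemma ge0_integral_simplex (g : W -> \bar R) : measurable_fun setT g -> (forall s, 0 <= g s) ->
  \int[simplex_measure]_s g s = \int[L]_(s in Delta) g s.
Proof.
move=> mg g0; rewrite [LHS](ge0_integral_density L msimplex_indic simplex_indic_ge0 mg g0).
rewrite [RHS]integral_mkcond; apply: eq_integral => s _; rewrite patchE indicE.
by case: ifP => _; rewrite ?mul1e ?mul0e.
Qed.

Lemma Rintegral_simplex (g : W -> R) : measurable_fun setT g ->
  (\int[simplex_measure]_s g s = \int[L]_(s in Delta) g s)%R.
Proof.
move=> mg; congr fine; rewrite [LHS]integralE [RHS]integralE.
have mEg : measurable_fun setT (EFin \o g) by exact/measurable_EFinP.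
congr (_ - _).
- by rewrite ge0_integral_simplex//; exact: measurable_funepos.
- by rewrite ge0_integral_simplex//; exact: measurable_funeneg.
Qed.

Lemma le_integral_simplex (f : W -> \bar R) (c : R) : measurable_fun setT f ->
  (forall s, 0 <= f s) -> (0 <= c)%R -> (forall s, Delta s -> f s <= c%:E) ->
  \int[simplex_measure]_s f s <= c%:E * simplex_volume%:E.
Proof.
move=> mf f0 c0 fc; rewrite ge0_integral_simplex// -simplex_volumeE.
rewrite -integral_cst; last exact: measurable_std_simplex.
apply: ge0_le_integral => //; first exact: measurable_std_simplex.
exact: measurable_funTS.
Qed.

End simplex.
Arguments simplex_volume : clear implicits.
Arguments simplex_measure : clear implicits.

Section chords.
Local Open Scope ereal_scope.
Context {R : realType} {n k : nat} (p : R).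
Hypotheses (p1 : (1 <= p)%R) (kn : (k <= n)%N).
Local Notation V := 'rV[R]_n.
Local Notation T := (k.-tuple V).
Local Notation L := (@lebesgue_rV R n).
Local Notation Lk := (tuple_measure L k).

(** In the applications P is the restriction of the Lebesgue measure to the simplex. *)
Variables (P : {sigma_finite_measure set 'rV[R]_k -> \bar R}) (D : R).
Hypotheses (D0 : (0 < D)%R) (PT : P setT = D%:E).
Hypothesis P_support : forall (f : 'rV[R]_k -> \bar R) (c : R), measurable_fun setT f ->
  (forall s, 0 <= f s) -> (0 <= c)%R -> (forall s, std_simplex s -> f s <= c%:E) ->
  \int[P]_s f s <= c%:E * D%:E.

Let p0 : (0 < p)%R. Proof. exact: lt_le_trans p1. Qed.

Definition chord (s : 'rV[R]_k) (h : T) : V := (\sum_i s ord0 i *: tnth h i)%R.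

Lemma measurable_chord d (U : measurableType d) (s : U -> 'rV[R]_k) (h : U -> T) :
  measurable_fun setT s -> measurable_fun setT h ->
  measurable_fun setT (fun u => chord (s u) (h u)).
Proof.
move=> ms mh; apply: measurable_sumrV => i; apply: measurable_scalerV.
  exact: measurable_coord.
exact: measurableT_comp (measurable_tnth i) mh.
Qed.

Lemma chord_le (s : 'rV[R]_k) (h : T) (r : R) : std_simplex s ->
  (forall i, enorm (tnth h i) < r)%R -> (0 < r)%R -> (enorm (chord s h) <= r)%R.
Proof.
move=> [s0 s1] hr r0; apply: le_trans (enorm_sum _) _.
apply: (@le_trans _ _ (\sum_i s ord0 i * r)%R).
  apply: ler_sum => i _; rewrite enormZ ger0_norm// ler_wpM2l//; exact: ltW.
by rewrite -mulr_suml ler_piMl// ltW.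
Qed.

(** Tonelli: integrating the starting point first lets translation invariance act. *)
Lemma integral_chord_swap (W : T -> R) (Q : V * T -> 'rV[R]_k -> \bar R) :
  measurable_fun setT W -> (forall h, 0 <= W h)%R ->
  measurable_fun setT (fun u : (V * T) * 'rV[R]_k => Q u.1 u.2) -> (forall z s, 0 <= Q z s) ->
  \int[L]_x \int[Lk]_h ((W h)%:E * \int[P]_s Q (x, h) s) =
  \int[Lk]_h ((W h)%:E * \int[P]_s \int[L]_x Q (x, h) s).
Proof.
move=> mW W0 mQ Q0.
have mQz z : measurable_fun setT (Q z).
  exact: (measurableT_comp mQ (measurable_pair1 z)).
have mI : measurable_fun setT (fun z : V * T => \int[P]_s Q z s).
  exact: (measurable_fun_fubini_tonelli_F (m2 := P) (fun u => Q u.1 u.2) mQ (fun u => Q0 u.1 u.2)).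
have I0 z : 0 <= \int[P]_s Q z s by apply: integral_ge0.
pose F (z : V * T) := (W z.2)%:E * \int[P]_s Q z s.
have mF : measurable_fun setT F.
  apply: emeasurable_funM => //; apply/measurable_EFinP.
  exact: (measurableT_comp mW measurable_snd).
have F0 z : 0 <= F z by rewrite mule_ge0// lee_fin.
rewrite (fubini_tonelli (m1 := L) (m2 := Lk) F mF F0).
apply: eq_integral => h _; rewrite /F /=.
rewrite ge0_integralZl//; last 2 first.
- by apply: (measurableT_comp mI); exact: measurable_pair2.
- by rewrite lee_fin.
congr (_ * _).
pose G (u : V * 'rV[R]_k) := Q (u.1, h) u.2.
have mG : measurable_fun setT G.
  apply: (measurableT_comp mQ (_ : measurable_fun setT (fun u : V * 'rV[R]_k => ((u.1, h), u.2)))).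
  by apply: measurable_fun_pair => //; apply: measurable_fun_pair.
exact: (fubini_tonelli (m1 := L) (m2 := P) G mG (fun u => Q0 _ _)).
Qed.

Variable w : V -> kcovector R n k.
Hypothesis mw : forall I, measurable_fun setT (fun x => w x I).

Definition chord_integral (z : V * T) : R :=
  (\int[P]_s kcov_eval (w (z.1 + chord s z.2)) z.2)%R.

Let chord_form (u : (V * T) * 'rV[R]_k) : R := kcov_eval (w (u.1.1 + chord u.2 u.1.2)%R) u.1.2.

Let measurable_chord_point :
  measurable_fun setT (fun u : (V * T) * 'rV[R]_k => (u.1.1 + chord u.2 u.1.2)%R).
Proof.
have m1 : measurable_fun setT (fun u : (V * T) * 'rV[R]_k => u.1.1).
  exact: (measurableT_comp measurable_fst measurable_fst).
have m2 : measurable_fun setT (fun u : (V * T) * 'rV[R]_k => u.1.2).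
  exact: (measurableT_comp measurable_snd measurable_fst).
by apply: measurable_addrV => //; apply: measurable_chord.
Qed.

Let measurable_chord_form : measurable_fun setT chord_form.
Proof.
apply: measurable_kcov_eval => [I|].
  exact: (measurableT_comp (mw I) measurable_chord_point).
exact: (measurableT_comp measurable_snd measurable_fst).
Qed.

Let measurable_chord_form1 z : measurable_fun setT (fun s => chord_form (z, s)).
Proof. exact: (measurableT_comp measurable_chord_form (measurable_pair1 z)). Qed.

Lemma measurable_chord_integral : measurable_fun setT chord_integral.
Proof.
pose F (u : (V * T) * 'rV[R]_k) := (chord_form u)%:E.
have mF : measurable_fun setT F by exact/measurable_EFinP.
rewrite (_ : chord_integral = fine \o (fun z => \int[P]_s (F^\+ (z, s)) - \int[P]_s (F^\- (z, s)))); last first.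
  apply/funext => z; rewrite /chord_integral /Rintegral integralE; congr (fine (_ - _));
    by apply: eq_integral => s _; rewrite ?funeposE ?funenegE.
apply: measurableT_comp; first exact: fine_measurable.
apply: emeasurable_funB.
- exact: (measurable_fun_fubini_tonelli_F (m2 := P) F^\+ (measurable_funepos mF) (funepos_ge0 F)).
- exact: (measurable_fun_fubini_tonelli_F (m2 := P) F^\- (measurable_funeneg mF) (funeneg_ge0 F)).
Qed.

Lemma kcov_powR_ge0 (a : kcovector R n k) h : 0 <= (`|kcov_eval a h| `^ p)%:E.
Proof. by rewrite lee_fin powR_ge0. Qed.

Variables (theta r : R).
Hypotheses (t01 : (0 < theta < 1)%R) (r0 : (0 < r)%R).
Local Notation W := (@slot_weights R n k p theta r).
Local Notation sf := (slots_factor n k p theta r).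

Let mW : measurable_fun setT W. Proof. exact: measurable_slot_weights. Qed.
Let W0 h : (0 <= W h)%R. Proof. by apply: slot_weights_ge0; case/andP: t01. Qed.

Let D_pow : (D `^ (p - 1) * D = D `^ p)%R.
Proof. by rewrite mulrC mulr_powRB1// ltW. Qed.

Let integral_chord_le (f : V * T -> R) (I : V * T -> \bar R) :
  measurable_fun setT f -> measurable_fun setT I -> (forall z, 0 <= I z) ->
  (forall z, (`|f z| `^ p)%:E <= (D `^ (p - 1))%:E * I z) ->
  \int[L]_x \int[Lk]_h ((W h)%:E * (`|f (x, h)| `^ p)%:E) <=
  (D `^ (p - 1))%:E * \int[L]_x \int[Lk]_h ((W h)%:E * I (x, h)).
Proof.
move=> mf mI I0 fI.
have mW2 : measurable_fun setT (fun z : V * T => (W z.2)%:E).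
  by apply/measurable_EFinP; exact: (measurableT_comp mW measurable_snd).
have mF : measurable_fun setT (fun z : V * T => (W z.2)%:E * (`|f z| `^ p)%:E).
  by apply: emeasurable_funM => //; exact: measurable_normr_powR.
have F0 z : 0 <= (W z.2)%:E * (`|f z| `^ p)%:E by rewrite mule_ge0// lee_fin ?powR_ge0.
have mG : measurable_fun setT (fun z : V * T => (W z.2)%:E * I z) by exact: emeasurable_funM.
have G0 z : 0 <= (W z.2)%:E * I z by rewrite mule_ge0// lee_fin.
have c0 : 0 <= (D `^ (p - 1))%:E by rewrite lee_fin powR_ge0.
have mGx := measurable_fun_fubini_tonelli_F (m2 := Lk) _ mG G0.
have G0x x : 0 <= \int[Lk]_h ((W h)%:E * I (x, h)).
  by apply: integral_ge0 => h _; exact: (G0 (x, h)).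
rewrite -ge0_integralZl//; apply: ge0_le_integral => //.
- by move=> x _; apply: integral_ge0 => h _; exact: (F0 (x, h)).
- exact: (measurable_fun_fubini_tonelli_F (m2 := Lk) _ mF F0).
- exact: measurable_funeM.
move=> x _; rewrite -ge0_integralZl//; last 2 first.
- exact: (measurableT_comp mG (measurable_pair1 x)).
- by move=> h _; exact: (G0 (x, h)).
apply: ge0_le_integral => //.
- by move=> h _; exact: (F0 (x, h)).
- exact: (measurableT_comp mF (measurable_pair1 x)).
- by apply: measurable_funeM; exact: (measurableT_comp mG (measurable_pair1 x)).
- move=> h _; rewrite muleCA; apply: lee_wpmul2l; first by rewrite lee_fin.
  exact: fI.
Qed.

(** After Jensen the translation by the chord disappears when the base point is
integrated, and polar coordinates are used in every slot. *)
Lemma chord_integral_le :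
  \int[L]_x \int[Lk]_h ((W h)%:E * (`|chord_integral (x, h)| `^ p)%:E) <=
  (D `^ p * sf)%:E * \int[L]_x sphere_power p (w x).
Proof.
pose Q (z : V * T) s := (`|chord_form (z, s)| `^ p)%:E.
have mQ : measurable_fun setT (fun u : (V * T) * 'rV[R]_k => Q u.1 u.2).
  apply: (@measurable_normr_powR R p _ _ (fun u => chord_form (u.1, u.2))).
  rewrite (_ : (fun u => _) = chord_form)//; by apply/funext => -[].
have Q0 z s : 0 <= Q z s by rewrite lee_fin powR_ge0.
have mI : measurable_fun setT (fun z : V * T => \int[P]_s Q z s).
  exact: (measurable_fun_fubini_tonelli_F (m2 := P) (fun u => Q u.1 u.2) mQ (fun u => Q0 u.1 u.2)).
have I0 z : 0 <= \int[P]_s Q z s by apply: integral_ge0.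
apply: (le_trans (integral_chord_le measurable_chord_integral mI I0 _)).
  move=> z; have := Rintegral_powR_le p1 D0 PT 0 (measurable_chord_form1 z).
  rewrite mul0r subr0; under eq_integral do rewrite subr0.
  exact.
rewrite integral_chord_swap// -D_pow [in leRHS]EFinM [in leRHS]EFinM -!muleA.
rewrite lee_wpmul2l ?lee_fin ?powR_ge0//.
pose q (h : T) := \int[L]_x (`|kcov_eval (w x) h| `^ p)%:E.
pose K (z : V * T) := (`|kcov_eval (w z.1) z.2| `^ p)%:E.
have mK : measurable_fun setT K.
  by apply: measurable_kcov_eval_powR => // I; exact: (measurableT_comp (mw I) measurable_fst).
have q0 h : 0 <= q h by apply: integral_ge0 => x _; rewrite lee_fin powR_ge0.
have mq : measurable_fun setT q.
  exact: (measurable_fun_fubini_tonelli_G (m1 := L) K mK (fun z => kcov_powR_ge0 _ _)).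
have QE h s : \int[L]_x Q (x, h) s = q h.
  have mKh : measurable_fun setT (fun x => K (x, h)) by exact: (measurableT_comp mK (measurable_pair2 h)).
  exact: (integral_shift (chord s h) mKh (fun x => kcov_powR_ge0 (w x) h)).
rewrite (eq_integral (fun h => D%:E * ((W h)%:E * q h))); last first.
  move=> h _; rewrite (eq_integral (fun=> q h)); last by move=> s _; exact: QE.
  transitivity ((W h)%:E * (q h * D%:E)); last by rewrite muleA muleC.
  by congr (_ * _); rewrite -PT; exact: integral_cst.
rewrite ge0_integralZl//; last 3 first.
- by apply: emeasurable_funM => //; exact/measurable_EFinP.
- by move=> h _; rewrite mule_ge0// lee_fin.
- by rewrite lee_fin ltW.
rewrite lee_wpmul2l ?lee_fin ?(ltW D0)//.
pose H (z : V * T) := (W z.2)%:E * K z.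
have mW2 : measurable_fun setT (fun z : V * T => (W z.2)%:E).
  by apply/measurable_EFinP; exact: (measurableT_comp mW measurable_snd).
have mH : measurable_fun setT H by exact: emeasurable_funM.
have H0 z : 0 <= H z by rewrite mule_ge0// ?lee_fin// powR_ge0.
rewrite (eq_integral (fun h => \int[L]_x H (x, h))); last first.
  move=> h _; transitivity (\int[L]_x ((W h)%:E * K (x, h))); last by [].
  rewrite ge0_integralZl//; last 3 first.
  - exact: (measurableT_comp mK (measurable_pair2 h)).
  - by move=> x _; exact: kcov_powR_ge0.
  - by rewrite lee_fin.
rewrite -(fubini_tonelli (m1 := L) (m2 := Lk) H mH H0) /H /K /=.
rewrite (eq_integral (fun x => sf%:E * sphere_power p (w x))); last first.
  by move=> x _; rewrite integral_slots_sphere_power.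
rewrite ge0_integralZl//.
- exact: measurable_sphere_power.
- by move=> x _; exact: sphere_power_ge0.
- by rewrite lee_fin ltW// slots_factor_gt0//; case/andP: t01.
Qed.

Lemma kcov_evalB (a b : kcovector R n k) h :
  (kcov_eval a h - kcov_eval b h = kcov_eval (a - b) h)%R.
Proof.
by rewrite /kcov_eval -sumrB; apply: eq_bigr => I _; rewrite !ffunE mulrBl.
Qed.

(** The mean oscillation of the form over a simplex is controlled by translations that
are no longer than its edges. *)
Lemma chord_integral_oscillation (e d : R) : (r < d)%R -> (0 <= e)%R ->
  (forall y, (enorm y < d)%R ->
    \int[L]_x ((\sum_I `|w (x + y)%R I - w x I|) `^ p)%:E <= e%:E) ->
  \int[L]_x \int[Lk]_h
    ((W h)%:E * (`|chord_integral (x, h) - kcov_eval (w x) h * D| `^ p)%:E) <=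
  (D `^ p * k`!%:R `^ p * area n ^+ k * sf * e)%:E.
Proof.
move=> rd e0 eP.
pose c (x : V) h := kcov_eval (w x) h.
pose Q (z : V * T) s := (`|chord_form (z, s) - c z.1 z.2| `^ p)%:E.
have mc : measurable_fun setT (fun z : V * T => c z.1 z.2).
  by apply: measurable_kcov_eval => // I; exact: (measurableT_comp (mw I) measurable_fst).
have mQ : measurable_fun setT (fun u : (V * T) * 'rV[R]_k => Q u.1 u.2).
  apply: (@measurable_normr_powR R p _ _ (fun u => chord_form (u.1, u.2) - c u.1.1 u.1.2)%R).
  apply: measurable_funB; last exact: (measurableT_comp mc measurable_fst).
  rewrite (_ : (fun u => _) = chord_form)//; by apply/funext => -[].
have Q0 z s : 0 <= Q z s by rewrite lee_fin powR_ge0.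
have mI : measurable_fun setT (fun z : V * T => \int[P]_s Q z s).
  exact: (measurable_fun_fubini_tonelli_F (m2 := P) (fun u => Q u.1 u.2) mQ (fun u => Q0 u.1 u.2)).
have I0 z : 0 <= \int[P]_s Q z s by apply: integral_ge0.
have mf : measurable_fun setT (fun z : V * T => chord_integral z - c z.1 z.2 * D)%R.
  by apply: measurable_funB; [exact: measurable_chord_integral|exact: measurable_funM].
apply: (le_trans (integral_chord_le mf mI I0 _)).
  by move=> z; exact: (Rintegral_powR_le p1 D0 PT (c z.1 z.2) (measurable_chord_form1 z)).
rewrite integral_chord_swap//.
pose C : R := (k`!%:R `^ p * e * D)%R.
have C0 : (0 <= C)%R by rewrite !mulr_ge0 ?powR_ge0// ltW.
have QP h s : std_simplex s -> (forall i, (enorm (tnth h i) < r)%R) ->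
    \int[L]_x Q (x, h) s <= (k`!%:R `^ p * e * norm_prod h `^ p)%:E.
  move=> Ds hr; pose y := chord s h.
  have yd : (enorm y < d)%R by apply: le_lt_trans rd; exact: chord_le.
  pose E (x : V) := ((\sum_I `|w (x + y)%R I - w x I|) `^ p)%:E.
  have mE : measurable_fun setT E.
    apply/measurable_EFinP; apply: measurableT_comp (measurable_powR _) _.
    apply: measurable_sum => I; apply: measurableT_comp => //; apply: measurable_funB => //.
    exact: (measurable_shift y (mw I)).
  have E0 x : 0 <= E x by rewrite lee_fin powR_ge0.
  have c0 : 0 <= ((k`!%:R * norm_prod h) `^ p)%:E :> \bar R by rewrite lee_fin powR_ge0.
  have np0 := norm_prod_ge0 h.
  apply: (@le_trans _ _ (\int[L]_x (((k`!%:R * norm_prod h) `^ p)%:E * E x))).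
    apply: ge0_le_integral => //.
    - apply: (measurableT_comp mQ (_ : measurable_fun setT (fun x : V => ((x, h), s)))).
      by apply: measurable_fun_pair => //; exact: measurable_fun_pair.
    - exact: measurable_funeM.
    - move=> x _; rewrite -EFinM lee_fin -powRM ?sumr_ge0 ?mulr_ge0//.
      apply: ler_powR2r => //; rewrite /chord_form /c /= kcov_evalB.
      apply: le_trans (kcov_eval_le _ _) _.
      rewrite -mulrA [leRHS]mulrC ler_wpM2r ?mulr_ge0//.
      by apply: ler_sum => I _; rewrite !ffunE.
  rewrite ge0_integralZl// powRM// (mulrAC _ e) EFinM.
  by apply: lee_wpmul2l (eP y yd); rewrite lee_fin mulr_ge0 ?powR_ge0.
pose G (u : V * (T * 'rV[R]_k)) := Q (u.1, u.2.1) u.2.2.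
have mG : measurable_fun setT G.
  apply: (measurableT_comp mQ (_ : measurable_fun setT
    (fun u : V * (T * 'rV[R]_k) => ((u.1, u.2.1), u.2.2)))).
  apply: measurable_fun_pair.
    by apply: measurable_fun_pair => //; exact: (measurableT_comp measurable_fst measurable_snd).
  exact: (measurableT_comp measurable_snd measurable_snd).
have G0 u : 0 <= G u by exact: Q0.
have mGx := measurable_fun_fubini_tonelli_G (m1 := L) G mG G0.
have G0x v : 0 <= \int[L]_x G (x, v) by apply: integral_ge0.
have mGs := measurable_fun_fubini_tonelli_F (m2 := P) _ mGx G0x.
apply: (@le_trans _ _ ((D `^ (p - 1))%:E *
    \int[Lk]_h (C%:E * ((W h)%:E * (norm_prod h `^ p)%:E)))).
  apply: lee_wpmul2l; first by rewrite lee_fin powR_ge0.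
  apply: ge0_le_integral => //.
  - by move=> h _; rewrite mule_ge0 ?lee_fin//; apply: integral_ge0 => s _; exact: (G0x (h, s)).
  - by apply: emeasurable_funM => //; exact/measurable_EFinP.
  - apply: measurable_funeM; apply: emeasurable_funM; first exact/measurable_EFinP.
    by apply/measurable_EFinP; apply: measurableT_comp (measurable_powR _) _; exact: measurable_norm_prod.
  move=> h _; have [/forallP hr|/forallPn[i hi]] := boolP [forall i, enorm (tnth h i) < r]%R; last first.
    suff -> : W h = 0%R by rewrite mul0e mul0e mule0.
    rewrite /slot_weights (bigD1 i)//= /slot_weight indicE memNset ?mulr0 ?mul0r//.
    by rewrite /eball/= sub0r enormN; exact/negP.
  rewrite muleCA; apply: lee_wpmul2l; first by rewrite lee_fin.
  have b0 : (0 <= k`!%:R `^ p * e * norm_prod h `^ p :> R)%R by rewrite !mulr_ge0 ?powR_ge0.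
  have := P_support (measurableT_comp mGx (measurable_pair1 h)) (fun s => G0x (h, s)) b0
    (fun s Ds => QP h s Ds hr).
  by rewrite -!EFinM /C [X in (_ <= X%:E -> _)%E]mulrAC.
rewrite ge0_integralZl//; last 2 first.
- apply: emeasurable_funM; first exact/measurable_EFinP.
  by apply/measurable_EFinP; apply: measurableT_comp (measurable_powR _) _; exact: measurable_norm_prod.
- by move=> h _; rewrite mule_ge0 ?lee_fin ?powR_ge0.
rewrite integral_slots_norm_prod// -!EFinM lee_fin /C -D_pow.
by rewrite le_eqVlt; apply/orP; left; apply/eqP; ring.
Qed.

End chords.
(** * Bounds for the functional *)

Section edge_coordinates.
Local Open Scope ereal_scope.
Context {R : realType} {n k : nat} (p : R).
Local Notation V := 'rV[R]_n.
Local Notation T := (k.-tuple V).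

Lemma powR_prodr I (s : seq I) (a : I -> R) (q : R) : (forall i, 0 <= a i)%R ->
  ((\prod_(i <- s) a i) `^ q = \prod_(i <- s) a i `^ q)%R.
Proof.
move=> a0; elim: s => [|i s IH]; first by rewrite !big_nil powR1.
by rewrite !big_cons powRM ?IH// prodr_ge0.
Qed.

Definition edge_weight (theta : R) (h : T) : R :=
  ((1 - theta) ^+ k / norm_prod h `^ (n%:R + theta * p))%R.

Definition short_edges (r : R) : set T := [set h | forall i, (enorm (tnth h i) < r)%R].

Lemma slot_weightsE theta r (h : T) :
  slot_weights p theta r h = (edge_weight theta h * \1_(short_edges r) h)%R.
Proof.
rewrite /slot_weights /slot_weight !big_split /= prodr_const card_ord /edge_weight -!mulrA.
congr (_ * (_ * _))%R.
  under eq_bigr do rewrite powRN.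
  by rewrite prodfV powR_prodr// => i; exact: enorm_ge0.
have eE i : eball 0 r (tnth h i) <-> (enorm (tnth h i) < r)%R by rewrite /eball/= sub0r enormN.
have [hr|hr] := pselect (short_edges r h).
  by rewrite indicE mem_set// big1// => i _; rewrite indicE mem_set//; apply/eE.
rewrite [RHS]indicE memNset//.
move/existsNP : hr => [i hi]; rewrite (bigD1 i)//= indicE memNset ?mul0r//.
by move/eE.
Qed.

Lemma edge_weight_ge0 theta h : (theta < 1)%R -> (0 <= edge_weight theta h)%R.
Proof. by move=> t1; rewrite divr_ge0 ?powR_ge0// exprn_ge0// subr_ge0 ltW. Qed.

Lemma measurable_edge_weight theta : measurable_fun setT (edge_weight theta).
Proof.
apply: measurable_funM => //; under eq_fun do rewrite -powRN.
exact: measurableT_comp (measurable_powR _) (@measurable_norm_prod R n k).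
Qed.

Definition translate (x : V) : T -> T := tuple_map (fun=> fun v : V => v + x)%R.

Lemma edges_translate x h : edges [tuple of x :: translate x h] = h.
Proof.
apply: eq_from_tnth => i; rewrite tnth_mktuple tnthS tnth0 tnth_mktuple.
by rewrite addrK.
Qed.

Lemma measurable_edges : measurable_fun setT (@edges R n k).
Proof.
apply/measurable_fun_tnthP => i.
rewrite (_ : _ \o _ = (fun X => tnth X (lift ord0 i) + (- tnth X ord0))%R); last first.
  by apply/funext => X /=; rewrite tnth_mktuple.
apply: measurable_addrV; first exact: measurable_tnth.
exact: measurableT_comp (@measurable_oppr R n) (measurable_tnth ord0).
Qed.

(** The domain of integration in the coordinates x_0, x_i - x_0. *)
Definition inside (Omega : set V) : set (V * T) :=
  [set z | Omega z.1 /\ forall i, Omega (tnth z.2 i + z.1)%R].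

Lemma measurable_inside Omega : measurable Omega -> measurable (inside Omega).
Proof.
move=> mO; have m2 : measurable_fun setT (fst : V * T -> V) by exact: measurable_fst.
rewrite (_ : inside Omega = (fst @^-1` Omega) `&`
   \bigcap_(i in [set: 'I_k]) ((fun z : V * T => tnth z.2 i + z.1)%R @^-1` Omega)).
  apply: measurableI; first by rewrite -[X in measurable X]setTI; exact: m2.
  apply: fin_bigcap_measurable => [|i _]; first exact: finite_finset.
  rewrite -[X in measurable X]setTI.
  have : measurable_fun setT (fun z : V * T => tnth z.2 i + z.1)%R.
    apply: measurable_addrV => //; exact: measurableT_comp (measurable_tnth i) measurable_snd.
  by apply.
apply/seteqP; split => z [z1 z2]; split => // i; first by move=> _; exact: z2.
exact: (z2 i).
Qed.

End edge_coordinates.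

Section functional.
Local Open Scope ereal_scope.
Context {R : realType} {n k : nat} (p : R).
Hypotheses (p1 : (1 <= p)%R) (kn : (k <= n)%N).
Local Notation V := 'rV[R]_n.
Local Notation T := (k.-tuple V).
Local Notation L := (@lebesgue_rV R n).
Local Notation Lk := (tuple_measure L k).
Local Notation P := (simplex_measure R k).
Local Notation D := (simplex_volume R k).

Let p0 : (0 < p)%R. Proof. exact: lt_le_trans p1. Qed.
Let D0 : (0 < D)%R. Proof. exact: simplex_volume_gt0. Qed.

Variable w : V -> kcovector R n k.
Hypothesis mw : forall I, measurable_fun setT (fun x => w x I).
Local Notation Iw := (chord_integral P w).

Let mI : measurable_fun setT Iw. Proof. exact: measurable_chord_integral. Qed.

Lemma integration_funE X : integration_fun w X = Iw (tnth X ord0, edges X).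
Proof.
rewrite /integration_fun -Rintegral_simplex//.
apply: measurable_kcov_eval => // J; apply: measurableT_comp (mw J) _.
by apply: measurable_addrV => //; apply: measurable_chord.
Qed.

Variable Omega : set V.
Hypothesis mO : measurable Omega.

(** In the coordinates x_0, x_i - x_0 the weight of the functional is the product of the
weights of the edges. *)
Lemma LpM_integralE theta : (theta < 1)%R ->
  LpM_integral p Omega (integration_fun w) theta =
  \int[L \x Lk]_z (\1_(inside Omega) z * edge_weight p theta z.2 * `|Iw z| `^ p)%:E.
Proof.
move=> t1; rewrite /LpM_integral.
set A := (X in integral _ X _); set g := (X in integral _ _ X).
have mA : measurable A by exact: (measurable_tuple_box (fun=> mO)).
pose G (z : V * T) := (\1_(inside Omega) z * edge_weight p theta z.2 * `|Iw z| `^ p)%:E.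
have mG : measurable_fun setT G.
  apply/measurable_EFinP; apply: measurable_funM.
    apply: measurable_funM; first by apply: measurable_indic; exact: measurable_inside.
    exact: measurableT_comp (measurable_edge_weight _ _) measurable_snd.
  by apply: measurableT_comp (measurable_powR _) _; exact: measurableT_comp.
have G0 z : 0 <= G z by rewrite lee_fin mulr_ge0 ?powR_ge0// mulr_ge0 ?edge_weight_ge0// indicE.
pose c (X : k.+1.-tuple V) : V * T := (tnth X ord0, edges X).
have mc : measurable_fun setT c.
  by apply: measurable_fun_pair; [exact: measurable_tnth|exact: measurable_edges].
rewrite integral_mkcond (_ : g \_ A = G \o c); last first.
  apply/funext => X; rewrite patchE /G /g /= integration_funE -/(c X).
  have AE : A X <-> inside Omega (c X).
    split=> [AX|[X1 X2]].
      by split => [|i] /=; rewrite ?tnth_mktuple ?subrK; exact: AX.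
    move=> i; case: (unliftP ord0 i) => [j ->|->//].
    by have := X2 j; rewrite /= tnth_mktuple subrK.
  case: ifPn => [|]; rewrite ?inE => AX.
    rewrite indicE mem_set ?mul1r; last exact/AE.
    by rewrite /edge_weight /norm_prod mulrAC.
  by rewrite indicE memNset ?mul0r// => /AE /mem_set; exact/negP.
rewrite integral_tuple_cons; last 2 first.
- exact: measurableT_comp.
- by move=> X; exact: G0.
transitivity (\int[L]_x \int[Lk]_h G (x, h)); last exact: (esym (fubini_tonelli1 (m1 := L) (m2 := Lk) G mG G0)).
apply: eq_integral => x _.
pose g' (t : T) := G (c [tuple of x :: t]).
have mg' : measurable_fun setT g'.
  exact: (measurableT_comp (measurableT_comp mG mc) (@measurable_cons1 _ _ k x)).
have := integral_tuple_map (fun=> lebesgue_rV_translation x) mg' (fun t => G0 _).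
move=> E; apply: eq_trans (esym E) _; apply: eq_integral => h _.
by rewrite /g' /c edges_translate tnth0.
Qed.

Lemma integral_pairE (f : V * T -> \bar R) : measurable_fun setT f -> (forall z, 0 <= f z) ->
  \int[L \x Lk]_z f z = \int[L]_x \int[Lk]_h f (x, h).
Proof. by move=> mf f0; rewrite (fubini_tonelli1 (m1 := L) (m2 := Lk) f mf f0). Qed.

Let measurable_slot_powR theta r (f : V * T -> R) : measurable_fun setT f ->
  measurable_fun setT (fun z : V * T => (slot_weights p theta r z.2)%:E * (`|f z| `^ p)%:E).
Proof.
move=> mf; apply: emeasurable_funM; last exact: measurable_normr_powR.
by apply/measurable_EFinP; exact: measurableT_comp (measurable_slot_weights _ _ _) measurable_snd.
Qed.

Let slot_powR_ge0 theta r (f : V * T -> R) z : (theta < 1)%R ->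
  0 <= (slot_weights p theta r z.2)%:E * (`|f z| `^ p)%:E.
Proof. by move=> t1; rewrite mule_ge0// lee_fin ?powR_ge0// slot_weights_ge0. Qed.

Let measurable_inside_powR theta :
  measurable_fun setT (fun z => (\1_(inside Omega) z * edge_weight p theta z.2 * `|Iw z| `^ p)%:E).
Proof.
apply/measurable_EFinP; apply: measurable_funM.
  apply: measurable_funM; first by apply: measurable_indic; exact: measurable_inside.
  exact: measurableT_comp (measurable_edge_weight _ _) measurable_snd.
by apply: measurableT_comp (measurable_powR _) _; exact: measurableT_comp.
Qed.

Let inside_powR_ge0 theta (z : V * T) : (theta < 1)%R ->
  0 <= (\1_(inside Omega) z * edge_weight p theta z.2 * `|Iw z| `^ p)%:E.
Proof.
by move=> t1; rewrite lee_fin mulr_ge0 ?powR_ge0// mulr_ge0 ?edge_weight_ge0// indicE.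
Qed.

Lemma LpM_integral_ge0 theta : (theta < 1)%R ->
  0 <= LpM_integral p Omega (integration_fun w) theta.
Proof.
move=> t1; rewrite LpM_integralE//; apply: integral_ge0 => z _; exact: inside_powR_ge0.
Qed.

(** All edges between points of a set of diameter less than r are shorter than r. *)
Lemma LpM_integral_le theta r : (0 < theta < 1)%R -> (0 < r)%R ->
  (forall x y, Omega x -> Omega y -> enorm (y - x) < r)%R ->
  LpM_integral p Omega (integration_fun w) theta <=
  (D `^ p * slots_factor n k p theta r)%:E * \int[L]_x sphere_power p (w x).
Proof.
move=> t01 r0 diam; have t1 : (theta < 1)%R by case/andP: t01.
apply: le_trans (chord_integral_le p1 kn D0 (simplex_measureT (k := k)) mw t01 r0).
have mS := measurable_slot_powR theta r mI.
rewrite -(integral_pairE mS) ?LpM_integralE//; last by move=> z; exact: slot_powR_ge0.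
apply: ge0_le_integral => //.
- by move=> z _; exact: inside_powR_ge0.
move=> z _; rewrite -EFinM lee_fin ler_wpM2r ?powR_ge0// slot_weightsE.
rewrite mulrC ler_wpM2l ?edge_weight_ge0// !indicE.
have [zO|_] := boolP (z \in inside Omega); last by rewrite ler0n.
rewrite mem_set// => i; move: zO; rewrite inE => -[zO /(_ i) ziO].
by have := diam _ _ zO ziO; rewrite addrK.
Qed.

Definition inner (r : R) : set V := [set x | forall y, enorm (x - y) < r -> Omega y]%R.

Lemma measurable_inner r : measurable (inner r).
Proof.
rewrite (_ : inner r = ~` \bigcup_(y in ~` Omega) eball y r).
  apply: measurableC; apply: open_rV_measurable.
  by apply: bigcup_open => y _; exact: open_eball.
apply/seteqP; split => [x xr [y nOy]|x nx y xy].
  by rewrite /eball/= -enormN opprB => /xr.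
apply: contrapT => nOy; apply: nx; exists y => //.
by rewrite /eball/= -enormN opprB.
Qed.

(** The domain contains all (x, h) with x in [inner r] and all edges shorter than r, so
that on it the full slot integrals are available. *)
Lemma LpM_integral_ge theta r (lam C B : R) : (0 < theta < 1)%R -> (0 < r)%R ->
  (0 <= lam)%R -> (0 <= C)%R ->
  (forall u v : R, 0 <= u -> 0 <= v -> (u + v) `^ p <= lam * u `^ p + C * v `^ p)%R ->
  \int[L]_x \int[Lk]_h ((slot_weights p theta r h)%:E *
    (`|Iw (x, h) - kcov_eval (w x) h * D| `^ p)%:E) <= B%:E ->
  (D `^ p * slots_factor n k p theta r)%:E * \int[L]_(x in inner r) sphere_power p (w x) <=
  lam%:E * LpM_integral p Omega (integration_fun w) theta + (C * B)%:E.
Proof.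
move=> t01 r0 lam0 C0 lamC osc; have t1 : (theta < 1)%R by case/andP: t01.
pose c (z : V * T) := (kcov_eval (w z.1) z.2 * D)%R.
have mc : measurable_fun setT c.
  apply: measurable_funM => //; apply: measurable_kcov_eval => // J.
  exact: measurableT_comp (mw J) measurable_fst.
have mIc : measurable_fun setT (fun z => Iw z - c z)%R by exact: measurable_funB.
have mir := measurable_inner r.
pose S r (f : V * T -> R) (z : V * T) := (slot_weights p theta r z.2)%:E * (`|f z| `^ p)%:E.
have mS f : measurable_fun setT f -> measurable_fun setT (S r f) by exact: measurable_slot_powR.
have S0 f z : 0 <= S r f z by exact: slot_powR_ge0.
pose J (z : V * T) : R := \1_(inner r) z.1.
have mJ : measurable_fun setT (EFin \o J).
  apply/measurable_EFinP; apply: (measurableT_comp (measurable_indic mir)).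
  exact: measurable_fst.
have J0 z : 0 <= (J z)%:E by rewrite lee_fin /J indicE.
have mJc : measurable_fun setT (fun z => (J z)%:E * S r c z).
  by apply: emeasurable_funM => //; exact: mS.
have JS0 z : 0 <= (J z)%:E * S r c z by rewrite mule_ge0.
have lhsE : (D `^ p * slots_factor n k p theta r)%:E * \int[L]_(x in inner r) sphere_power p (w x) =
    \int[L \x Lk]_z ((J z)%:E * S r c z).
  rewrite (integral_pairE mJc JS0) integral_mkcond -ge0_integralZl//; last 3 first.
  - apply: (iffLR (measurable_restrictT _ mir)); apply: measurable_funTS.
    exact: measurable_sphere_power.
  - by move=> x _; rewrite erestrict_ge0// => y _; exact: sphere_power_ge0.
  - by rewrite lee_fin mulr_ge0 ?powR_ge0// ltW// slots_factor_gt0.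
  apply: eq_integral => x _; rewrite patchE /J /=.
  under [RHS]eq_integral do rewrite indicE.
  case: ifP => xr /=; last first.
    by rewrite mule0 integral0_eq// => h _; rewrite mul0e.
  under [RHS]eq_integral do rewrite mul1e.
  rewrite EFinM -muleA -integral_slots_sphere_power// -ge0_integralZl//; last 3 first.
  - apply: emeasurable_funM; last exact: measurable_kcov_eval_powR.
    by apply/measurable_EFinP; exact: measurable_slot_weights.
  - by move=> h _; rewrite mule_ge0// lee_fin ?powR_ge0// slot_weights_ge0.
  - by rewrite lee_fin powR_ge0.
  apply: eq_integral => h _; rewrite muleCA /S /c /=; congr (_ * _).
  by rewrite -EFinM normrM (gtr0_norm D0) mulrC powRM// ltW.
rewrite lhsE.
pose G (z : V * T) := (\1_(inside Omega) z * edge_weight p theta z.2 * `|Iw z| `^ p)%:E.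
have mG : measurable_fun setT G by exact: measurable_inside_powR.
have G0 z : 0 <= G z by exact: inside_powR_ge0.
have mE := mS _ mIc.
apply: (@le_trans _ _ (\int[L \x Lk]_z (lam%:E * G z + C%:E * S r (fun z => Iw z - c z)%R z))).
  apply: ge0_le_integral => //.
    by apply: emeasurable_funD; exact: measurable_funeM.
  move=> z _; have [zr|zr] := boolP (z.1 \in inner r); last first.
    by rewrite /J indicE (negbTE zr) mul0e adde_ge0// mule_ge0.
  rewrite /J indicE zr mul1e.
  have key : (`|c z| `^ p <= lam * `|Iw z| `^ p + C * `|Iw z - c z| `^ p)%R.
    apply: le_trans (lamC _ _ (normr_ge0 _) (normr_ge0 _)); apply: ler_powR2r => //.
    by rewrite -[c z in leLHS](subKr (Iw z)) ler_normB.
  apply: (@le_trans _ _ ((slot_weights p theta r z.2)%:E *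
      (lam * `|Iw z| `^ p + C * `|Iw z - c z| `^ p)%:E)).
    by apply: lee_wpmul2l; rewrite lee_fin ?slot_weights_ge0.
  rewrite /S /G -!EFinM -EFinD lee_fin mulrDr [X in (_ + X)%R]mulrCA lerD2r mulrCA.
  rewrite ler_wpM2l// ler_wpM2r ?powR_ge0// slot_weightsE mulrC ler_wpM2r ?edge_weight_ge0//.
  rewrite !indicE; have [hr|_] := boolP (z.2 \in short_edges r); last by rewrite ler0n.
  move: zr hr; rewrite !inE => zr hr; rewrite mem_set//; split => [|i].
    by apply: zr; rewrite subrr enorm0.
  by apply: zr; rewrite opprD addrCA subrr addr0 enormN.
rewrite ge0_integralD//; last 4 first.
- by move=> z _; rewrite mule_ge0.
- exact: measurable_funeM.
- by move=> z _; rewrite mule_ge0.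
- exact: measurable_funeM.
rewrite !ge0_integralZl// LpM_integralE// leeD2l// EFinM.
apply: lee_wpmul2l; first by rewrite lee_fin.
by rewrite integral_pairE.
Qed.

End functional.
(** * Passage to the limit *)

Section slots_factor_limit.
Context {R : realType} {n : nat} (p : R).
Hypothesis p0 : 0 < p.

Lemma slots_factor_cvg k (r : R) : 0 < r ->
  slots_factor n k p theta r @[theta --> 1^'-] --> slot_factor_lim n p ^+ k.
Proof.
move=> r0.
suff H : (slot_factor n p theta * r `^ (p * (1 - theta)) @[theta --> 1^'-] --> slot_factor_lim n p)%R.
  exact: (cvg_comp _ _ H (@exprn_continuous R k _)).
rewrite -[X in _ --> X]mulr1.
apply: cvgM; first exact: slot_factor_cvg.
rewrite (_ : (fun theta => _) = (fun theta : R => expR (p * (1 - theta) * ln r))); last first.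
  by apply/funext => theta; rewrite /powR gt_eqF.
rewrite -[X in _ --> X](_ : expR (p * (1 - 1) * ln r) = 1); last first.
  by rewrite subrr mulr0 mul0r expR0.
have H : p * (1 - theta) * ln r @[theta --> (1 : R)] --> p * (1 - 1) * ln r.
  apply: cvgM; last exact: cvg_cst.
  by apply: cvgM; [exact: cvg_cst|apply: cvgB; [exact: cvg_cst|exact: cvg_id]].
exact: cvg_at_left_filter (cvg_comp _ _ H (@continuous_expR R _)).
Qed.

End slots_factor_limit.

Section ereal_limits.
Local Open Scope ereal_scope.
Context {R : realType}.

Lemma limf_esup_cvg (F : set_system R) {FF : ProperFilter F} (f : R -> \bar R) (l : R) :
  f @ F --> l%:E -> limf_esup f F = l%:E.
Proof.
move=> /fine_cvgP[ffin /cvgrPdist_le fl]; apply/eqP; rewrite eq_le; apply/andP; split.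
- apply/lee_addgt0Pr => e e0; apply: (@le_trans _ _ (ereal_sup (f @`
    [set x | f x \is a fin_num /\ `|l - fine (f x)| <= e]%R))).
    apply: ereal_inf_lbound; exists [set x | f x \is a fin_num /\ `|l - fine (f x)| <= e]%R => //.
    exact: filterI ffin (fl _ e0).
  apply: ge_ereal_sup => _ [x [fx xe] <-].
  rewrite -(fineK fx) -EFinD lee_fin -lerBlDl; apply: le_trans xe.
  by rewrite distrC ler_norm.
- apply: le_ereal_inf_tmp => _ [V FV <-]; apply/lee_subgt0Pr => e e0.
  have FA : F ([set x | f x \is a fin_num /\ `|l - fine (f x)| <= e]%R `&` V).
    by apply: filterI => //; exact: filterI ffin (fl _ e0).
  have [x [[fx xe] Vx]] := filter_ex FA.
  apply: (@le_trans _ _ (f x)); last by apply: ereal_sup_ubound; exists x.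
  rewrite -(fineK fx) -EFinB lee_fin lerBlDl -lerBlDr.
  by apply: le_trans xe; exact: ler_norm.
Qed.

(** The p-th root is uniformly continuous on [0, +oo[, by [powR_dist_le]. *)
Lemma poweR_root_cvg (F : set_system R) {FF : ProperFilter F} (p : R) (f : R -> \bar R) (l : R) :
  (1 <= p)%R -> (0 <= l)%R -> (\forall x \near F, 0 <= f x) ->
  f @ F --> l%:E -> f x `^ p^-1 @[x --> F] --> l%:E `^ p^-1.
Proof.
move=> p1 l0 f0 /fine_cvgP[ffin /cvgrPdist_le fl].
have p0 : (0 < p)%R by exact: lt_le_trans p1.
rewrite poweR_EFin; apply/fine_cvgP; split.
  by near=> x; apply: fin_num_poweR; near: x.
apply/cvgrPdist_le => e e0; near=> x; rewrite /= fine_poweR.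
have fx : f x \is a fin_num by near: x.
have fx0 : (0 <= fine (f x))%R by rewrite fine_ge0//; near: x.
have root (a : R) : (0 <= a)%R -> ((a `^ p^-1) `^ p = a)%R.
  by move=> a0; rewrite -powRrM mulVf ?gt_eqF// powRr1.
have d : (`|l - fine (f x)| <= e `^ p)%R by near: x; apply: fl; exact: powR_gt0.
have := powR_dist_le p1 (powR_ge0 l p^-1) (powR_ge0 (fine (f x)) p^-1).
rewrite !root// => /le_trans/(_ d) h; rewrite leNgt; apply/negP => he.
move: h; apply/negP; rewrite -ltNge; apply: gt0_ltr_powR; rewrite ?nnegrE//.
exact: ltW.
Unshelve. all: by end_near. Qed.

End ereal_limits.

Lemma measurable_kcov_norm_powR d (T : measurableType d) (R : realType) (n k : nat) (p : R)
    (u : T -> kcovector R n k) : (forall I, measurable_fun setT (fun x => u x I)) ->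
  measurable_fun setT (fun x => (kcov_norm (u x) `^ p)%:E).
Proof.
move=> mu; apply/measurable_EFinP; apply: measurableT_comp (measurable_powR _) _.
apply: measurableT_comp measurable_sqrt _; apply: measurable_sum => I.
exact: measurable_funX.
Qed.

Section limit.
Local Open Scope ereal_scope.
Context {R : realType} {n k : nat} (p : R).
Hypotheses (p1 : (1 <= p)%R) (kn : (k <= n)%N).
Local Notation V := 'rV[R]_n.
Local Notation L := (@lebesgue_rV R n).
Local Notation D := (simplex_volume R k).

Let p0 : (0 < p)%R. Proof. exact: lt_le_trans p1. Qed.
Let D0 : (0 < D)%R. Proof. exact: simplex_volume_gt0. Qed.

Variables (w : V -> kcovector R n k) (Omega : set V) (rho : R).
Hypotheses (mw : forall I, measurable_fun setT (fun x => w x I)) (oO : open Omega).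
Hypotheses (rho0 : (0 < rho)%R)
  (diam : forall x y, Omega x -> Omega y -> (enorm (y - x) < rho)%R).
Hypothesis w0 : {ae L, forall x, ~ Omega x -> w x = 0%R}.
Hypothesis woo : \int[L]_x (kcov_norm (w x) `^ p)%:E < +oo.

Let mO : measurable Omega. Proof. exact: open_rV_measurable. Qed.

Let measurable_norm_form : measurable_fun setT (fun x => (kcov_norm (w x) `^ p)%:E).
Proof. exact: measurable_kcov_norm_powR. Qed.

Let msp : measurable_fun setT (fun x => sphere_power p (w x)).
Proof. exact: measurable_sphere_power. Qed.

Let sp0 x : 0 <= sphere_power p (w x). Proof. exact: sphere_power_ge0. Qed.

Let coef_lty I : \int[L]_x (`|w x I| `^ p)%:E < +oo.
Proof.
apply: le_lt_trans woo; apply: ge0_le_integral => //.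
- exact: measurable_normr_powR.
- by move=> x _; rewrite lee_fin ler_powR2r// coef_le_kcov_norm.
Qed.

Let N : R := fine (\int[L]_x sphere_power p (w x)).

Let NE : \int[L]_x sphere_power p (w x) = N%:E.
Proof.
rewrite /N fineK// ge0_fin_numE; last by apply: integral_ge0.
have [C C0 CP] := @sphere_power_le R n k p p0 kn.
apply: (@le_lt_trans _ _ (\int[L]_x (C%:E * (kcov_norm (w x) `^ p)%:E))).
  apply: ge0_le_integral => //.
  exact: measurable_funeM.
rewrite ge0_integralZl//.
- by rewrite lte_mul_pinfty// lee_fin ltW.
- by move=> x _; rewrite lee_fin powR_ge0.
- by rewrite lee_fin ltW.
Qed.

Let N0 : (0 <= N)%R.
Proof. by rewrite -lee_fin -NE; apply: integral_ge0. Qed.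

(** An open set is the increasing union of the sets [inner r]. *)
Lemma inner_exhausts (e d : R) : (0 < e)%R -> (0 < d)%R ->
  exists r : R, [/\ (0 < r)%R, (r < d)%R &
    N%:E <= \int[L]_(x in inner Omega r) sphere_power p (w x) + e%:E].
Proof.
move=> e0 d0; pose F (i : nat) := inner Omega (i.+1%:R^-1 : R).
have mF i : measurable (F i) by exact: measurable_inner.
have ndF : nondecreasing_seq F.
  move=> i j ij; apply/subsetPset => x xi y xy; apply: xi; apply: lt_le_trans xy _.
  by rewrite lef_pV2 ?posrE// ler_nat ltnS.
have UF : \bigcup_i F i = Omega.
  apply/seteqP; split => [x [i _ xi]|x Ox].
    by apply: xi; rewrite subrr enorm0.
  have [r r0 rO] := open_eballP oO Ox.
  have := @near_infty_natSinv_lt R (PosNum r0).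
  case=> i _ /(_ i (leqnn _)) /= ir; exists i => // y xy.
  by apply: rO; exact: lt_trans ir.
have := @ge0_nondecreasing_set_cvg_integral _ _ _ F (fun x => sphere_power p (w x)) L ndF mF
  (fun i => measurable_funTS msp) (fun i x _ => sp0 x).
rewrite UF.
have -> : \int[L]_(x in Omega) sphere_power p (w x) = N%:E.
  rewrite -NE integral_mkcond; apply: ge0_ae_eq_integral => //.
  - by apply: (iffLR (measurable_restrictT _ mO)); exact: measurable_funTS.
  - by move=> x _; rewrite erestrict_ge0.
  apply: filterS w0 => x wx _; rewrite patchE; case: ifPn => //.
  rewrite notin_setE => /wx ->; apply/esym/eqP; rewrite eq_le sphere_power_ge0 andbT.
  have [C C0 CP] := @sphere_power_le R n k p p0 kn; apply: le_trans (CP _) _.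
  rewrite /kcov_norm big1 ?sqrtr0 ?powR0 ?mulr0// ?gt_eqF// => I _.
  by rewrite ffunE expr0n.
move=> /fine_cvgP[[i1 _ Ffin] /cvgrPdist_le/(_ _ e0)[i2 _ Fe]].
have [i3 _ i3d] := @near_infty_natSinv_lt R (PosNum d0).
pose i := maxn i1 (maxn i2 i3).
have ii1 : (i1 <= i)%N by rewrite leq_maxl.
have ii2 : (i2 <= i)%N by rewrite leq_max leq_maxl orbT.
have ii3 : (i3 <= i)%N by rewrite leq_max leq_maxr orbT.
exists (i.+1%:R^-1)%R; split; [by rewrite invr_gt0|exact: i3d|].
have /= fi := Ffin _ ii1; have /= := Fe _ ii2; rewrite -/(F i) => h.
rewrite -(fineK fi) -EFinD lee_fin -lerBlDl; exact: le_trans (ler_norm _) h.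
Qed.

Let kappa : R := (slot_factor_lim n p ^+ k)%R.

Let kappa0 : (0 < kappa)%R. Proof. by rewrite exprn_gt0// slot_factor_lim_gt0. Qed.

Let G theta := LpM_integral p Omega (integration_fun w) theta.

Let G_le theta : (0 < theta < 1)%R -> G theta <= (D `^ p * slots_factor n k p theta rho * N)%:E.
Proof.
by move=> t01; have := LpM_integral_le p1 kn mw mO t01 rho0 diam; rewrite NE -EFinM.
Qed.

Let G_fin theta : (0 < theta < 1)%R -> G theta = (fine (G theta))%:E.
Proof.
move=> t01; rewrite fineK// ge0_fin_numE; first exact: le_lt_trans (G_le t01) (ltry _).
by apply: LpM_integral_ge0 => //; case/andP: t01.
Qed.

Let G_fine_ge0 theta : (0 < theta < 1)%R -> (0 <= fine (G theta))%R.
Proof.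
move=> t01; rewrite -lee_fin -G_fin//.
by apply: LpM_integral_ge0 => //; case/andP: t01.
Qed.

(** The two errors, from the points near the boundary and from the oscillation of the
form, are each made smaller than eta / 2; r depends on them but not on theta. *)
Let G_ge (lam eta : R) : (1 < lam)%R -> (0 < eta)%R ->
  exists r M : R, [/\ (0 < r)%R, (D `^ p * kappa * N - eta <= kappa * M)%R &
    forall theta, (0 < theta < 1)%R ->
      (slots_factor n k p theta r * M <= lam * fine (G theta))%R].
Proof.
move=> lam1 eta0; have [C C0 lamC] := powR_perturb p1 lam1.
pose B : R := (D `^ p * k`!%:R `^ p * area n ^+ k)%R.
have B0 : (0 <= B)%R by rewrite !mulr_ge0 ?powR_ge0// exprn_ge0// ltW// area_gt0.
pose e1 : R := (eta / (2 * (D `^ p * kappa)))%R.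
pose e2 : R := (eta / (2 * (kappa * (C * B) + 1)))%R.
have Dp0 : (0 < D `^ p)%R by rewrite powR_gt0.
have e10 : (0 < e1)%R by rewrite divr_gt0// !mulr_gt0.
have CB0 : (0 <= kappa * (C * B))%R by rewrite mulr_ge0 ?(ltW kappa0)// mulr_ge0 ?(ltW C0).
have e20 : (0 < e2)%R by rewrite divr_gt0// mulr_gt0// ltr_wpDl.
have [d d0 dP] := family_shift p1 mw coef_lty e20.
have [r [r0 rd Nr]] := inner_exhausts e10 d0.
pose Nr' : R := fine (\int[L]_(x in inner Omega r) sphere_power p (w x)).
have mir := measurable_inner Omega r.
have Nr'E : \int[L]_(x in inner Omega r) sphere_power p (w x) = Nr'%:E.
  rewrite /Nr' fineK// ge0_fin_numE; last by apply: integral_ge0.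
  apply: (@le_lt_trans _ _ N%:E); last exact: ltry.
  rewrite -NE; apply: ge0_subset_integral => //.
exists r, (D `^ p * Nr' - C * (B * e2))%R; split => //.
  move: Nr; rewrite Nr'E -EFinD lee_fin => Nr.
  have h1 : (kappa * D `^ p * (N - Nr') <= eta / 2)%R.
    apply: (@le_trans _ _ (kappa * D `^ p * e1)%R).
      by rewrite ler_wpM2l ?mulr_ge0 ?(ltW kappa0) ?(ltW Dp0)// lerBlDl.
    rewrite /e1 le_eqVlt; apply/orP; left; apply/eqP; field.
    by rewrite !gt_eqF.
  have h2 : (kappa * (C * B) * e2 <= eta / 2)%R.
    rewrite /e2; move: CB0; set q := (kappa * (C * B))%R => q0.
    have q1 : (0 < q + 1)%R by rewrite ltr_wpDl.
    have -> : (q * (eta / (2 * (q + 1))) = eta / 2 * (q / (q + 1)))%R by field; rewrite gt_eqF.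
    by rewrite ler_piMr ?divr_ge0 ?(ltW eta0)// ler_pdivrMr// mul1r lerDl.
  have -> : (kappa * (D `^ p * Nr' - C * (B * e2)) =
    D `^ p * kappa * N - (kappa * D `^ p * (N - Nr')) - kappa * (C * B) * e2)%R by ring.
  by move: h1 h2; lra.
move=> theta t01.
have osc := chord_integral_oscillation p1 kn D0 (simplex_measureT (k := k))
  (@le_integral_simplex R k) mw t01 r0 rd (ltW e20) dP.
have := LpM_integral_ge p1 kn mw mO t01 r0 (ltW (lt_trans ltr01 lam1)) (ltW C0) lamC osc.
rewrite Nr'E -/(G theta) (G_fin t01) -!EFinM -EFinD lee_fin => h.
rewrite mulrBr lerBlDr; apply: le_trans (_ : _ <= D `^ p * slots_factor n k p theta r * Nr')%R _.
  by rewrite mulrA (mulrC (slots_factor _ _ _ _ _)).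
apply: le_trans h _; rewrite lerD2l /B le_eqVlt; apply/orP; left; apply/eqP; ring.
Qed.

(** The upper bound converges to the limit as it stands; in the lower bound the error
terms are chosen first and then theta tends to 1. *)
Lemma LpM_integral_cvg :
  LpM_integral p Omega (integration_fun w) theta @[theta --> 1%R^'-] -->
  (D `^ p * kappa * N)%:E.
Proof.
set l : R := (D `^ p * kappa * N)%R.
have l0 : (0 <= l)%R by rewrite !mulr_ge0 ?powR_ge0// ltW.
have near01 : \forall theta \near (1%R : R)^'-, (0 < theta < 1)%R.
  near=> theta; apply/andP; split; first by near: theta; exact: nbhs_left_gt.
  by near: theta; exact: nbhs_left_lt.
apply/fine_cvgP; split.
  near=> theta; rewrite -/(G theta) G_fin//; by near: theta.
apply/cvgrPdist_le => eta eta0.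
have up : (D `^ p * slots_factor n k p theta rho * N @[theta --> 1^'-] --> l)%R.
  apply: cvgM; last exact: cvg_cst; apply: cvgM; first exact: cvg_cst.
  exact: slots_factor_cvg.
have lower : \forall theta \near (1%R : R)^'-, (l - eta <= fine (G theta))%R.
  have [le_eta|lt_eta] := leP l eta.
    near=> theta; apply: (@le_trans _ _ 0%R); first by rewrite subr_le0.
    by apply: G_fine_ge0; near: theta.
  (* With lam = l / (l - eta / 2), the bound l - eta / 2 <= lam * G gives
     G >= (l - eta / 2)^2 / l >= l - eta. *)
  have l2 : (0 < l - eta / 2)%R by lra.
  have lam1 : (1 < l / (l - eta / 2))%R by rewrite ltr_pdivlMr// mul1r; lra.
  have eta8 : (0 < eta / 4)%R by rewrite divr_gt0.
  have [r [M [r0 lM rM]]] := G_ge lam1 eta8.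
  have lo : (slots_factor n k p theta r * M @[theta --> 1^'-] --> kappa * M)%R.
    by apply: cvgM; [exact: slots_factor_cvg|exact: cvg_cst].
  near=> theta.
  have t01 : (0 < theta < 1)%R by near: theta.
  have near_lo : (`|kappa * M - slots_factor n k p theta r * M| <= eta / 4)%R.
    by near: theta; move/cvgrPdist_le : lo; exact.
  have := rM _ t01; have := le_trans (ler_norm _) near_lo.
  move: lM; rewrite -/l => lM h1 h2.
  have h3 : (l - eta / 2 <= l / (l - eta / 2) * fine (G theta))%R by lra.
  have l00 : (0 < l)%R by lra.
  rewrite -(@ler_pM2l _ (l / (l - eta / 2))%R) ?divr_gt0//; apply: le_trans h3.
  rewrite mulrAC ler_pdivrMr//; nra.
near=> theta.
have t01 : (0 < theta < 1)%R by near: theta.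
have h1 : (l - eta <= fine (G theta))%R by near: theta.
have h2 : (fine (G theta) <= D `^ p * slots_factor n k p theta rho * N)%R.
  by rewrite -lee_fin -G_fin// G_le.
have h3 : (`|l - D `^ p * slots_factor n k p theta rho * N| <= eta)%R.
  by near: theta; move/cvgrPdist_le : up; exact.
move: h3; rewrite ler_norml => /andP[h3 _].
rewrite ler_norml; change (- eta <= l - fine (G theta) <= eta)%R.
by apply/andP; split; lra.
Unshelve. all: by end_near. Qed.

End limit.

Lemma bounded_diameter (R : realType) (n : nat) (Omega : set 'rV[R]_n) : bounded_set Omega ->
  exists2 rho : R, (0 < rho)%R &
  forall x y, Omega x -> Omega y -> (enorm (y - x) < rho)%R.
Proof.
move=> /= [M [_ MO]]; pose B : R := (`|M| + 1)%R.
have OB x : Omega x -> (`|x| <= B)%R.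
  by apply: MO; apply: le_lt_trans (ler_norm M) _; rewrite ltrDl.
have coord x i : Omega x -> (`|x ord0 i| <= B)%R.
  move=> /OB; apply: le_trans; rewrite [leRHS]mx_normrE.
  by rewrite (bigmaxD1 (ord0, i))//= le_max lexx.
exists (n%:R * (2 * B) + 1)%R.
  by rewrite ltr_wpDl// !mulr_ge0// addr_ge0.
move=> x y Ox Oy; apply: le_lt_trans (enorm_le_sum _) _.
rewrite ltr_pwDr//; apply: (@le_trans _ _ (\sum_(i < n) 2 * B)%R).
  apply: ler_sum => i _; rewrite !mxE; apply: le_trans (ler_normB _ _) _.
  by rewrite mulrDl mul1r lerD// coord.
by rewrite sumr_const card_ord [leRHS]mulr_natl.
Qed.

Section representatives.
Local Open Scope ereal_scope.
Context {R : realType} {n k : nat} (p : R).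
Hypotheses (p1 : (1 <= p)%R) (kn : (k <= n)%N).
Local Notation V := 'rV[R]_n.
Local Notation L := (@lebesgue_rV R n).

Let p0 : (0 < p)%R. Proof. exact: lt_le_trans p1. Qed.

Lemma Lp_normE (Omega : set V) (f : V -> \bar R) : (forall x, 0 <= f x) ->
  Lp_norm p Omega f = (\int[L]_x (((fun x => f x `^ p) \_ Omega) x)) `^ p^-1.
Proof.
move=> f0; rewrite /Lp_norm unlock; congr (_ `^ _); apply: eq_integral => x _.
rewrite !patchE; case: ifP => _; first by rewrite gee0_abs.
by change (`|0 : \bar R| `^ p = 0); rewrite abse0 poweR0r// gt_eqF.
Qed.

Variables (Omega : set V) (w w' : V -> kcovector R n k).
Hypotheses (mO : measurable Omega) (mw : measurable_form Omega w)
  (ww' : borel_representative (zero_ext Omega w) w').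

(** A nonnegative functional of covectors that vanishes at 0 has the same integral for
the form, its extension by zero and any representative of the latter. *)
Lemma integral_representative (Psi : kcovector R n k -> \bar R) :
  Psi 0%R = 0 -> (forall a, 0 <= Psi a) ->
  (forall u : V -> kcovector R n k, (forall I, measurable_fun setT (fun x => u x I)) ->
    measurable_fun setT (fun x => Psi (u x))) ->
  \int[L]_x (((fun x => Psi (w x)) \_ Omega) x) = \int[L]_x Psi (w' x).
Proof.
move=> Psi0 Psi_ge0 mPsi; have [mw' aew] := ww'.
rewrite (eq_integral (fun x => Psi (zero_ext Omega w x))); last first.
  move=> x _; rewrite patchE /zero_ext; case: ifPn => [|]; rewrite ?inE => Ox.
    by rewrite ifT//; exact/asboolP.
  by rewrite ifF ?Psi0//; apply/asboolP => /mem_set; exact/negP.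
apply: ge0_ae_eq_integral => //.
- apply: mPsi => I.
  rewrite (_ : (fun x => _) = (fun x => w x I) \_ Omega); last first.
    apply/funext => x; rewrite patchE /zero_ext; case: ifPn => [/asboolP Ox|/asboolP nOx].
      by rewrite mem_set.
    by rewrite memNset// ffunE.
  exact: (iffLR (measurable_restrictT _ mO) (mw I)).
- exact: mPsi.
- by apply: filterS aew => x -> _.
Qed.

Lemma kcov_norm0 : kcov_norm (0%R : kcovector R n k) = 0%R.
Proof. by rewrite /kcov_norm big1 ?sqrtr0// => I _; rewrite ffunE expr0n. Qed.

Lemma Lp_norm_form : Lp_norm p Omega (fun x => (kcov_norm (w x))%:E) =
  (\int[L]_x (kcov_norm (w' x) `^ p)%:E) `^ p^-1.
Proof.
rewrite Lp_normE => [|x]; last by rewrite lee_fin kcov_norm_ge0.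
rewrite -(@integral_representative (fun a => (kcov_norm a `^ p)%:E))//.
- by rewrite kcov_norm0 powR0// gt_eqF.
- by move=> a; rewrite lee_fin powR_ge0.
- by move=> u mu; exact: measurable_kcov_norm_powR.
Qed.

Lemma Lp_norm_sphere : Lp_norm p Omega (fun x => kcov_sphere_norm p (w x)) =
  (\int[L]_x sphere_power p (w' x)) `^ p^-1.
Proof.
rewrite Lp_normE => [|x]; last exact: poweR_ge0.
rewrite -(@integral_representative (sphere_power p))//.
- congr (_ `^ _); apply: eq_integral => x _; rewrite !patchE; case: ifP => // _.
  by rewrite /kcov_sphere_norm -poweRrM mulVf ?gt_eqF// poweRe1// sphere_power_ge0.
- apply/eqP; rewrite eq_le sphere_power_ge0 andbT.
  have [C C0 CP] := @sphere_power_le R n k p p0 kn; apply: le_trans (CP _) _.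
  by rewrite kcov_norm0 powR0 ?mulr0// gt_eqF.
- exact: sphere_power_ge0.
- by move=> u mu; exact: measurable_sphere_power.
Qed.

End representatives.

Section root.
Local Open Scope ereal_scope.
Context {R : realType} (p : R).
Hypothesis p0 : (0 < p)%R.

Lemma root_le (x y : \bar R) : 0 <= x -> x <= y -> x `^ p^-1 <= y `^ p^-1.
Proof.
move=> x0 xy; apply: gt0_ler_poweR => //; rewrite ?invr_ge0 ?(ltW p0)// in_itv/=.
- by rewrite x0 leey.
- by rewrite (le_trans x0 xy) leey.
Qed.

Lemma root_mull (a : R) (x : \bar R) : (0 <= a)%R -> 0 <= x ->
  (a%:E * x) `^ p^-1 = (a `^ p^-1)%:E * x `^ p^-1.
Proof. by move=> a0 x0; rewrite poweRM ?lee_fin. Qed.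

End root.
Theorem theorem1p3 (R : realType) (n k : nat) (p : R) :
  (k <= n)%N -> 1 <= p ->
  exists K c C : R, [/\ 0 < c, 0 < C &
    forall (Omega : set 'rV[R]_n) (w w' : 'rV[R]_n -> kcovector R n k),
      open Omega -> bounded_set Omega ->
      measurable_form Omega w ->
      (Lp_norm p Omega (fun x => (kcov_norm (w x))%:E) < +oo)%E ->
      borel_representative (zero_ext Omega w) w' ->
      [/\ (LpM_integral p Omega (integration_fun w') theta `^ p^-1)%E
            @[theta --> 1^'-] --> LpM_norm p Omega (integration_fun w'),
          LpM_norm p Omega (integration_fun w') =
            (K%:E * Lp_norm p Omega (fun x => kcov_sphere_norm p (w x)))%E,
          (c%:E * Lp_norm p Omega (fun x => (kcov_norm (w x))%:E) <=
            LpM_norm p Omega (integration_fun w'))%E &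
          (LpM_norm p Omega (integration_fun w') <=
            C%:E * Lp_norm p Omega (fun x => (kcov_norm (w x))%:E))%E]].
Proof.
move=> kn p1; have p0 : 0 < p by exact: lt_le_trans p1.
have [c c0 cP] := @sphere_power_ge R n k p p0 kn.
have [C C0 CP] := @sphere_power_le R n k p p0 kn.
pose D : R := simplex_volume R k.
pose A : R := D `^ p * slot_factor_lim n p ^+ k.
have A0 : 0 < A.
  by rewrite mulr_gt0 ?powR_gt0 ?simplex_volume_gt0// exprn_gt0// slot_factor_lim_gt0.
pose K : R := A `^ p^-1; have K0 : 0 < K by rewrite powR_gt0.
exists K, (K * c `^ p^-1), (K * C `^ p^-1); split; rewrite ?mulr_gt0 ?powR_gt0//.
move=> Omega w w' oO bO mw woo ww'; have [mw' aew] := ww'.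
have mO : measurable Omega by exact: open_rV_measurable.
have [rho rho0 diam] := bounded_diameter bO.
have w0 : {ae lebesgue_rV, forall x, ~ Omega x -> w' x = 0}.
  by apply: filterS aew => x -> nOx; rewrite /zero_ext ifF//; exact/asboolP.
move: woo; rewrite (Lp_norm_form p1 mO mw ww') (Lp_norm_sphere p1 kn mO mw ww').
move=> /(lty_poweRy (lt0r_neq0 (_ : 0 < p^-1))); rewrite invr_gt0 => /(_ p0) woo.
have mN : measurable_fun setT (fun x => (kcov_norm (w' x) `^ p)%:E).
  exact: measurable_kcov_norm_powR.
have mS := measurable_sphere_power p0 kn mw'.
have N0 : (0 <= \int[lebesgue_rV]_x sphere_power p (w' x))%E.
  by apply: integral_ge0 => x _; exact: sphere_power_ge0.
have B0 : (0 <= \int[lebesgue_rV]_x (kcov_norm (w' x) `^ p)%:E)%E.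
  by apply: integral_ge0 => x _; rewrite lee_fin powR_ge0.
have lowN : (c%:E * \int[lebesgue_rV]_x (kcov_norm (w' x) `^ p)%:E <=
    \int[lebesgue_rV]_x sphere_power p (w' x))%E.
  rewrite -ge0_integralZl ?lee_fin ?(ltW c0)//; last by move=> x _; rewrite lee_fin powR_ge0.
  apply: ge0_le_integral => //.
  - by move=> x _; rewrite mule_ge0// lee_fin ?powR_ge0// ltW.
  - exact: measurable_funeM.
  - by move=> x _; rewrite -EFinM; exact: cP.
have upN : (\int[lebesgue_rV]_x sphere_power p (w' x) <=
    C%:E * \int[lebesgue_rV]_x (kcov_norm (w' x) `^ p)%:E)%E.
  rewrite -ge0_integralZl ?lee_fin ?(ltW C0)//; last by move=> x _; rewrite lee_fin powR_ge0.
  apply: ge0_le_integral => //.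
  - by move=> x _; exact: sphere_power_ge0.
  - exact: measurable_funeM.
have Nfin : (\int[lebesgue_rV]_x sphere_power p (w' x))%E \is a fin_num.
  rewrite ge0_fin_numE//; apply: le_lt_trans upN _.
  by rewrite lte_mul_pinfty// lee_fin ltW.
have Gcvg := LpM_integral_cvg p1 kn mw' oO rho0 diam w0 woo.
have normE : LpM_norm p Omega (integration_fun w') =
    (K%:E * (\int[lebesgue_rV]_x sphere_power p (w' x)) `^ p^-1)%E.
  rewrite /LpM_norm (limf_esup_cvg Gcvg) -/D -/A EFinM (fineK Nfin).
  by rewrite root_mull// ltW.
split=> //.
- rewrite /LpM_norm (limf_esup_cvg Gcvg); apply: poweR_root_cvg => //.
  + by rewrite mulr_ge0 ?fine_ge0// ltW.
  + near=> theta; apply: LpM_integral_ge0 => //; near: theta; exact: nbhs_left_lt.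
- rewrite normE EFinM -muleA; apply: lee_wpmul2l; first by rewrite lee_fin ltW.
  rewrite -root_mull ?(ltW c0)//; apply: root_le => //.
  by rewrite mule_ge0// lee_fin ltW.
- rewrite normE EFinM -muleA; apply: lee_wpmul2l; first by rewrite lee_fin ltW.
  by rewrite -root_mull ?(ltW C0)//; exact: root_le.
Unshelve. all: by end_near. Qed.
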